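(* Let $\mathcal{H}$ be a one-parameter group of hyperbolic translations of $\mathbb{H}^3$ fixing two points $p,q\in\mathbb{H}^3_\infty$. Then totally geodesic planes containing both points are the only horo-shrinkers invariant by the group $\mathcal{H}$.
   Context: $\mathbb{H}^3$ is hyperbolic space in the upper half-space model, i.e. $\mathbb{R}^3_+=\{(x,y,z)\in\mathbb{R}^3: z>0\}$ with the metric $\langle\cdot,\cdot\rangle=\frac{1}{z^2}(dx^2+dy^2+dz^2)$; its ideal boundary $\mathbb{H}^3_\infty$ is the one-point compactification of the plane $z=0$. A horo-shrinker in $\mathbb{H}^3$ is an isometric immersion $\Psi:\Sigma\to\mathbb{H}^3$ of an oriented smooth surface $\Sigma$ whose mean curvature $H$ satisfies $H=\langle N,\partial_z\rangle$, where $N$ is the unit normal of $\Sigma$. The mean curvature is the average of the principal curvatures, with the sign convention that the horosphere $z=c$ with $N=c\,\partial_z$ has $H=1$; equivalently $H=zH_e+(N^e)_3$, where $H_e$ is the Euclidean mean curvature, $N^e=N/z$ is the Euclidean unit normal and $(\cdot)_3$ denotes the third coordinate. A hyperbolic translation of $\mathbb{H}^3$ is an isometry that leaves fixed two points of the ideal boundary $\mathbb{H}^3_\infty$; for example, when these two points are the origin $O$ of $\mathbb{R}^3$ and $\infty$, the corresponding one-parameter group is the group of Euclidean homotheties $\{(x,y,z)\mapsto t(x,y,z): t>0\}$.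
   Formalization: Invariant horo-shrinkers (connected) are shown to lie in a totally geodesic plane containing both points and to equal it if closed, as open sectors of vertical planes are also invariant; the converse covers only planes with ∞ in their ideal boundary, as hemispheres are not horo-shrinkers. *)

(* Defs.v *)
From HB Require Import structures.
From mathcomp Require Import all_boot all_order all_algebra.
From mathcomp Require Import all_classical all_reals all_analysis.

Set Implicit Arguments.
Unset Strict Implicit.
Unset Printing Implicit Defensive.

Import Order.TTheory GRing.Theory Num.Theory.
Import numFieldNormedType.Exports.

Local Open Scope classical_set_scope.
Local Open Scope ring_scope.

Section Calculus.
Context {R : realType}.

Definition basis_vec {n : nat} (i : 'I_n) : 'rV[R]_n := delta_mx 0 i.

(* [Ck_on k U f]: all iterated partial derivatives of [f] of order at most [k]
   exist and are continuous at every point of [U], which is meant to be open. *)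
Fixpoint Ck_on {n m : nat} (k : nat) (U : set 'rV[R]_n)
    (f : 'rV[R]_n -> 'rV[R]_m) : Prop :=
  (forall x, U x -> {for x, continuous f}) /\
  if k is k'.+1 then
    forall i : 'I_n, (forall x, U x -> derivable f x (basis_vec i)) /\
      Ck_on k' U (fun x => 'D_(basis_vec i) f x)
  else True.

Definition smooth_on {n m : nat} (U : set 'rV[R]_n)
    (f : 'rV[R]_n -> 'rV[R]_m) : Prop := forall k, Ck_on k U f.

(* Row [i] is the [i]-th partial derivative. *)
Definition partials {n m : nat} (f : 'rV[R]_n -> 'rV[R]_m) (x : 'rV[R]_n) :
  'M[R]_(n, m) := \matrix_(i < n) 'D_(basis_vec i) f x.

End Calculus.

Section Surfaces.
Variable R : realType.

(* [chart_map] and [chart_inv] are only meaningful on [chart_dom] and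
   [chart_cod]; see [is_chart]. *)
Record chart (S : topologicalType) := Chart {
  chart_dom : set S;
  chart_cod : set 'rV[R]_2;
  chart_map : S -> 'rV[R]_2;
  chart_inv : 'rV[R]_2 -> S
}.

Definition is_chart (S : topologicalType) (c : chart S) : Prop :=
  [/\ open (chart_dom c),
      open (chart_cod c),
      forall s, chart_dom c s ->
        [/\ chart_cod c (chart_map c s), chart_inv c (chart_map c s) = s
          & {for s, continuous (chart_map c)}]
    & forall x, chart_cod c x ->
        [/\ chart_dom c (chart_inv c x), chart_map c (chart_inv c x) = x
          & {for x, continuous (chart_inv c)}]].

Definition transition_dom (S : topologicalType) (c d : chart S) : set 'rV[R]_2 :=
  [set x | chart_cod c x /\ chart_dom d (chart_inv c x)].

Definition transition (S : topologicalType) (c d : chart S) :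
  'rV[R]_2 -> 'rV[R]_2 := fun x => chart_map d (chart_inv c x).

Record oriented_surface := OrientedSurface {
  carrier :> topologicalType;
  atlas : set (chart carrier);
  surface_nonempty : [set: carrier] !=set0;
  surface_connected : connected [set: carrier];
  surface_hausdorff : hausdorff_space carrier;
  surface_second_countable : @second_countable carrier;
  atlas_chart : forall c, atlas c -> is_chart c;
  atlas_cover : forall s : carrier, exists2 c, atlas c & chart_dom c s;
  atlas_smooth : forall c d, atlas c -> atlas d ->
    smooth_on (transition_dom c d) (transition c d);
  atlas_oriented : forall c d, atlas c -> atlas d ->
    forall x, transition_dom c d x -> 0 < \det (partials (transition c d) x)
}.

End Surfaces.

Section HyperbolicSpace.
Context {R : realType}.
Implicit Types (x u v : 'rV[R]_3) (X : 'rV[R]_2 -> 'rV[R]_3).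

Definition height x : R := x 0 ord_max.

Definition H3 : set 'rV[R]_3 := [set x | 0 < height x].

Definition dz : 'rV[R]_3 := basis_vec ord_max.

Definition dotp u v : R := (u *m v^T) 0 0.

Definition hmetric x u v : R := dotp u v / height x ^+ 2.

(* Indices are taken modulo 3 in ['I_3]. *)
Definition crossp u v : 'rV[R]_3 :=
  \row_(k < 3) (u 0 (k + 1) * v 0 (k + 1 + 1) - u 0 (k + 1 + 1) * v 0 (k + 1)).

(* The Levi-Civita connection of [hmetric] is
   [nabla_u V = D_u V + christoffel x u V]: the metric is exp(2 rho) times the
   Euclidean one with rho = - ln z, and a conformal change adds
   u(rho) V + V(rho) u - (u . V) grad rho, where grad rho = - dz / z. *)
Definition christoffel x u v : 'rV[R]_3 :=
  - (height x)^-1 *: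
    (height u *: v + height v *: u - dotp u v *: dz).

(* In what follows [X] is a local parametrization of a surface in [H3]. *)

Definition first_form X (x : 'rV[R]_2) : 'M[R]_2 :=
  \matrix_(i < 2, j < 2)
    hmetric (X x) ('D_(basis_vec i) X x) ('D_(basis_vec j) X x).

(* The unit normal for [hmetric]: it is [height] times the Euclidean one. *)
Definition unit_normal X (x : 'rV[R]_2) : 'rV[R]_3 :=
  let w := crossp ('D_(basis_vec 0) X x) ('D_(basis_vec 1) X x) in
  (height (X x) / Num.sqrt (dotp w w)) *: w.

Definition second_form X (x : 'rV[R]_2) : 'M[R]_2 :=
  \matrix_(i < 2, j < 2)
    hmetric (X x)
      ('D_(basis_vec i) (fun y => 'D_(basis_vec j) X y) x +
       christoffel (X x) ('D_(basis_vec i) X x) ('D_(basis_vec j) X x))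
      (unit_normal X x).

(* The principal curvatures are the eigenvalues of the shape operator. *)
Definition shape_operator X (x : 'rV[R]_2) : 'M[R]_2 :=
  invmx (first_form X x) *m second_form X x.

Definition mean_curvature X (x : 'rV[R]_2) : R := \tr (shape_operator X x) / 2.

(* The surface carries the metric induced by [Psi], so an isometric immersion
   is just an immersion. *)
Definition immersion_H3 (S : oriented_surface R) (Psi : S -> 'rV[R]_3) : Prop :=
  (forall s, H3 (Psi s)) /\
  forall c, atlas c ->
    smooth_on (chart_cod c) (Psi \o chart_inv c) /\
    forall y, chart_cod c y -> row_free (partials (Psi \o chart_inv c) y).

Definition horo_shrinker (S : oriented_surface R) (Psi : S -> 'rV[R]_3) : Prop :=
  immersion_H3 Psi /\
  forall c, atlas c -> forall y, chart_cod c y ->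
    let X := Psi \o chart_inv c in
    mean_curvature X y = hmetric (X y) (unit_normal X y) dz.

Definition closed_in_H3 (A : set 'rV[R]_3) : Prop := closure A `&` H3 `<=` A.

(* A connected totally geodesic surface is an open piece of a totally geodesic
   plane; being closed in [H3] makes it the whole plane. *)
Definition totally_geodesic_plane (P : set 'rV[R]_3) : Prop :=
  closed_in_H3 P /\
  exists (S : oriented_surface R) (Psi : S -> 'rV[R]_3),
    [/\ immersion_H3 Psi,
        forall c, atlas c -> forall y, chart_cod c y ->
          second_form (Psi \o chart_inv c) y = 0
      & range Psi = P].

(* [None] is the point at infinity of the plane z = 0. *)
Definition ideal_point : Type := one_point_compactification 'rV[R]_2.

Definition ideal_origin : ideal_point := Some 0.
Definition ideal_infinity : ideal_point := None.

Definition ideal_embed (a : ideal_point) : one_point_compactification 'rV[R]_3 :=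
  omap (fun u : 'rV[R]_2 => row_mx u (0 : 'rV[R]_1) : 'rV[R]_3) a.

(* The trace on [H3] of the neighborhoods of an ideal point in the one-point
   compactification of R^3. *)
Definition ideal_nbhs (a : ideal_point) : set_system 'rV[R]_3 :=
  [set A | exists2 U : set (one_point_compactification 'rV[R]_3),
             nbhs (ideal_embed a) U & H3 `&` (Some @^-1` U) `<=` A].

Definition at_infinity (P : set 'rV[R]_3) (a : ideal_point) : Prop :=
  forall A, ideal_nbhs a A -> P `&` A !=set0.

Definition isometry_H3 (g : 'rV[R]_3 -> 'rV[R]_3) : Prop :=
  [/\ set_bij H3 H3 g,
      smooth_on H3 g
    & forall x u v, H3 x -> hmetric (g x) ('D_u g x) ('D_v g x) = hmetric x u v].

(* The continuous extension of [g] to the ideal boundary maps [a] to [b]. *)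
Definition ideal_maps (g : 'rV[R]_3 -> 'rV[R]_3) (a b : ideal_point) : Prop :=
  g @ ideal_nbhs a --> ideal_nbhs b.

Definition hyperbolic_translation (p q : ideal_point)
    (f : 'rV[R]_3 -> 'rV[R]_3) : Prop :=
  [/\ isometry_H3 f, ideal_maps f p p & ideal_maps f q q].

(* The group is the image of the homotheties, which are the translations for
   the origin and infinity, under an isometry [g] taking these points to [p]
   and [q]. Asking only for isometries fixing [p] and [q] would also allow the
   rotations about the geodesic joining them. *)
Definition translation_group (p q : ideal_point)
    (h : R -> 'rV[R]_3 -> 'rV[R]_3) : Prop :=
  (forall t, 0 < t -> hyperbolic_translation p q (h t)) /\
  exists g : 'rV[R]_3 -> 'rV[R]_3,
    [/\ isometry_H3 g,
        ideal_maps g ideal_origin p,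
        ideal_maps g ideal_infinity q
      & forall t x, 0 < t -> H3 x -> h t (g x) = g (t *: x)].

Definition invariant_by (h : R -> 'rV[R]_3 -> 'rV[R]_3)
    (A : set 'rV[R]_3) : Prop := forall t, 0 < t -> h t @` A = A.

End HyperbolicSpace.

Arguments ideal_point R : clear implicits.

(* Main.v *)
From HB Require Import structures.
From mathcomp Require Import all_boot all_order all_algebra.
From mathcomp Require Import all_classical all_reals all_analysis.
From mathcomp Require Import ring lra.
Require Import Defs.
Set Implicit Arguments.
Unset Strict Implicit.
Unset Printing Implicit Defensive.
Import Order.TTheory GRing.Theory Num.Theory.
Import numFieldNormedType.Exports.
Local Open Scope classical_set_scope.
Local Open Scope ring_scope.

(** A horo-shrinker invariant under the group is a cone, and the equation of
    horo-shrinkers is homogeneous along cones except for one term; that term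
    has to vanish, which makes the cone vertical and therefore flat. Arbitrary
    fixed points p and q reduce to 0 and infinity as follows.

    The point (x, y, z) of the half-space lifts to the vector
    (1, x, y, x^2 + y^2 + z^2) / z of R^4, which has square 1 for the Lorentz
    form [mink], and the hyperbolic metric is minus that form on derivatives of
    lifts ([mink_dlift]). An isometry of the half-space acts on lifts as a
    linear Lorentz map ([isometry_lorentz]). The second fundamental form and the
    horo-shrinker equation are determinants in the lift and its derivatives,
    where the field dz enters through a constant null vector L
    ([second_form0P], [minkowski_eqP]). Thus an isometry carries the equation
    with the vector L to the equation with the image of L ([patch_shrinker]).

    Let Psi be an invariant horo-shrinker, g the isometry that takes 0 and
    infinity to p and q, and Phi = g^-1 o Psi. The image of Phi is invariant
    under homotheties. If the position vector were transverse to Phi somewhere,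
    the homotheties would sweep out an open set, whereas the image of a surface
    is meagre ([range_no_interior]); so Phi is tangent to the position vector
    ([homothety_tangent]). Differentiating the equation along this tangent field
    leaves nu_3 (L_0 |X|^2 - L_3) = 0, where nu is the Euclidean normal, and
    since L is null and nonzero nu_3 vanishes ([cone_vertical]). A vertical cone
    has zero second fundamental form ([cone_flat]).

    Totally geodesic surfaces lie in a quadric m_0 + m_1 x + m_2 y + m_3 r^2 = 0:
    the covector m of the tangent hyperplane in R^4 stays proportional to itself
    along the surface, and the surface is connected ([geodesic_quad]). For Phi
    one has m_0 = m_3 = 0, a vertical plane through the origin. Its image under
    g is the required plane P ([vertical_plane_geodesic]), and a surface that is
    closed in H^3 fills it ([immersed_covers]).

    Conversely, an ideal point of a totally geodesic plane gives a linear
    condition on m ([boundary_quad0]). The point at infinity gives m_3 = 0,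
    that is nu_3 = 0, and then both sides of the horo-shrinker equation vanish
    ([plane_normal]). The points p and q give m_0 = m_3 = 0 for the plane pulled
    back by g ([boundary_limit]), so this plane is invariant under homotheties. *)

(** * Calculus on row vectors *)

(** The contraction theorem and the theorem of Baire are stated for complete
    spaces; this instance lets row vectors be recognized as complete. *)
HB.instance Definition _ (R : realType) n := Uniform_isComplete.Build 'rV[R]_n cauchy_cvg.

Lemma add_halves_le {R : realType} (e u v : R) : u <= e / 2 -> v <= e / 2 -> u + v <= e.
Proof. by move=> *; lra. Qed.

Lemma quarter_mul3_lt {R : realType} (r : R) : 0 < r -> (r / 4) *+ 3 < r.
Proof. by move=> r0; rewrite mulrS mulr2n; lra. Qed.

Section PointwiseRules.
Context {R : realType} {V : normedModType R}.
Implicit Types (f g : V -> R) (x v : V).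

Lemma is_derive_add f g x v df dg : is_derive x v f df -> is_derive x v g dg ->
  is_derive x v (fun y => f y + g y) (df + dg).
Proof. by move=> ? ?; exact: is_deriveD. Qed.

Lemma is_derive_opp f x v df : is_derive x v f df ->
  is_derive x v (fun y => - f y) (- df).
Proof. by move=> ?; exact: is_deriveN. Qed.

Lemma is_derive_mul f g x v df dg : is_derive x v f df -> is_derive x v g dg ->
  is_derive x v (fun y => f y * g y) (df * g x + f x * dg).
Proof.
move=> ? ?; apply: is_derive_eq (is_deriveM _ _) _.
by rewrite /GRing.scale /= addrC [g x * df]mulrC.
Qed.

Lemma is_derive_inv f x v df : f x != 0 -> is_derive x v f df ->
  is_derive x v (fun y => (f y)^-1) (- df / f x ^+ 2).
Proof.
move=> fx0 [df0 <-].
apply: DeriveDef; first exact: derivableV.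
by rewrite deriveV // /GRing.scale /= mulNr mulNr mulrC.
Qed.

Lemma is_derive_const (a : R) x v : is_derive x v (fun=> a) 0.
Proof. exact: is_derive_cst. Qed.

Lemma is_derive_unique f x v a b : is_derive x v f a -> is_derive x v f b -> a = b.
Proof. by move=> [_ <-] [_ <-]. Qed.

Lemma is_derive_along_line f (p v : V) (t : R) :
  derivable f (p + t *: v) v ->
  is_derive t 1 (fun s : R => f (p + s *: v)) ('D_v f (p + t *: v)).
Proof.
move=> dv.
have E : (fun h : R => h^-1 *: ((f \o shift (p + t *: v)) (h *: v) - f (p + t *: v)))
       = (fun h : R => h^-1 *: (((fun s : R => f (p + s *: v)) \o shift t) (h *: 1)
                          - f (p + t *: v))).
  apply/funext => h /=; congr (_ *: (f _ - _)).
  by rewrite scalerDl [h *: 1]mulr1 addrCA.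
apply: DeriveDef; first by rewrite /derivable -E.
by rewrite /derive -E.
Qed.

End PointwiseRules.

(** The step is s v with any sign of s, hence t s in place of an interval. *)
Lemma mvt_line {R : realType} {V : normedModType R} (f : V -> R) (p v : V) (s : R) :
  (forall t : R, 0 <= t <= 1 -> derivable f (p + (t * s) *: v) v) ->
  exists2 t : R, 0 <= t <= 1 & f (p + s *: v) - f p = s * 'D_v f (p + (t * s) *: v).
Proof.
move=> df.
pose phi := fun t : R => f (p + (t * s) *: v).
pose dphi := fun t : R => s * 'D_v f (p + (t * s) *: v).
have dphiP (t : R) : 0 <= t <= 1 -> is_derive t 1 phi (dphi t).
  move=> t01.
  have h1 := is_derive_along_line (df t t01).
  have h2 : is_derive t 1 (fun t : R => t * s) (1 * s + t * 0).
    exact: (@is_derive_mul R R id (fun=> s)).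
  have := @is_derive1_comp R (fun s : R => f (p + s *: v)) ( *%R^~ s) t _ _ h1 h2.
  by rewrite /dphi mulr0 addr0 mul1r mulrC.
have [||c c01 E] := @MVT_segment R phi dphi 0 1 ler01.
- by move=> x; rewrite in_itv /= => /andP[x0 x1]; apply: dphiP; rewrite !ltW.
- apply: derivable_within_continuous => x; rewrite in_itv /= => x01.
  by case: (dphiP x x01).
- exists c; first by move: c01; rewrite in_itv.
  by move: E; rewrite /phi /dphi mul1r mul0r scale0r addr0 subr0 mulr1.
Qed.

Section RowVectors.
Context {R : realType} {n : nat}.
Implicit Types (x y a b : 'rV[R]_n).

Lemma ball_rowE x (r : R) y :
  ball x r y <-> 0 < r /\ forall j, `|x 0 j - y 0 j| < r.
Proof.
split=> [[r0 h]|[r0 h]]; split=> // i; first by move: (h 0 i).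
by move=> j; rewrite ord1; exact: h.
Qed.

Lemma coord_le_norm a j : `|a 0 j| <= `|a|.
Proof.
rewrite [leRHS]/Num.norm /= mx_normrE.
exact: (le_bigmax _ (fun ij : 'I_1 * 'I_n => `|a ij.1 ij.2|) (0, j)).
Qed.

Lemma norm_le_coord a (c : R) : 0 <= c -> (forall j, `|a 0 j| <= c) -> `|a| <= c.
Proof.
move=> c0 h; rewrite [leLHS]/Num.norm /= mx_normrE.
by apply: bigmax_le => // -[i j] _ /=; rewrite ord1.
Qed.

Lemma basis_vecE (i j : 'I_n) : (basis_vec i : 'rV[R]_n) 0 j = (i == j)%:R.
Proof. by rewrite /basis_vec mxE eqxx eq_sym. Qed.

(* A path from b to a that changes one coordinate at a time; it stays in
   every box that contains both ends. *)
Let hybrid a b (k : nat) : 'rV[R]_n := \row_i (if (i < k)%N then a 0 i else b 0 i).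

(** Only the partial derivatives are controlled, so b is moved to a one
    coordinate at a time, with the mean value theorem for each move. *)
Lemma box_lipschitz (f : 'rV[R]_n -> R) (x0 : 'rV[R]_n) (r c : R) :
  (forall x, ball x0 r x -> forall i,
     derivable f x (basis_vec i) /\ `|'D_(basis_vec i) f x| <= c) ->
  forall a b, ball x0 r a -> ball x0 r b ->
    `|f a - f b| <= c *+ n * `|a - b|.
Proof.
move=> df a b ha hb.
have [r0 ha'] := (ball_rowE _ _ _).1 ha; have [_ hb'] := (ball_rowE _ _ _).1 hb.
have step (k : 'I_n) : `|f (hybrid a b k.+1) - f (hybrid a b k)| <= c * `|a - b|.
  have E (s : R) : forall j, (hybrid a b k + (s * (a 0 k - b 0 k)) *: basis_vec k) 0 j =
      if (j < k)%N then a 0 j else if j == k then b 0 k + s * (a 0 k - b 0 k) else b 0 j.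
    move=> j; rewrite !mxE eqxx /=; have [->|jk] := eqVneq j k.
      by rewrite ltnn mulr1.
    by rewrite mulr0 addr0.
  have E1 : hybrid a b k + (a 0 k - b 0 k) *: basis_vec k = hybrid a b k.+1.
    apply/rowP => j; have := E 1 j; rewrite mul1r => ->; rewrite [RHS]mxE.
    rewrite ltnS [(j <= k)%N]leq_eqVlt; have [->|jk] := eqVneq j k.
      by rewrite eqxx ltnn /= addrC subrK.
    by rewrite -(inj_eq val_inj) in jk; rewrite (negbTE jk).
  have inb (s : R) : 0 <= s <= 1 ->
      ball x0 r (hybrid a b k + (s * (a 0 k - b 0 k)) *: basis_vec k).
    move=> /andP[s0 s1]; apply/ball_rowE; split => // j; rewrite E.
    case: ifP => _; first exact: ha'.
    case: eqP => [->|_]; last exact: hb'.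
    have := ha' k; have := hb' k; rewrite !ltr_norml => /andP[h1 h2] /andP[h3 h4].
    have [->|sn0] := eqVneq s 0; first by rewrite mul0r addr0; apply/andP; split; lra.
    have sp : 0 < s by rewrite lt_def sn0.
    have k1 : 0 <= (1 - s) * (r - (x0 0 k - b 0 k)) by rewrite mulr_ge0 // subr_ge0 // ltW.
    have k2 : 0 < s * (r - (x0 0 k - a 0 k)) by rewrite mulr_gt0 // subr_gt0.
    have k3 : 0 <= (1 - s) * (r + (x0 0 k - b 0 k)) by rewrite mulr_ge0 ?subr_ge0 //; lra.
    have k4 : 0 < s * (r + (x0 0 k - a 0 k)) by rewrite mulr_gt0 //; lra.
    by apply/andP; split; lra.
  have [s s01 D] := @mvt_line R _ f (hybrid a b k) (basis_vec k) (a 0 k - b 0 k)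
     (fun s h => (df _ (inb s h) k).1).
  rewrite -E1 D normrM mulrC ler_pM //; first by have [] := df _ (inb s s01) k.
  by have := coord_le_norm (a - b) k; rewrite !mxE.
have -> : f a - f b = \sum_(k < n) (f (hybrid a b k.+1) - f (hybrid a b k)).
  rewrite -(big_mkord xpredT (fun k => f (hybrid a b k.+1) - f (hybrid a b k))).
  rewrite (telescope_sumr (fun k => f (hybrid a b k))) //.
  by congr (f _ - f _); apply/rowP => j; rewrite mxE ?ltn_ord.
apply: le_trans (ler_norm_sum _ _ _) _.
apply: le_trans (ler_sum _ (fun k _ => step k)) _.
by rewrite sumr_const card_ord mulrnAl.
Qed.

End RowVectors.

Section Smooth.
Context {R : realType} {n : nat}.
Implicit Types (f g : 'rV[R]_n -> R) (U : set 'rV[R]_n) (x : 'rV[R]_n).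

(** The scalar counterpart of [Ck_on]; vector fields are studied one coordinate
    at a time ([Ck_on_coordP]). *)
Fixpoint Ck (k : nat) U f : Prop :=
  (forall x, U x -> {for x, continuous f}) /\
  if k is k'.+1 then
    forall i : 'I_n, (forall x, U x -> derivable f x (basis_vec i)) /\
      Ck k' U (fun x => 'D_(basis_vec i) f x)
  else True.

Definition smooth U f := forall k, Ck k U f.

Lemma Ck_sub U U' k f : U' `<=` U -> Ck k U f -> Ck k U' f.
Proof.
move=> sU; elim: k f => [|k IH] f [h0 h1]; split => //; try by move=> x /sU /h0.
by move=> i; have [h2 h3] := h1 i; split; [move=> x /sU /h2|exact: IH].
Qed.

Lemma Ck_eq U k f g : open U -> (forall x, U x -> f x = g x) -> Ck k U f -> Ck k U g.
Proof.
move=> oU; have nU x : U x -> \forall y \near x, U y.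
  by move=> Ux; apply: open_nbhs_nbhs.
have nfg' f' g' : (forall x, U x -> f' x = g' x) -> forall x, U x -> \near x, f' x = g' x.
  by move=> fg x Ux; near=> y; rewrite fg //; near: y; exact: nU.
elim: k f g => [|k IH] f g fg [h0 h1]; have nfg := nfg' _ _ fg.
  split=> // x Ux; rewrite /prop_for /continuous_at -(fg x Ux).
  exact: (cvg_trans (near_eq_cvg (nfg x Ux)) (h0 x Ux)).
split=> [x Ux|i].
  rewrite /prop_for /continuous_at -(fg x Ux).
  exact: (cvg_trans (near_eq_cvg (nfg x Ux)) (h0 x Ux)).
have [h2 h3] := h1 i; split=> [x Ux|].
  by apply: near_eq_derivable (h2 x Ux); exact: nfg.
by apply: (IH _ _ _ h3) => x Ux; apply: near_eq_derive; exact: nfg.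
Unshelve. all: by end_near. Qed.

Lemma Ck_continuous U k f x : Ck k U f -> U x -> {for x, continuous f}.
Proof. by case: k => [|k] [h _]; exact: h. Qed.

Lemma Ck_lower U k f : Ck k.+1 U f -> Ck k U f.
Proof.
elim: k f => [|k IH] f [h0 h1]; split => // i.
by have [h2 h3] := h1 i; split => //; exact: IH.
Qed.

Lemma CkD U k f g : open U -> Ck k U f -> Ck k U g -> Ck k U (fun x => f x + g x).
Proof.
move=> oU; elim: k f g => [|k IH] f g [f0 f1] [g0 g1]; split=> //.
- by move=> x Ux; exact: (cvgD (f0 x Ux) (g0 x Ux)).
- by move=> x Ux; exact: (cvgD (f0 x Ux) (g0 x Ux)).
- move=> i; have [f2 f3] := f1 i; have [g2 g3] := g1 i; split=> [x Ux|].
    by apply: derivableD; [exact: f2|exact: g2].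
  apply: (Ck_eq oU _ (IH _ _ f3 g3)) => x Ux.
  by rewrite -deriveD //; [exact: f2|exact: g2].
Qed.

Lemma CkM U k f g : open U -> Ck k U f -> Ck k U g -> Ck k U (fun x => f x * g x).
Proof.
move=> oU; elim: k f g => [|k IH] f g.
  by move=> [f0 _] [g0 _]; split=> // x Ux; exact: (cvgM (f0 x Ux) (g0 x Ux)).
move=> /[dup] /Ck_lower cf [f0 f1] /[dup] /Ck_lower cg [g0 g1]; split.
  by move=> x Ux; exact: (cvgM (f0 x Ux) (g0 x Ux)).
move=> i; have [f2 f3] := f1 i; have [g2 g3] := g1 i; split=> [x Ux|].
  by apply: derivableM; [exact: f2|exact: g2].
apply: (Ck_eq oU _ (CkD oU (IH _ _ f3 cg) (IH _ _ cf g3))) => x Ux.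
have h := is_derive_mul (derivableP (f2 x Ux)) (derivableP (g2 x Ux)).
by rewrite (@derive_val _ _ _ _ _ _ _ h).
Qed.

Lemma Ck_cst U k (c : R) : open U -> Ck k U (fun=> c).
Proof.
move=> oU; elim: k c => [|k IH] c; split=> //; try by move=> x _; exact: (@cst_continuous _ _ c x).
move=> i; split=> [x _|]; first exact: derivable_cst.
by apply: (Ck_eq oU _ (IH 0)) => x _; rewrite derive_cst.
Qed.

Lemma is_derive_coord x v j : is_derive x v (fun y : 'rV[R]_n => y 0 j) (v 0 j).
Proof.
have h : (fun h : R => h^-1 *: (((fun y : 'rV[R]_n => y 0 j) \o shift x) (h *: v) - x 0 j))
   @ 0^' --> v 0 j.
  apply: cvg_near_cst; rewrite /= near_withinE; near=> h => h0.
  by rewrite /= !mxE addrK /GRing.scale /= mulKf.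
apply: DeriveDef; first by apply/cvg_ex; exists (v 0 j).
exact: cvg_lim h.
Unshelve. all: by end_near. Qed.

Lemma Ck_coord U k j : open U -> Ck k U (fun x : 'rV[R]_n => x 0 j).
Proof.
move=> oU; case: k => [|k]; split=> //; try by move=> x _; exact: coord_continuous.
move=> i; split=> [x _|]; first by have [] := is_derive_coord x (basis_vec i) j.
apply: (Ck_eq oU _ (Ck_cst k ((basis_vec i : 'rV[R]_n) 0 j) oU)) => x _.
by rewrite (@derive_val _ _ _ _ _ _ _ (is_derive_coord x (basis_vec i) j)).
Qed.

Lemma CkV U k f : open U -> (forall x, U x -> f x != 0) ->
  Ck k U f -> Ck k U (fun x => (f x)^-1).
Proof.
move=> oU fn0; elim: k => [|k IH].
  by move=> [f0 _]; split=> // x Ux; exact: (cvgV (fn0 x Ux) (f0 x Ux)).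
move=> /[dup] /Ck_lower cf [f0 f1]; split.
  by move=> x Ux; exact: (cvgV (fn0 x Ux) (f0 x Ux)).
move=> i; have [f2 f3] := f1 i; split=> [x Ux|].
  by apply: derivableV; [exact: fn0|exact: f2].
have := CkM oU (CkM oU (Ck_cst k (-1) oU) f3) (CkM oU (IH cf) (IH cf)).
apply: Ck_eq => // x Ux.
have h := is_derive_inv (fn0 x Ux) (derivableP (f2 x Ux)).
by rewrite (@derive_val _ _ _ _ _ _ _ h) expr2 invfM mulN1r.
Qed.

End Smooth.

Lemma near_forall_ord {R : realType} {n m : nat} (x : 'rV[R]_n) (P : 'I_m -> 'rV[R]_n -> Prop) :
  (forall i, \forall y \near x, P i y) -> \forall y \near x, forall i, P i y.
Proof. by move=> h; exact: (@filter_forall _ 'I_m P (nbhs x) _ h). Qed.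

Lemma near_ball {R : realType} {n : nat} (x : 'rV[R]_n) (P : 'rV[R]_n -> Prop) :
  (\forall y \near x, P y) -> exists2 r : R, 0 < r & forall y, ball x r y -> P y.
Proof. by move=> /nbhs_ballP[r r0 h]; exists r. Qed.

Section FirstOrder.
Context {R : realType} {n : nat}.
Implicit Types (f g : 'rV[R]_n -> R) (U : set 'rV[R]_n) (x y v : 'rV[R]_n).

Lemma Ck1_near U f x (e : R) : open U -> U x -> Ck 1 U f -> 0 < e ->
  \forall y \near x, U y /\ forall i, derivable f y (basis_vec i) /\
     `|'D_(basis_vec i) f y - 'D_(basis_vec i) f x| <= e.
Proof.
move=> oU Ux [_ f1] e0.
have nU : \forall y \near x, U y by apply: open_nbhs_nbhs.
have nd : \forall y \near x, forall i : 'I_n,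
    `|'D_(basis_vec i) f y - 'D_(basis_vec i) f x| <= e.
  apply: near_forall_ord => i.
  have [_ [c _]] := f1 i.
  have /cvgrPdist_le/(_ _ e0) := c x Ux.
  by apply: filterS => y; rewrite distrC.
near=> y; have Uy : U y by near: y.
split=> // i; split; first by have [d _] := f1 i; exact: d.
by move: i; near: y.
Unshelve. all: by end_near. Qed.

(** A function minus its linear part at x has small partial derivatives near x,
    so by [box_lipschitz] it is o(h) along every line. *)
Lemma is_derive_dir U f x v : open U -> U x -> Ck 1 U f ->
  is_derive x v f (\sum_i v 0 i * 'D_(basis_vec i) f x).
Proof.
move=> oU Ux cf; set c := \sum_i _.
suff h : (fun h : R => h^-1 *: ((f \o shift x) (h *: v) - f x)) @ 0^' --> c.
  by apply: DeriveDef; [apply/cvg_ex; exists c | exact: cvg_lim h].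
apply/cvgrPdist_le => e e0.
(* box_lipschitz multiplies the bound by n, and 1 keeps the denominator
   positive when v = 0. *)
pose eta := e / (1 + `|v| *+ n).
have den : 0 < 1 + `|v| *+ n by rewrite ltr_pwDl // mulrn_wge0.
have eta0 : 0 < eta by rewrite divr_gt0.
have /nbhs_ballP[r /= r0 rP] := Ck1_near oU Ux cf eta0.
pose psi y := f y + - \sum_i y 0 i * 'D_(basis_vec i) f x.
have dpsi y : ball x r y -> forall i, derivable psi y (basis_vec i) /\
    `|'D_(basis_vec i) psi y| <= eta.
  move=> /rP[Uy dy] i; have [d1 d2] := dy i.
  have dl : is_derive y (basis_vec i) (fun y => \sum_j y 0 j * 'D_(basis_vec j) f x)
        ('D_(basis_vec i) f x).
    have h (j : 'I_n) : is_derive y (basis_vec i) (fun y : 'rV[R]_n => y 0 j * 'D_(basis_vec j) f x)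
        ((basis_vec i : 'rV[R]_n) 0 j * 'D_(basis_vec j) f x + y 0 j * 0).
      by apply: is_derive_mul; exact: is_derive_coord.
    have := is_derive_sum (h := fun j (y : 'rV[R]_n) => y 0 j * 'D_(basis_vec j) f x) h.
    rewrite (_ : \sum_(_ < n) _ = 'D_(basis_vec i) f x) => [D|].
      apply: near_eq_is_derive D; near=> z; first by rewrite fct_sumE.
    rewrite (bigD1 i) //= big1 => [|j ji]; rewrite basis_vecE.
      by rewrite eqxx mul1r mulr0 !addr0.
    by rewrite eq_sym (negbTE ji) mul0r mulr0 addr0.
  have D := is_derive_add (derivableP d1) (is_derive_opp dl).
  split; first by have [] := D.
  by rewrite (@derive_val _ _ _ _ _ _ _ D).
have nb : \forall h \near (0 : R)^', ball x r (h *: v + x).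
  have /nbhs_ballP[d /= d0 dP] : \forall h \near (0 : R), ball x r (h *: v + x).
    have : (fun h : R => h *: v + x) @ (0 : R) --> 0 *: v + x.
      by apply: cvgD; [apply: cvgZr_tmp; exact: cvg_id|exact: cvg_cst].
    by rewrite scale0r add0r => /(_ (ball x r) (nbhsx_ballx _ _ r0)).
  by apply: nbhs_dnbhs; apply/nbhs_ballP; exists d.
near=> h.
have h0 : h != 0 by near: h; exact: nbhs_dnbhs_neq.
have hb : ball x r (h *: v + x) by near: h.
have := box_lipschitz dpsi hb (ballxx x r0).
have -> : psi (h *: v + x) - psi x = f (h *: v + x) - f x - h * c.
  rewrite /psi /c mulr_sumr.
  have -> : \sum_i (h *: v + x) 0 i * 'D_(basis_vec i) f x =
    \sum_i h * (v 0 i * 'D_(basis_vec i) f x) + \sum_i x 0 i * 'D_(basis_vec i) f x.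
    by rewrite -big_split /=; apply: eq_bigr => i _; rewrite !mxE mulrDl mulrA.
  by ring.
rewrite addrK normrZ => le1.
have -> : c - h^-1 *: ((f \o shift x) (h *: v) - f x) =
   - (h^-1 * (f (h *: v + x) - f x - h * c)).
  by rewrite /= /GRing.scale /=; field.
rewrite normrN normrM normfV ler_pdivrMl ?normr_gt0 //.
apply: le_trans le1 _.
rewrite mulrCA ler_pM2l ?normr_gt0 // mulrnAl -mulrnAr /eta mulrAC ler_pdivrMr //.
by rewrite ler_pM2l // lerDr.
Unshelve. all: by end_near. Qed.

Lemma ball_const (f : 'rV[R]_n -> R) x (r : R) :
  (forall y, ball x r y -> forall i, is_derive y (basis_vec i) f 0) ->
  forall a b, ball x r a -> ball x r b -> f a = f b.
Proof.
move=> df a b ha hb.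
have := @box_lipschitz R n f x r 0 _ a b ha hb.
rewrite mul0rn mul0r normr_le0 subr_eq0 => h; apply/eqP/h => y yb i.
by have [d1 ->] := df y yb i; rewrite normr0.
Qed.

Lemma derive_shiftE f (c x v : 'rV[R]_n) d : is_derive (x + c) v f d ->
  is_derive x v (fun y => f (y + c)) d.
Proof.
have E : (fun h : R => h^-1 *: ((f \o shift (x + c)) (h *: v) - f (x + c)))
       = (fun h : R => h^-1 *: (((fun y => f (y + c)) \o shift x) (h *: v)
                          - f (x + c))).
  by apply/funext => h /=; rewrite addrA.
move=> [d1 d2]; apply: DeriveDef; first by rewrite /derivable -E.
by rewrite /derive -E.
Qed.

Lemma derivable_Ck1 U f x i : Ck 1 U f -> U x -> derivable f x (basis_vec i).
Proof. by move=> [_ /(_ i)[h _]]; exact: h. Qed.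

(** The left side is a difference quotient in the direction i of the increment
    of f in the direction j, so the mean value theorem applies to each of the
    two steps in turn. The factor 3 leaves room for the corner of the square
    in the sup-norm ball. *)
Lemma second_difference U f x i j (r s : R) : open U -> Ck 2 U f ->
  (forall y, ball x r y -> U y) -> 0 < s -> s *+ 3 < r ->
  exists2 y, ball x r y &
   f (x + s *: basis_vec i + s *: basis_vec j) - f (x + s *: basis_vec i)
     - (f (x + s *: basis_vec j) - f x)
   = s * s * 'D_(basis_vec j) (fun z => 'D_(basis_vec i) f z) y.
Proof.
move=> oU cf rU s0 s3r.
have inb (a b : R) : 0 <= a <= 1 -> 0 <= b <= 1 ->
    ball x r (x + (a * s) *: basis_vec i + (b * s) *: basis_vec j).
  move=> /andP[a0 a1] /andP[b0 b1]; apply/ball_rowE; split.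
    by apply: lt_trans s3r; rewrite pmulrn_lgt0.
  move=> k; rewrite !mxE /= -addrA opprD addrA subrr add0r normrN.
  apply: le_lt_trans s3r; apply: le_trans (ler_normD _ _) _.
  rewrite !normrM !ger0_norm ?(ltW s0) //; try by case: eqP; case: eqP.
  have k1 : (k == i)%:R <= 1 :> R by case: eqP.
  have k2 : (k == j)%:R <= 1 :> R by case: eqP.
  have k3 : 0 <= (k == i)%:R :> R by [].
  have k4 : 0 <= (k == j)%:R :> R by [].
  have le (c d : R) : 0 <= c <= 1 -> 0 <= d <= 1 -> c * s * d <= s.
    move=> /andP[c0 c1] /andP[d0 d1].
    have : c * d <= 1 by rewrite mulr_ile1.
    by move=> cd; rewrite mulrAC ler_piMl // ltW.
  rewrite mulrS mulr2n; apply: lerD; first by apply: le; apply/andP; split.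
  apply: (@le_trans _ _ s); first by apply: le; apply/andP; split.
  by rewrite lerDl ltW.
have s1 : 0 <= (1 : R) <= 1 by rewrite ler01 lexx.
have z1 : 0 <= (0 : R) <= 1 by rewrite ler01 lexx.
have c1 : Ck 1 U f := Ck_lower cf.
have c2 : Ck 1 U (fun z => 'D_(basis_vec i) f z) by have [_ /(_ i)[]] := cf.
pose g y := f (y + s *: basis_vec j) + - f y.
have dg (t : R) : 0 <= t <= 1 -> is_derive (x + (t * s) *: basis_vec i) (basis_vec i) g
    ('D_(basis_vec i) f (x + (t * s) *: basis_vec i + s *: basis_vec j)
     + - 'D_(basis_vec i) f (x + (t * s) *: basis_vec i)).
  move=> t1; apply: is_derive_add.
    apply: derive_shiftE; apply: derivableP; apply: (derivable_Ck1 c1); apply: rU.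
    by have := inb t 1 t1 s1; rewrite mul1r.
  apply: is_derive_opp; apply: derivableP; apply: (derivable_Ck1 c1); apply: rU.
  by have := inb t 0 t1 z1; rewrite mul0r scale0r addr0.
have [|t t1 E1] := @mvt_line R _ g x (basis_vec i) s.
  by move=> t /dg[].
have [|t' t'1 E2] := @mvt_line R _ (fun z => 'D_(basis_vec i) f z)
   (x + (t * s) *: basis_vec i) (basis_vec j) s.
  by move=> t' t'1; apply: (derivable_Ck1 c2); apply: rU; exact: inb.
exists (x + (t * s) *: basis_vec i + (t' * s) *: basis_vec j); first exact: inb.
have -> : f (x + s *: basis_vec i + s *: basis_vec j) - f (x + s *: basis_vec i)
     - (f (x + s *: basis_vec j) - f x) = g (x + s *: basis_vec i) - g x by [].
by rewrite E1 (@derive_val _ _ _ _ _ _ _ (dg t t1)) E2 mulrA.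
Qed.

(** Both mixed derivatives equal, at points close to x, the same second
    difference of f. *)
Lemma schwarz U f x i j : open U -> U x -> Ck 2 U f ->
  'D_(basis_vec i) (fun z => 'D_(basis_vec j) f z) x =
  'D_(basis_vec j) (fun z => 'D_(basis_vec i) f z) x.
Proof.
move=> oU Ux cf.
have cij k l : {for x, continuous (fun z => 'D_(basis_vec k) (fun z => 'D_(basis_vec l) f z) z)}.
  by have [_ /(_ l)[_ [_ /(_ k)[_ [c _]]]]] := cf; exact: c.
set a := fun z => 'D_(basis_vec i) (fun z => 'D_(basis_vec j) f z) z.
set b := fun z => 'D_(basis_vec j) (fun z => 'D_(basis_vec i) f z) z.
apply/eqP; rewrite -subr_eq0 -normr_le0; apply/ler_addgt0Pl => e e0.
have e2 : 0 < e / 2 by rewrite divr_gt0.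
have /cvgrPdist_le/(_ _ e2) ca := cij i j.
have /cvgrPdist_le/(_ _ e2) cb := cij j i.
have nU : \forall y \near x, U y by apply: open_nbhs_nbhs.
have [r r0 rP] := near_ball (filterI nU (filterI ca cb)).
have rU y : ball x r y -> U y by move=> /rP[].
pose s := r / 4.
have s0 : 0 < s by rewrite divr_gt0.
have s3 : s *+ 3 < r by exact: quarter_mul3_lt.
have [p pb Ep] := second_difference i j oU cf rU s0 s3.
have [q qb Eq] := second_difference j i oU cf rU s0 s3.
have E : b p = a q.
  apply: (mulfI (x := s * s)); first by rewrite mulf_neq0 ?gt_eqF.
  apply: (etrans (esym Ep)); apply: (etrans _ Eq).
  rewrite [x + s *: basis_vec j + _]addrAC.
  by rewrite !opprB addrACA [RHS]addrACA; congr (_ + _); exact: addrC.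
have [_ [_ h1]] := rP _ pb; have [_ [h2 _]] := rP _ qb.
have -> : a x - b x = (a x - a q) - (b x - b p) by rewrite E opprB addrA subrK.
rewrite addr0; apply: le_trans (ler_normB _ _) _.
exact: (add_halves_le h2 h1).
Qed.

End FirstOrder.

Section MoreSmooth.
Context {R : realType} {n : nat}.
Implicit Types (f g : 'rV[R]_n -> R) (U : set 'rV[R]_n) (x : 'rV[R]_n).

Lemma CkN U k f : open U -> Ck k U f -> Ck k U (fun x => - f x).
Proof.
move=> oU cf; apply: (Ck_eq oU _ (CkM oU (Ck_cst k (-1) oU) cf)) => x _.
by rewrite mulN1r.
Qed.

Lemma Ck_sum U k (I : finType) (F : I -> 'rV[R]_n -> R) : open U ->
  (forall i, Ck k U (F i)) -> Ck k U (fun x => \sum_i F i x).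
Proof.
move=> oU cF; rewrite (_ : (fun x => _) = (fun x => \sum_(i <- enum I) F i x)).
  elim: (enum I) => [|i s IH].
    by apply: (Ck_eq oU _ (Ck_cst k 0 oU)) => x _; rewrite big_nil.
  by apply: (Ck_eq oU _ (CkD oU (cF i) IH)) => x _; rewrite big_cons.
by apply/funext => x; rewrite big_enum.
Qed.

Lemma Ck_partial U k f i : Ck k.+1 U f -> Ck k U (fun x => 'D_(basis_vec i) f x).
Proof. by move=> [_ /(_ i)[]]. Qed.

Lemma smooth_partial U f i : smooth U f -> smooth U (fun x => 'D_(basis_vec i) f x).
Proof. by move=> sf k; exact: Ck_partial (sf k.+1). Qed.

Lemma smooth_cont U f x : smooth U f -> U x -> {for x, continuous f}.
Proof. by move=> sf; exact: Ck_continuous (sf 0%N). Qed.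

Lemma smooth_derivable U f x i : smooth U f -> U x ->
  is_derive x (basis_vec i) f ('D_(basis_vec i) f x).
Proof. by move=> sf Ux; exact: (derivableP (derivable_Ck1 (sf 1%N) Ux)). Qed.

Lemma smooth_dir U f x v : open U -> smooth U f -> U x ->
  is_derive x v f (\sum_i v 0 i * 'D_(basis_vec i) f x).
Proof. by move=> oU sf Ux; exact: is_derive_dir oU Ux (sf 1%N). Qed.

Lemma smooth_schwarz U f x i j : open U -> smooth U f -> U x ->
  'D_(basis_vec i) (fun z => 'D_(basis_vec j) f z) x =
  'D_(basis_vec j) (fun z => 'D_(basis_vec i) f z) x.
Proof. by move=> oU sf Ux; exact: schwarz oU Ux (sf 2%N). Qed.

Lemma smoothD U f g : open U -> smooth U f -> smooth U g -> smooth U (fun x => f x + g x).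
Proof. by move=> oU sf sg k; apply: CkD. Qed.

Lemma smoothM U f g : open U -> smooth U f -> smooth U g -> smooth U (fun x => f x * g x).
Proof. by move=> oU sf sg k; apply: CkM. Qed.

Lemma smoothN U f : open U -> smooth U f -> smooth U (fun x => - f x).
Proof. by move=> oU sf k; apply: CkN. Qed.

Lemma smoothV U f : open U -> (forall x, U x -> f x != 0) -> smooth U f ->
  smooth U (fun x => (f x)^-1).
Proof. by move=> oU f0 sf k; apply: CkV. Qed.

Lemma smooth_cst U (c : R) : open U -> smooth U (fun=> c).
Proof. by move=> oU k; apply: Ck_cst. Qed.

Lemma smooth_coord U j : open U -> smooth U (fun x : 'rV[R]_n => x 0 j).
Proof. by move=> oU k; apply: Ck_coord. Qed.

Lemma smooth_eq U f g : open U -> (forall x, U x -> f x = g x) -> smooth U f -> smooth U g.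
Proof. by move=> oU fg sf k; apply: Ck_eq (sf k). Qed.

Lemma smooth_sum U (I : finType) (F : I -> 'rV[R]_n -> R) : open U ->
  (forall i, smooth U (F i)) -> smooth U (fun x => \sum_i F i x).
Proof. by move=> oU sF k; apply: Ck_sum => // i; exact: sF. Qed.

Lemma continuous_coordP m (f : 'rV[R]_n -> 'rV[R]_m) x :
  {for x, continuous f} <-> forall j, {for x, continuous (fun y => f y 0 j)}.
Proof.
rewrite /prop_for /continuous_at; split=> [cf j|cf]; first by apply: (cvg_comp f (fun M : 'rV[R]_m => M 0 j) cf); exact: coord_continuous.
apply: (proj2 (@cvgrPdist_le R 'rV[R]_m 'rV[R]_n (nbhs x) _ f (f x))) => e e0.
have h : \forall y \near x, forall j, `|f x 0 j - f y 0 j| <= e.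
  apply: near_forall_ord => j.
  by have /cvgrPdist_le/(_ _ e0) := cf j.
apply: filterS h => y h; apply: norm_le_coord; first exact: ltW.
by move=> j; rewrite !mxE.
Qed.

Lemma Ck_on_coordP m k U (f : 'rV[R]_n -> 'rV[R]_m) : open U ->
  Ck_on k U f <-> forall j, Ck k U (fun x => f x 0 j).
Proof.
move=> oU; elim: k f => [|k IH] f.
  split=> [[h _] j|h]; split=> // x Ux; first by apply: (continuous_coordP _ _).1; exact: h.
  by apply/continuous_coordP => j; have [hj _] := h j; exact: hj.
split=> [[h0 h1] j|h]; split.
- by move=> x Ux; apply: (continuous_coordP _ _).1; exact: h0.
- move=> i; have [h2 h3] := h1 i; split=> [x Ux|].
    by have /derivable_mxP/(_ 0 j) := h2 x Ux.
  apply: (Ck_eq oU _ ((IH _).1 h3 j)) => x Ux.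
  by rewrite derive_mx ?mxE //; exact: h2.
- by move=> x Ux; apply/continuous_coordP => j; have [h0 _] := h j; exact: h0.
- move=> i; have d x : U x -> derivable f x (basis_vec i).
    by move=> Ux; apply/derivable_mxP => j' j; rewrite ord1; have [_ /(_ i)[h1 _]] := h j; exact: h1.
  split=> //; apply/IH => j; have [_ /(_ i)[_ c]] := h j.
  by apply: (Ck_eq oU _ c) => x Ux; rewrite derive_mx ?mxE //; exact: d.
Qed.

Lemma smooth_onP m U (f : 'rV[R]_n -> 'rV[R]_m) : open U ->
  smooth_on U f <-> forall j, smooth U (fun x => f x 0 j).
Proof.
move=> oU; split=> [sf j k|sf k]; first exact: ((Ck_on_coordP _ _ oU).1 (sf k)).
by apply/Ck_on_coordP => // j; exact: sf.
Qed.

Lemma derive_coord m (f : 'rV[R]_n -> 'rV[R]_m) x i j :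
  (forall j, derivable (fun x => f x 0 j) x (basis_vec i)) ->
  ('D_(basis_vec i) f x) 0 j = 'D_(basis_vec i) (fun x => f x 0 j) x.
Proof.
move=> d; rewrite derive_mx ?mxE //.
by apply/derivable_mxP => j' k; rewrite ord1; exact: d.
Qed.

End MoreSmooth.

Section OpenMap.
Context {R : realType} {n : nat}.
Implicit Types (F : 'rV[R]_n -> 'rV[R]_n) (U : set 'rV[R]_n) (x : 'rV[R]_n).

Lemma closed_cball x (r : R) : closed [set y : 'rV[R]_n | `|y - x| <= r].
Proof.
have -> : [set y : 'rV[R]_n | `|y - x| <= r] = closed_ball_ Num.norm x r.
  by apply/funext => y; rewrite /closed_ball_ /= distrC.
exact: closed_closed_ball_.
Qed.

(** With A the inverse of the Jacobian at x, the map y - F y A has zero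
    derivative at x, so it is a contraction on a small closed ball; its
    translate by w A has a fixed point, which is a preimage of w. *)
Lemma open_map U F x : open U -> U x -> (forall j, Ck 1 U (fun y => F y 0 j)) ->
  \det (\matrix_(i, j) 'D_(basis_vec i) (fun y => F y 0 j) x) != 0 ->
  nbhs (F x) (F @` U).
Proof.
move=> oU Ux cF dJ; set J := \matrix_(i, j) _ in dJ.
have uJ : J \in unitmx by rewrite unitmxE unitfE.
pose A := invmx J.
pose K y := y - F y *m A.
have KE k y : K y 0 k = y 0 k + - \sum_j F y 0 j * A j k by rewrite !mxE.
have cK k : Ck 1 U (fun y => K y 0 k).
  apply: (Ck_eq oU (f := fun y => y 0 k + - \sum_j F y 0 j * A j k)).
    by move=> y _; rewrite KE.
  apply: CkD => //; first exact: Ck_coord.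
  apply: CkN => //; apply: Ck_sum => // j; apply: CkM => //; exact: Ck_cst.
have dK k i : 'D_(basis_vec i) (fun y => K y 0 k) x = 0.
  have dFj (j : 'I_n) : is_derive x (basis_vec i) (fun y => F y 0 j * A j k)
      (J i j * A j k + F x 0 j * 0).
    apply: is_derive_mul; first by rewrite mxE; apply/derivableP/(derivable_Ck1 (cF j)).
  have h := is_derive_add (is_derive_coord x (basis_vec i) k)
     (is_derive_opp (is_derive_sum (h := fun j (y : 'rV[R]_n) => F y 0 j * A j k) dFj)).
  have -> : (fun y => K y 0 k) = (fun y : 'rV[R]_n =>
      y 0 k + - (\sum_j (fun y : 'rV[R]_n => F y 0 j * A j k)) y).
    by apply/funext => y; rewrite KE fct_sumE.
  rewrite (@derive_val _ _ _ _ _ _ _ h) basis_vecE.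
  under eq_bigr do rewrite mulr0 addr0.
  have -> : \sum_j J i j * A j k = (J *m A) i k by rewrite mxE.
  by rewrite mulmxV // mxE subrr.
(* So that the Lipschitz constant c *+ n is at most 1/2, also for n = 0. *)
pose c : R := (2 * n.+1%:R)^-1.
have c0 : 0 < c by rewrite invr_gt0 mulr_gt0.
have cn : c *+ n <= 2^-1.
  rewrite /c invfM -mulrnAr -[leRHS]mulr1 ler_pM2l ?invr_gt0 //.
  by rewrite -[_ *+ n]mulr_natr mulrC ler_pdivrMr // mul1r ler_nat.
have near_all : \forall y \near x, forall k : 'I_n, U y /\ forall i,
    derivable (fun y => K y 0 k) y (basis_vec i) /\
    `|'D_(basis_vec i) (fun y => K y 0 k) y| <= c.
  apply: near_forall_ord => k.
  apply: filterS (Ck1_near oU Ux (cK k) c0) => y [Uy h]; split=> // i.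
  by have [d] := h i; rewrite dK subr0.
have nU : \forall y \near x, U y by apply: open_nbhs_nbhs.
have [r r0 rP] := near_ball (filterI nU near_all).
have lipK a b : ball x r a -> ball x r b -> `|K a - K b| <= 2^-1 * `|a - b|.
  move=> ha hb; apply: norm_le_coord; first by rewrite mulr_ge0 // invr_ge0.
  move=> k; have h y : ball x r y -> forall i, derivable (fun y => K y 0 k) y (basis_vec i) /\
    `|'D_(basis_vec i) (fun y => K y 0 k) y| <= c by move=> /rP[_ /(_ k)[]].
  have := box_lipschitz h ha hb; rewrite [(K a - K b) 0 k]mxE [(- K b) 0 k]mxE => /le_trans; apply.
  by rewrite ler_wpM2r.
pose B := [set y : 'rV[R]_n | `|y - x| <= r / 2].
have Bball y : B y -> ball x r y.
  move=> /= By; rewrite -ball_normE /= distrC; apply: le_lt_trans By _; lra.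
have xB : B x by rewrite /B /= subrr normr0 divr_ge0 // ltW.
have nw : \forall w \near F x, `|(w - F x) *m A| <= r / 4.
  pose s := \sum_j \sum_k `|A j k|.
  have s0 : 0 <= s by apply: sumr_ge0 => j _; apply: sumr_ge0.
  have d0 : 0 < r / 4 / (1 + s) by rewrite !divr_gt0 // ltr_pwDl.
  apply/nbhs_ballP; exists (r / 4 / (1 + s)) => //= w; rewrite -ball_normE /= distrC => /ltW hw.
  apply: norm_le_coord; first by rewrite divr_ge0 // ltW.
  move=> k; rewrite mxE; apply: le_trans (ler_norm_sum _ _ _) _.
  apply: (@le_trans _ _ (\sum_j (r / 4 / (1 + s)) * `|A j k|)).
    apply: ler_sum => j _; rewrite normrM ler_wpM2r //.
    exact: le_trans (coord_le_norm _ _) hw.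
  rewrite -mulr_sumr -mulrA ler_piMr ?divr_ge0 ?(ltW r0) //.
  rewrite mulrC ler_pdivrMr ?ltr_pwDl // mul1r.
  apply: (@le_trans _ _ s); last by rewrite lerDr.
  by apply: ler_sum => j _; rewrite (bigD1 k) //= lerDl sumr_ge0.
apply: filterS nw => w hw.
pose T y := K y + w *m A.
have TB : {homo T : y / B y >-> B y}.
  move=> y By; rewrite /B /=.
  have -> : T y - x = (K y - K x) + (w - F x) *m A.
    rewrite /T {3}/K mulmxBl; move: (K y) (F x *m A) (w *m A) => k1 k2 k3.
    by apply/rowP => k; rewrite !mxE; ring.
  apply: le_trans (ler_normD _ _) _.
  have h1 := lipK _ _ (Bball y By) (Bball x xB).
  have h2 : `|y - x| <= r / 2 := By.
  lra.
have ctr : is_contraction (mkfun TB : {fun B >-> B}).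
  exists (2^-1)%:nng; split=> /=; first by rewrite invf_lt1 // ltr1n.
  move=> [a b] [/= Ba Bb]; rewrite /T opprD addrACA subrr addr0.
  by apply: lipK; exact: Bball.
have [||y By E] := banach_fixed_point ctr.
- exact: closed_cball.
- by exists x.
have Uy : U y by have [] := rP _ (Bball y By).
exists y => //; apply/eqP; rewrite -subr_eq0; apply/eqP.
have h : (F y - w) *m A = 0.
  have : y = y - F y *m A + w *m A := E.
  by move=> /(congr1 (fun z => y - z)); rewrite subrr mulmxBl => ->; apply/rowP => k; rewrite !mxE; ring.
by rewrite -[F y - w]mulmx1 -(mulVmx uJ) mulmxA h mul0mx.
Qed.

End OpenMap.

(** Partial derivatives of the same field occur many times below in large
    algebraic expressions. Locking keeps them atomic: conversion would otherwise
    unfold them to limits. *)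
HB.lock Definition pd {R : realType} {n : nat} {V : normedModType R} (i : 'I_n)
  (f : 'rV[R]_n -> V) (x : 'rV[R]_n) : V := 'D_(basis_vec i) f x.

Section Partials.
Context {R : realType} {n : nat}.
Implicit Types (f g : 'rV[R]_n -> R) (O : set 'rV[R]_n) (x v : 'rV[R]_n).

Lemma pdE (V : normedModType R) (i : 'I_n) (f : 'rV[R]_n -> V) :
  (fun x => 'D_(basis_vec i) f x) = pd i f.
Proof. by rewrite pd.unlock. Qed.

Lemma smooth_pd O f i : smooth O f -> smooth O (pd i f).
Proof. by rewrite -pdE; exact: smooth_partial. Qed.

Lemma is_derive_pd O f i x : smooth O f -> O x -> is_derive x (basis_vec i) f (pd i f x).
Proof. by rewrite -pdE; exact: smooth_derivable. Qed.

Lemma pd_val f i x d : is_derive x (basis_vec i) f d -> pd i f x = d.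
Proof. by rewrite -pdE => -[]. Qed.

Lemma is_derive_smooth O f x v : open O -> smooth O f -> O x ->
  is_derive x v f (\sum_i v 0 i * pd i f x).
Proof. by under eq_bigr do rewrite -pdE; exact: smooth_dir. Qed.

Lemma pd_comm O f i j x : open O -> smooth O f -> O x -> pd i (pd j f) x = pd j (pd i f) x.
Proof. by rewrite -!pdE; exact: smooth_schwarz. Qed.

Lemma pd_eq_on O (V : normedModType R) (f h : 'rV[R]_n -> V) x i : open O -> O x ->
  (forall y, O y -> f y = h y) -> pd i f x = pd i h x.
Proof.
move=> oO Ox e; rewrite -!pdE; apply: near_eq_derive.
have nO : \forall y \near x, O y by apply: open_nbhs_nbhs.
by near=> y; apply: e; near: y.
Unshelve. all: by end_near. Qed.

(** Used to differentiate an identity that holds on an open set. *)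
Lemma is_derive_eq_on O f h x v a b : open O -> O x ->
  (forall y, O y -> f y = h y) -> is_derive x v f a -> is_derive x v h b -> a = b.
Proof.
move=> oO Ox e [_ <-] [_ <-]; apply: near_eq_derive.
have nO : \forall y \near x, O y by apply: open_nbhs_nbhs.
by near=> y; apply: e; near: y.
Unshelve. all: by end_near. Qed.

End Partials.

Section VectorFields.
Context {R : realType} {n m : nat}.
Implicit Types (W : 'rV[R]_n -> 'rV[R]_m) (O : set 'rV[R]_n) (x : 'rV[R]_n).

Lemma pd_coord O W x i k : open O -> smooth_on O W -> O x ->
  (pd i W x) 0 k = pd i (fun y => W y 0 k) x.
Proof.
move=> oO /(smooth_onP _ oO) sW Ox; rewrite -!pdE; apply: derive_coord => j.
by have [] := smooth_derivable i (sW j) Ox.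
Qed.

Lemma is_derive_pd_coord O W x i k : open O -> smooth_on O W -> O x ->
  is_derive x (basis_vec i) (fun y => W y 0 k) ((pd i W x) 0 k).
Proof.
move=> oO sW Ox; rewrite (pd_coord i k oO sW Ox).
by apply: is_derive_pd Ox; exact: (smooth_onP _ oO).1.
Qed.

Lemma smooth_on_pd O W i : open O -> smooth_on O W -> smooth_on O (pd i W).
Proof. by move=> oO sW k; rewrite -pdE; have [_ /(_ i)[]] := sW k.+1. Qed.

Lemma pd_coord2 O W x i j k : open O -> smooth_on O W -> O x ->
  (pd i (pd j W) x) 0 k = pd i (pd j (fun y => W y 0 k)) x.
Proof.
move=> oO sW Ox; rewrite (pd_coord i k oO (smooth_on_pd j oO sW) Ox).
by apply: (pd_eq_on i oO Ox) => y Oy; exact: pd_coord oO sW Oy.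
Qed.

Lemma pd_comm_vec O W x i j : open O -> smooth_on O W -> O x ->
  pd i (pd j W) x = pd j (pd i W) x.
Proof.
move=> oO sW Ox; apply/rowP => k; rewrite !(pd_coord2 _ _ _ oO sW Ox).
by apply: (pd_comm i j oO _ Ox); exact: (smooth_onP _ oO).1.
Qed.

Lemma smooth_on_eq O W W' : open O -> (forall x, O x -> W x = W' x) ->
  smooth_on O W -> smooth_on O W'.
Proof.
move=> oO e /(smooth_onP _ oO) sW; apply/smooth_onP => // k.
by apply: (smooth_eq oO _ (sW k)) => x Ox; rewrite e.
Qed.

End VectorFields.

Section Coordinates.

Lemma ord3P (k : 'I_3) : [\/ k = 0, k = 1 | k = ord_max].
Proof.
case: k => [[|[|[|//]]] hk]; [apply: Or31|apply: Or32|apply: Or33]; exact: val_inj.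
Qed.

Lemma ord2P (k : 'I_2) : k = 0 \/ k = 1.
Proof. by case: k => [[|[|//]] hk]; [left|right]; exact: val_inj. Qed.

Lemma sum_ord3 (V : nmodType) (F : 'I_3 -> V) : \sum_k F k = F 0 + F 1 + F ord_max.
Proof.
rewrite !big_ord_recr big_ord0 /= add0r.
by congr (F _ + F _ + F _); exact: val_inj.
Qed.

Lemma sum_ord2 (V : nmodType) (F : 'I_2 -> V) : \sum_k F k = F 0 + F 1.
Proof.
rewrite !big_ord_recr big_ord0 /= add0r.
by congr (F _ + F _); exact: val_inj.
Qed.

End Coordinates.

Notation m0 := (@Ordinal 4 0 isT).
Notation m1 := (@Ordinal 4 1 isT).
Notation m2 := (@Ordinal 4 2 isT).
Notation m3 := (@Ordinal 4 3 isT).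

Lemma ord4P (P : 'I_4 -> Prop) : P m0 -> P m1 -> P m2 -> P m3 -> forall k, P k.
Proof.
move=> p0 p1 p2 p3 [[|[|[|[|//]]]] hk].
- by rewrite (_ : Ordinal hk = m0) //; exact: val_inj.
- by rewrite (_ : Ordinal hk = m1) //; exact: val_inj.
- by rewrite (_ : Ordinal hk = m2) //; exact: val_inj.
- by rewrite (_ : Ordinal hk = m3) //; exact: val_inj.
Qed.

Lemma sum_ord4 (V : nmodType) (F : 'I_4 -> V) : \sum_k F k = F m0 + F m1 + F m2 + F m3.
Proof.
rewrite !big_ord_recr big_ord0 /= add0r.
by congr (F _ + F _ + F _ + F _); exact: val_inj.
Qed.

(** * The hyperboloid model *)
Section Minkowski.
Context {R : realType}.
Implicit Types (X Y : 'rV[R]_3) (u v w : 'rV[R]_4).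

Lemma dotpE X Y : dotp X Y = X 0 0 * Y 0 0 + X 0 1 * Y 0 1 + X 0 ord_max * Y 0 ord_max.
Proof. by rewrite /dotp mxE sum_ord3 !mxE. Qed.

Lemma crosspE X Y : [/\ crossp X Y 0 0 = X 0 1 * Y 0 ord_max - X 0 ord_max * Y 0 1,
  crossp X Y 0 1 = X 0 ord_max * Y 0 0 - X 0 0 * Y 0 ord_max
  & crossp X Y 0 ord_max = X 0 0 * Y 0 1 - X 0 1 * Y 0 0].
Proof.
have e1 : (0 + 1 : 'I_3) = 1 by exact: val_inj.
have e2 : (1 + 1 : 'I_3) = ord_max by exact: val_inj.
have e3 : (ord_max + 1 : 'I_3) = 0 by exact: val_inj.
by split; rewrite mxE ?e1 ?e2 ?e3 ?e1 ?e2.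
Qed.

Definition lift X : 'rV[R]_4 := \row_k
  nth 0 [:: (X 0 ord_max)^-1; X 0 0 * (X 0 ord_max)^-1; X 0 1 * (X 0 ord_max)^-1;
    (X 0 0 * X 0 0 + X 0 1 * X 0 1 + X 0 ord_max * X 0 ord_max) * (X 0 ord_max)^-1] k.

(** The differential of [lift] at X applied to Y. *)
Definition dlift X Y : 'rV[R]_4 := \row_k
  nth 0 [:: - Y 0 ord_max / X 0 ord_max ^+ 2;
    Y 0 0 * (X 0 ord_max)^-1 + X 0 0 * (- Y 0 ord_max / X 0 ord_max ^+ 2);
    Y 0 1 * (X 0 ord_max)^-1 + X 0 1 * (- Y 0 ord_max / X 0 ord_max ^+ 2);
    (2 * (X 0 0 * Y 0 0 + X 0 1 * Y 0 1 + X 0 ord_max * Y 0 ord_max)) * (X 0 ord_max)^-1 +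
    (X 0 0 * X 0 0 + X 0 1 * X 0 1 + X 0 ord_max * X 0 ord_max) *
    (- Y 0 ord_max / X 0 ord_max ^+ 2)] k.

Definition mink u v : R := (u 0 m0 * v 0 m3 + u 0 m3 * v 0 m0) / 2
  - u 0 m1 * v 0 m1 - u 0 m2 * v 0 m2.

Lemma mink_lift X : X 0 ord_max != 0 -> mink (lift X) (lift X) = 1.
Proof. by move=> z0; rewrite /mink !mxE /=; field. Qed.

Lemma mink_lift_dlift X Y : X 0 ord_max != 0 -> mink (lift X) (dlift X Y) = 0.
Proof. by move=> z0; rewrite /mink !mxE /=; field. Qed.

Lemma mink_dlift X Y Z : X 0 ord_max != 0 -> mink (dlift X Y) (dlift X Z) = - hmetric X Y Z.
Proof. by move=> z0; rewrite /mink /hmetric /height dotpE !mxE /=; field. Qed.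

Lemma minkC u v : mink u v = mink v u.
Proof. by rewrite /mink; ring. Qed.

Lemma minkDl u v w : mink (u + v) w = mink u w + mink v w.
Proof. by rewrite /mink !mxE; field. Qed.

Lemma minkZl a u w : mink (a *: u) w = a * mink u w.
Proof. by rewrite /mink !mxE; field. Qed.

Lemma minkBl u v w : mink (u - v) w = mink u w - mink v w.
Proof. by rewrite /mink !mxE; field. Qed.

(** The Gram matrix of [mink]; written by cases on i + j because the null
    coordinates 0 and 3 are paired. *)
Definition minkJ : 'M[R]_4 := \matrix_(i, j)
  (if (i + j == 3)%N then (if (i == 0%N :> nat) || (i == 3%N :> nat) then 2^-1 else 0)
   else if (i == j) && (i != 0%N :> nat) && (i != 3%N :> nat) then -1 else 0).

Lemma minkE u v : mink u v = (u *m minkJ *m v^T) 0 0.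
Proof. by rewrite mxE !sum_ord4 /mink !mxE !sum_ord4 !mxE /=; field. Qed.

Section Derivatives.
Context {V : normedModType R}.

Lemma is_derive_lift (X : V -> 'rV[R]_3) (x v : V) (X' : 'rV[R]_3) :
  X x 0 ord_max != 0 ->
  (forall j, is_derive x v (fun y => X y 0 j) (X' 0 j)) ->
  forall k, is_derive x v (fun y => lift (X y) 0 k) (dlift (X x) X' 0 k).
Proof.
move=> z0 dX.
have dz := is_derive_inv z0 (dX ord_max).
apply: ord4P.
- have -> : (fun y => lift (X y) 0 m0) = (fun y => (X y 0 ord_max)^-1).
    by apply/funext => y; rewrite mxE.
  by rewrite mxE /=.
- have -> : (fun y => lift (X y) 0 m1) = (fun y => X y 0 0 * (X y 0 ord_max)^-1).
    by apply/funext => y; rewrite mxE.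
  by rewrite mxE /=; exact: is_derive_mul.
- have -> : (fun y => lift (X y) 0 m2) = (fun y => X y 0 1 * (X y 0 ord_max)^-1).
    by apply/funext => y; rewrite mxE.
  by rewrite mxE /=; exact: is_derive_mul.
- have -> : (fun y => lift (X y) 0 m3) = (fun y =>
     (X y 0 0 * X y 0 0 + X y 0 1 * X y 0 1 + X y 0 ord_max * X y 0 ord_max) * (X y 0 ord_max)^-1).
    by apply/funext => y; rewrite mxE.
  rewrite mxE /=; apply: is_derive_mul => //.
  have h := is_derive_add (is_derive_add (is_derive_mul (dX 0) (dX 0)) (is_derive_mul (dX 1) (dX 1)))
      (is_derive_mul (dX ord_max) (dX ord_max)).
  by apply: is_derive_eq h _; ring.
Qed.

Lemma is_derive_mink (F G : V -> 'rV[R]_4) (x v : V) (F' G' : 'rV[R]_4) :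
  (forall k, is_derive x v (fun y => F y 0 k) (F' 0 k)) ->
  (forall k, is_derive x v (fun y => G y 0 k) (G' 0 k)) ->
  is_derive x v (fun y => mink (F y) (G y)) (mink F' (G x) + mink (F x) G').
Proof.
move=> dF dG.
have h k l := is_derive_mul (dF k) (dG l).
have D := is_derive_add (is_derive_add (is_derive_mul (is_derive_add (h m0 m3) (h m3 m0))
   (is_derive_const 2^-1 x v)) (is_derive_opp (h m1 m1))) (is_derive_opp (h m2 m2)).
by apply: is_derive_eq D _; rewrite /mink; ring.
Qed.

End Derivatives.

End Minkowski.

Section HalfSpace.
Context {R : realType}.

Lemma open_H3 : open (@H3 R).
Proof.
apply: (open_comp (f := fun X : 'rV[R]_3 => X 0 ord_max) (D := [set t : R | 0 < t])).
  by move=> X _; exact: coord_continuous.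
exact: open_gt.
Qed.

(** Two points of the half-space lie in a common ball of the half-space, for
    the sup norm: its center is high on the vertical axis and its radius is
    the height of the center. *)
Lemma H3_const (F : 'rV[R]_3 -> R) :
  (forall x, H3 x -> forall i, is_derive x (basis_vec i) F 0) ->
  forall a b, H3 a -> H3 b -> F a = F b.
Proof.
move=> dF a b ha hb.
pose T := `|a| + `|b| + 1.
have T0 : 0 < T by rewrite /T ltr_wpDl // addr_ge0.
pose c : 'rV[R]_3 := T *: basis_vec ord_max.
have inb y : H3 y -> `|y| < T -> ball c T y.
  move=> hy yT; apply/ball_rowE; split=> // j; rewrite /c mxE basis_vecE.
  have yj := le_lt_trans (coord_le_norm y j) yT.
  have [->|j2] := eqVneq j ord_max; rewrite ?eqxx ?mulr1.
    have : 0 < y 0 ord_max by exact: hy.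
    have := le_lt_trans (coord_le_norm y ord_max) yT.
    by rewrite !ltr_norml => /andP[h1 h2] h3; apply/andP; split; lra.
  by rewrite mulr0 sub0r normrN.
apply: (@ball_const _ _ F c T).
- move=> y /ball_rowE[_ /(_ ord_max)]; rewrite /c mxE basis_vecE eqxx mulr1.
  by rewrite ltr_norml => /andP[_ h] i; apply: dF; rewrite /H3 /= /height; lra.
- by apply: inb => //; rewrite /T -addrA ltr_pwDr // ltr_wpDl.
- by apply: inb => //; rewrite /T -addrA addrC -addrA ltrDl ltr_pwDl.
Qed.

(** The equation makes F_3 / z and each F_j - c x_j locally constant, hence
    constant on the half-space, and two integrations give F. It is the equation
    satisfied by z times a coordinate of the lift of an isometry, and its
    solutions are the combinations of z times the coordinates of [lift]. *)
Lemma conformal_hessian_solution (F : 'rV[R]_3 -> R) : smooth H3 F ->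
  (forall x, H3 x -> forall i j,
    pd i (pd j F) x
    = (i == j)%:R * pd ord_max F x / x 0 ord_max) ->
  exists al b0 b1 ga, forall x, H3 x ->
    F x = al + b0 * x 0 0 + b1 * x 0 1
      + ga * (x 0 0 * x 0 0 + x 0 1 * x 0 1 + x 0 ord_max * x 0 ord_max).
Proof.
move=> sF FF.
pose o : 'rV[R]_3 := basis_vec ord_max.
have ho : H3 o by rewrite /H3 /= /height /o basis_vecE eqxx ltr01.
have dF i j x : H3 x -> is_derive x (basis_vec i) (pd j F)
    ((i == j)%:R * pd ord_max F x / x 0 ord_max).
  by move=> hx; rewrite -FF //; apply: is_derive_pd hx; exact: smooth_pd.
have dc (i j : 'I_3) (x : 'rV[R]_3) : is_derive x (basis_vec i) (fun y : 'rV[R]_3 => y 0 j) (i == j)%:R.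
  by rewrite -basis_vecE; exact: is_derive_coord.
have z0 (x : 'rV[R]_3) : H3 x -> x 0 ord_max != 0 by move=> hx; rewrite gt_eqF.
pose la x := pd ord_max F x * (x 0 ord_max)^-1.
have laE x : H3 x -> la x = la o.
  move=> hx; apply: (H3_const (F := la)) => // y hy i.
  apply: is_derive_eq (is_derive_mul (dF i ord_max y hy) (is_derive_inv (z0 y hy) (dc i ord_max y))) _.
  by have := z0 y hy; move: (pd ord_max F y) ((i == ord_max)%:R) => d e z; field.
have d3 x : H3 x -> pd ord_max F x = la o * x 0 ord_max.
  by move=> hx; rewrite -(laE x hx) /la divfK // z0.
pose p j x := pd j F x + - (la o * x 0 j).
have pE j x : H3 x -> p j x = p j o.
  move=> hx; apply: (H3_const (F := p j)) => // y hy i.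
  apply: is_derive_eq (is_derive_add (dF i j y hy)
    (is_derive_opp (is_derive_mul (is_derive_const (la o) y (basis_vec i)) (dc i j y)))) _.
  rewrite d3 //; have := z0 y hy; move: (la o) ((i == j)%:R) => d e z; field.
  exact: z.
pose ga := la o / 2.
pose q x := F x + - (p 0 o * x 0 0 + p 1 o * x 0 1
   + ga * (x 0 0 * x 0 0 + x 0 1 * x 0 1 + x 0 ord_max * x 0 ord_max)).
have qE x : H3 x -> q x = q o.
  move=> hx; apply: (H3_const (F := q)) => // y hy i.
  have dcst (a : R) := is_derive_const a y (basis_vec i).
  have dm (a : R) j := is_derive_mul (dcst a) (dc i j y).
  have dd j := is_derive_mul (dc i j y) (dc i j y).
  apply: is_derive_eq (is_derive_add (is_derive_pd i sF hy) (is_derive_opp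
    (is_derive_add (is_derive_add (dm (p 0 o) 0) (dm (p 1 o) 1)) (is_derive_mul (dcst ga)
      (is_derive_add (is_derive_add (dd 0) (dd 1)) (dd ord_max)))))) _.
  have := pE i y hy; have := d3 y hy; rewrite /p /ga.
  case: (ord3P i) => -> /=.
  - by move: (la o) (pd 0 F y) => l d _ E; move: E; lra.
  - by move: (la o) (pd 1 F y) => l d _ E; move: E; lra.
  - by move: (la o) (pd ord_max F y) => l d -> E; move: E; lra.
exists (q o), (p 0 o), (p 1 o), ga => x hx.
by rewrite -(qE x hx) /q; ring.
Qed.

End HalfSpace.

Section LiftFields.
Context {R : realType} {n : nat}.
Implicit Types (X : 'rV[R]_n -> 'rV[R]_3) (O : set 'rV[R]_n) (x : 'rV[R]_n).

Lemma smooth_on_lift O X : open O -> smooth_on O X -> (forall x, O x -> H3 (X x)) ->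
  smooth_on O (fun y => lift (X y)).
Proof.
move=> oO sX hX; have s := (smooth_onP X oO).1 sX; apply/smooth_onP => //.
have sV : smooth O (fun y => (X y 0 ord_max)^-1).
  by apply: smoothV => // y /hX hy; rewrite gt_eqF.
apply: ord4P.
- by apply: smooth_eq sV => // y _; rewrite mxE.
- by apply: smooth_eq (smoothM oO (s 0) sV) => // y _; rewrite mxE.
- by apply: smooth_eq (smoothM oO (s 1) sV) => // y _; rewrite mxE.
- have sq j := smoothM oO (s j) (s j).
  apply: smooth_eq (smoothM oO (smoothD oO (smoothD oO (sq 0) (sq 1)) (sq ord_max)) sV) => //.
  by move=> y _; rewrite mxE.
Qed.

Lemma pd_lift O X x i : open O -> smooth_on O X -> (forall x, O x -> H3 (X x)) -> O x ->
  pd i (fun y => lift (X y)) x = dlift (X x) (pd i X x).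
Proof.
move=> oO sX hX Ox; apply/rowP => k.
have sL := smooth_on_lift oO sX hX.
rewrite (pd_coord i k oO sL Ox); apply: pd_val.
by apply: is_derive_lift => [|j]; [rewrite gt_eqF //; exact: hX|exact: is_derive_pd_coord sX Ox].
Qed.

End LiftFields.

Section Frames.
Context {R : realType}.

Lemma frame_gram (f : 'I_4 -> 'rV[R]_4) (i j : 'I_4) :
  ((\matrix_(a, b) f a 0 b) *m minkJ *m (\matrix_(a, b) f a 0 b)^T) i j = mink (f i) (f j).
Proof.
rewrite minkE !mxE; apply: eq_bigr => k _; rewrite !mxE; congr (_ * _).
by apply: eq_bigr => l _; rewrite !mxE.
Qed.

(** The Gram determinant of the frame is the product of the d i, hence nonzero,
    and it is also the product of the determinants of the factors. *)
Lemma frame_unit (f : 'I_4 -> 'rV[R]_4) (d : 'I_4 -> R) :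
  (forall i j, mink (f i) (f j) = if i == j then d i else 0) -> (forall i, d i != 0) ->
  (\matrix_(a, b) f a 0 b) \in unitmx /\ minkJ \in @unitmx R 4.
Proof.
move=> fd d0; set F := \matrix_(a, b) _.
have e : F *m minkJ *m F^T = diag_mx (\row_i d i).
  apply/matrixP => i j; rewrite frame_gram fd !mxE.
  by case: eqP => [->|_]; rewrite ?mulr1n ?mulr0n.
have : \det (F *m minkJ *m F^T) != 0.
  rewrite e det_diag prodf_seq_neq0; apply/allP => i _; rewrite mxE; exact: d0.
by rewrite !det_mulmx !mulf_eq0 !negb_or !unitmxE !unitfE => /andP[/andP[-> ->] _].
Qed.

Lemma frame_nondeg (f : 'I_4 -> 'rV[R]_4) (d : 'I_4 -> R) (w : 'rV[R]_4) :
  (forall i j, mink (f i) (f j) = if i == j then d i else 0) -> (forall i, d i != 0) ->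
  (forall i, mink w (f i) = 0) -> w = 0.
Proof.
move=> fd d0 wf; have [uF uJ] := frame_unit fd d0; set F := \matrix_(a, b) _ in uF.
have e : w *m minkJ *m F^T = 0.
  apply/rowP => i; rewrite [RHS]mxE -(wf i) minkE !mxE; apply: eq_bigr => k _.
  by rewrite !mxE.
have uFT : F^T \in unitmx by rewrite unitmx_tr.
by rewrite -(mulmxK uJ w) -(mulmxK uFT (w *m minkJ)) e mul0mx mul0mx.
Qed.

End Frames.

(** * Isometries are Lorentz maps *)
Section Isometry.
Context {R : realType}.

Definition metric_map (g : 'rV[R]_3 -> 'rV[R]_3) : Prop :=
  [/\ forall x, H3 x -> H3 (g x), smooth_on H3 g
    & forall x u v, H3 x -> hmetric (g x) ('D_u g x) ('D_v g x) = hmetric x u v].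

Lemma metric_map_id : metric_map id.
Proof.
split=> //.
- by apply/smooth_onP; [exact: open_H3|move=> j; apply: smooth_coord; exact: open_H3].
- by move=> x u v _; rewrite !derive_id.
Qed.

Section OneMap.
Variable g : 'rV[R]_3 -> 'rV[R]_3.
Hypothesis gm : metric_map g.
Implicit Type x : 'rV[R]_3.
Let oH := @open_H3 R.
Let U x := lift (g x).
Let gH x : H3 x -> H3 (g x). Proof. by case: gm => h _ _; exact: h. Qed.
Let sg : smooth_on H3 g. Proof. by case: gm. Qed.
Let sU : smooth_on H3 U. Proof. exact: smooth_on_lift. Qed.
Let gz x : H3 x -> g x 0 ord_max != 0. Proof. by move=> /gH h; rewrite gt_eqF. Qed.
Let xz x : H3 x -> x 0 ord_max != 0. Proof. by move=> h; rewrite gt_eqF. Qed.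
Let DU x i : H3 x -> pd i U x = dlift (g x) (pd i g x).
Proof. by move=> hx; exact: (pd_lift i oH sg gH hx). Qed.

Let gram0 x : H3 x -> mink (U x) (U x) = 1.
Proof. by move=> hx; apply: mink_lift; exact: gz. Qed.

Let gram1 x i : H3 x -> mink (U x) (pd i U x) = 0.
Proof. by move=> hx; rewrite DU //; apply: mink_lift_dlift; exact: gz. Qed.

Let gram2 x i j : H3 x -> mink (pd i U x) (pd j U x) =
  - ((i == j)%:R / x 0 ord_max ^+ 2).
Proof.
move=> hx; rewrite !DU // mink_dlift; last exact: gz.
rewrite -!pdE; case: gm => _ _ -> //; rewrite /hmetric /height; congr (- (_ / _)).
rewrite dotpE !basis_vecE.
by case: (ord3P i) => ->; case: (ord3P j) => -> /=; rewrite ?mulr0 ?mul0r ?mulr1 ?addr0 ?add0r.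
Qed.

Definition frame x (a : 'I_4) : 'rV[R]_4 :=
  nth 0 [:: U x; pd 0 U x; pd 1 U x; pd ord_max U x] a.

Lemma frame_orthogonal x : H3 x -> forall a b,
  mink (frame x a) (frame x b) =
  if a == b then (if a == m0 then 1 else - (x 0 ord_max ^- 2)) else 0.
Proof.
move=> hx; apply: ord4P; apply: ord4P; rewrite /frame /= ?gram0 ?gram1 ?gram2 //=
  ?mul0r ?oppr0 ?mul1r //; by rewrite minkC gram1.
Qed.

Let DDU x i j : H3 x -> forall k, is_derive x (basis_vec i) (fun y => (pd j U y) 0 k)
  ((pd i (pd j U) x) 0 k).
Proof. by move=> hx k; apply: (is_derive_pd_coord i k oH _ hx); exact: smooth_on_pd. Qed.

Let hess0 x i j : H3 x -> mink (pd i (pd j U) x) (U x) =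
  (i == j)%:R / x 0 ord_max ^+ 2.
Proof.
move=> hx.
have d1 := is_derive_mink (fun k => is_derive_pd_coord i k oH sU hx) (DDU i j hx).
have d2 := is_derive_const (0 : R) x (basis_vec i).
have := is_derive_eq_on oH hx (fun y hy => gram1 j hy) d1 d2.
rewrite gram2 // [mink (U x) _]minkC => /eqP.
by rewrite addrC subr_eq0 => /eqP.
Qed.

Let dcoord x (i j : 'I_3) : is_derive x (basis_vec i) (fun y : 'rV[R]_3 => y 0 j) (i == j)%:R.
Proof. by rewrite -basis_vecE; exact: is_derive_coord. Qed.

(* Derivatives of the Gram matrix of the first derivatives. *)
Let hess_sym x i j k : H3 x ->
  mink (pd k (pd i U) x) (pd j U x) +
  mink (pd k (pd j U) x) (pd i U x) =
  2 * (i == j)%:R * (k == ord_max)%:R / x 0 ord_max ^+ 3.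
Proof.
move=> hx.
have d1 := is_derive_mink (DDU k i hx) (DDU k j hx).
have x2 : x 0 ord_max * x 0 ord_max != 0 by rewrite mulf_neq0 // xz.
have d2 := is_derive_opp (is_derive_mul (is_derive_const (i == j)%:R x (basis_vec k))
   (is_derive_inv (f := fun y : 'rV[R]_3 => y 0 ord_max * y 0 ord_max) x2 (is_derive_mul (dcoord x k ord_max) (dcoord x k ord_max)))).
have e y : H3 y -> mink (pd i U y) (pd j U y) =
  - ((i == j)%:R * (y 0 ord_max * y 0 ord_max)^-1).
  by move=> hy; rewrite gram2 // expr2.
have := is_derive_eq_on oH hx e d1 d2.
rewrite [X in _ + X]minkC => ->.
by have := xz hx; move: ((i == j)%:R) ((k == ord_max)%:R) => a b z; field.
Qed.

(* The usual solution of hess_sym by a cyclic sum, which yields the Christoffel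
   symbols. *)
Let hess1 x i j k : H3 x ->
  mink (pd i (pd j U) x) (pd k U x) =
  ((j == k)%:R * (i == ord_max)%:R + (i == k)%:R * (j == ord_max)%:R
   - (i == j)%:R * (k == ord_max)%:R) / x 0 ord_max ^+ 3.
Proof.
move=> hx.
have s a b : pd a (pd b U) x =
   pd b (pd a U) x by apply: pd_comm_vec hx.
have h1 := hess_sym j k i hx; have h2 := hess_sym i k j hx; have h3 := hess_sym i j k hx.
rewrite (s k i) (s k j) in h3; rewrite (s j i) in h2.
move: h1 h2 h3; rewrite !(eq_sym _ k).
move: (mink _ _) (mink _ _) (mink _ _) => a b c.
move: (k == j) (k == i) (i == j) (i == ord_max) (j == ord_max) (k == ord_max) => e1 e2 e3 e4 e5 e6.
move: (x 0 ord_max ^+ 3) => z.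
lra.
Qed.

(** The lift of g and its first derivatives form an orthogonal frame at every
    point, and the products of the second derivatives with this frame are
    determined by the metric alone. Hence the lifts of all isometries satisfy
    one and the same linear system. *)
Lemma hessian_lift x i j : H3 x ->
  pd i (pd j U) x =
  ((i == j)%:R / x 0 ord_max ^+ 2) *: U x
  - (x 0 ord_max)^-1 *: ((i == ord_max)%:R *: pd j U x
     + (j == ord_max)%:R *: pd i U x - (i == j)%:R *: pd ord_max U x).
Proof.
move=> hx; apply/eqP; rewrite -subr_eq0; apply/eqP.
apply: (frame_nondeg (frame_orthogonal hx)).
  by move=> a; case: ifP => _; rewrite ?oner_eq0 // oppr_eq0 invr_eq0 expf_eq0 /= xz.
have z0 := xz hx.
have h0 : mink (pd i (pd j U) x -
  (((i == j)%:R / x 0 ord_max ^+ 2) *: U x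
  - (x 0 ord_max)^-1 *: ((i == ord_max)%:R *: pd j U x
     + (j == ord_max)%:R *: pd i U x - (i == j)%:R *: pd ord_max U x)))
   (U x) = 0.
  rewrite !(minkBl, minkDl, minkZl) gram0 // hess0 // ![mink _ (U x)]minkC !gram1 //.
  by rewrite !mulr0 addr0 subr0 mulr0 mulr1 subr0 subrr.
have h1 k : mink (pd i (pd j U) x -
  (((i == j)%:R / x 0 ord_max ^+ 2) *: U x
  - (x 0 ord_max)^-1 *: ((i == ord_max)%:R *: pd j U x
     + (j == ord_max)%:R *: pd i U x - (i == j)%:R *: pd ord_max U x)))
   (pd k U x) = 0.
  rewrite !(minkBl, minkDl, minkZl) gram1 // hess1 // !gram2 // (eq_sym ord_max k).
  move: z0; move: (x 0 ord_max) (_%:R) (_%:R) (_%:R) (_%:R) (_%:R) (_%:R) => z e1 e2 e3 e4 e5 e6 z0.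
  by field.
by apply: ord4P; rewrite /frame /=.
Qed.

End OneMap.

End Isometry.

(** Smoothness and derivative are proved together as both come from the same
    expansion in coordinates. *)
Lemma pd_linear {R : realType} n p q (O : set 'rV[R]_n) (W : 'rV[R]_n -> 'rV[R]_p) (M : 'M[R]_(p, q))
   (x : 'rV[R]_n) i : open O -> smooth_on O W -> O x ->
   smooth_on O (fun y => W y *m M) /\ pd i (fun y => W y *m M) x = pd i W x *m M.
Proof.
move=> oO sW Ox.
have s : smooth_on O (fun y => W y *m M).
  apply/smooth_onP => // k.
  apply: (smooth_eq (f := fun y => \sum_l W y 0 l * M l k)) => //.
    by move=> y _; rewrite mxE.
  apply: smooth_sum => // l; apply: smoothM => //; last exact: smooth_cst.
  exact: (smooth_onP _ oO).1.
split=> //; apply/rowP => k; rewrite (pd_coord i k oO s Ox) [RHS]mxE.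
apply: pd_val.
have D l := is_derive_mul (is_derive_pd_coord i l oO sW Ox) (is_derive_const (M l k) x (basis_vec i)).
have := is_derive_sum (h := fun l (y : 'rV[R]_n) => W y 0 l * M l k) D.
rewrite (eq_bigr (fun l => pd i W x 0 l * M l k)); last by move=> l _; rewrite mulr0 addr0.
congr (is_derive _ _ _ _).
by apply/funext => y; rewrite [RHS]mxE fct_sumE.
Qed.


Section IsometryGroup.
Context {R : realType}.
Implicit Types (g : 'rV[R]_3 -> 'rV[R]_3) (x y : 'rV[R]_3).
Let oH := @open_H3 R.

Lemma smooth_on_lift_map g : metric_map g -> smooth_on H3 (fun x => lift (g x)).
Proof. by case=> gH sg _; exact: smooth_on_lift. Qed.

(** Multiplying a coordinate of the lift by the height turns the system of
    [hessian_lift] into the equation of [conformal_hessian_solution]. *)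
Lemma metric_map_linear g : metric_map g ->
  exists M : 'M[R]_4, forall x, H3 x -> lift (g x) = lift x *m M.
Proof.
move=> gm; have sU := smooth_on_lift_map gm.
pose U x := lift (g x).
have coef k : exists c : 'rV[R]_4, forall x, H3 x -> U x 0 k = \sum_l lift x 0 l * c 0 l.
  have sUk : smooth H3 (fun x => U x 0 k) by apply: (smooth_onP _ oH).1.
  pose F x := x 0 ord_max * U x 0 k.
  have sz := smooth_coord (ord_max : 'I_3) oH.
  have sF : smooth H3 F := smoothM oH sz sUk.
  have dz x (i : 'I_3) : is_derive x (basis_vec i) (fun y : 'rV[R]_3 => y 0 ord_max) (i == ord_max)%:R.
    by rewrite -basis_vecE; exact: is_derive_coord.
  have dF x i : H3 x -> pd i F x = (i == ord_max)%:R * U x 0 k + x 0 ord_max * pd i (fun y => U y 0 k) x.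
    move=> hx; apply: pd_val; apply: is_derive_mul => //.
    exact: is_derive_pd sUk hx.
  have ddF x i j : H3 x -> pd i (pd j F) x = (i == j)%:R * pd ord_max F x / x 0 ord_max.
    move=> hx; have z0 : x 0 ord_max != 0 by rewrite gt_eqF.
    rewrite (pd_eq_on i oH hx (fun y hy => dF y j hy)).
    have D := is_derive_add (is_derive_mul (is_derive_const (j == ord_max)%:R x (basis_vec i))
       (is_derive_pd i sUk hx)) (is_derive_mul (dz x i) (is_derive_pd i (smooth_pd j sUk) hx)).
    rewrite (pd_val D) dF //.
    have := hessian_lift gm i j hx.
    move=> /(congr1 (fun w : 'rV[R]_4 => w 0 k)); rewrite (pd_coord2 i j k oH sU hx) => ->.
    rewrite !mxE !(pd_coord _ k oH sU hx) eqxx.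
    move: z0; rewrite -/(U x 0 k).
    move: (pd i _ x : R) (pd j _ x : R) (pd ord_max _ x : R) => p1 p2 p3.
    move: (i == j) (i == ord_max) (j == ord_max) => e1 e2 e3.
    move: (x 0 ord_max) => z z0; move: (nth _ _ _) => u.
    rewrite -[true%:R]/(1 : R); field.
    exact: z0.
  have [al [b0 [b1 [ga E]]]] := conformal_hessian_solution sF (fun x hx i j => ddF x i j hx).
  exists (\row_l nth 0 [:: al; b0; b1; ga] l) => x hx.
  have z0 : x 0 ord_max != 0 by rewrite gt_eqF.
  apply: (mulfI z0); rewrite -/(F x) (E x hx) sum_ord4 !mxE /=; field.
  exact: z0.
have [c cE] := choice coef.
exists (\matrix_(l, k) c k 0 l) => x hx; apply/rowP => k.
by rewrite [RHS]mxE -/(U x) cE //; apply: eq_bigr => l _; congr (_ * _); rewrite mxE.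
Qed.

(** M maps the frame of the identity to the frame of g, and these orthogonal
    frames have the same Gram matrix. *)
Lemma isometry_lorentz g : metric_map g ->
  exists M : 'M[R]_4, [/\ M \in unitmx, forall u v, mink (u *m M) (v *m M) = mink u v
    & forall x, H3 x -> lift (g x) = lift x *m M].
Proof.
move=> gm; have [M ME] := metric_map_linear gm.
pose o : 'rV[R]_3 := basis_vec ord_max.
have ho : H3 o by rewrite /H3 /= /height /o basis_vecE eqxx ltr01.
have z0 : o 0 ord_max != 0 by rewrite gt_eqF.
have fE a : frame g o a = frame id o a *m M.
  have pE i : pd i (fun x => lift (g x)) o = pd i (fun x => lift x) o *m M.
    rewrite -(pd_linear M i oH (smooth_on_lift_map metric_map_id) ho).2.
    exact: pd_eq_on oH ho ME.
  by move: a; apply: ord4P; rewrite /frame /= ?pE // ME.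
have gram := frame_orthogonal gm ho; have gramid := frame_orthogonal metric_map_id ho.
have d0 (a : 'I_4) : (if a == m0 then 1 else - (o 0 ord_max ^- 2)) != 0 :> R.
  by case: ifP => _; rewrite ?oner_eq0 // oppr_eq0 invr_eq0 expf_eq0 /= z0.
have [uF uJ] := frame_unit gramid d0; have [uG _] := frame_unit gram d0.
set F := \matrix_(a, b) frame id o a 0 b in uF; set G := \matrix_(a, b) _ in uG.
have GE : G = F *m M.
  by apply/matrixP => a b; rewrite mxE fE !mxE; apply: eq_bigr => k _; rewrite !mxE.
have uM : M \in unitmx.
  by move: uG; rewrite GE unitmxE det_mulmx unitrM -unitmxE => /andP[].
have MJM : M *m minkJ *m M^T = minkJ.
  have uFT : F^T \in unitmx by rewrite unitmx_tr.
  apply: (can_inj (mulKmx uF)); apply: (can_inj (mulmxK uFT)).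
  rewrite !mulmxA -GE -[_ *m M^T *m _]mulmxA -trmx_mul -GE.
  by apply/matrixP => a b; rewrite !frame_gram gram gramid.
exists M; split=> // u v.
by rewrite !minkE trmx_mul !mulmxA -(mulmxA u M) -(mulmxA u _ M^T) MJM.
Qed.

End IsometryGroup.

(** * Curvature in terms of lifts *)
Section Determinants.
Context {R : realType}.
Implicit Types (a b c d P A B C L : 'rV[R]_4).

Definition rows4 a b c d : 'M[R]_4 := \matrix_(i, j) (nth 0 [:: a; b; c; d] i) 0 j.
Definition det4 a b c d : R := \det (rows4 a b c d).

(** With entries indexed by natural numbers, the minors of small matrices reduce
    by computation. *)
Lemma det_nat_expand n (f : nat -> nat -> R) :
  \det (\matrix_(i < n.+1, j < n.+1) f i j) =
  \sum_(j < n.+1) f 0%N j * ((-1) ^+ j * \det (\matrix_(i < n, k < n) f i.+1 (bump j k))).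
Proof.
rewrite (expand_det_row _ ord0); apply: eq_bigr => j _; rewrite mxE /cofactor add0n.
by congr (_ * (_ * \det _)); apply/matrixP => i k; rewrite !mxE.
Qed.

Lemma det_nat2 (f : nat -> nat -> R) :
  \det (\matrix_(i < 2, j < 2) f i j) = f 0%N 0%N * f 1%N 1%N - f 0%N 1%N * f 1%N 0%N.
Proof.
rewrite det_nat_expand !big_ord_recl big_ord0 !det_mx11 !mxE /=.
by rewrite expr0 expr1; ring.
Qed.

Lemma det_nat3 (f : nat -> nat -> R) :
  \det (\matrix_(i < 3, j < 3) f i j) =
  f 0%N 0%N * (f 1%N 1%N * f 2%N 2%N - f 1%N 2%N * f 2%N 1%N)
  - f 0%N 1%N * (f 1%N 0%N * f 2%N 2%N - f 1%N 2%N * f 2%N 0%N)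
  + f 0%N 2%N * (f 1%N 0%N * f 2%N 1%N - f 1%N 1%N * f 2%N 0%N).
Proof.
have e (j : nat) := det_nat2 (fun i k => f i.+1 (bump j k)).
by rewrite det_nat_expand !big_ord_recl big_ord0 !e /= expr0 expr1 expr2; ring.
Qed.

Lemma det4E a b c d : det4 a b c d =
  (a 0 m0 * b 0 m1 - a 0 m1 * b 0 m0) * (c 0 m2 * d 0 m3 - c 0 m3 * d 0 m2)
  - (a 0 m0 * b 0 m2 - a 0 m2 * b 0 m0) * (c 0 m1 * d 0 m3 - c 0 m3 * d 0 m1)
  + (a 0 m0 * b 0 m3 - a 0 m3 * b 0 m0) * (c 0 m1 * d 0 m2 - c 0 m2 * d 0 m1)
  + (a 0 m1 * b 0 m2 - a 0 m2 * b 0 m1) * (c 0 m0 * d 0 m3 - c 0 m3 * d 0 m0)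
  - (a 0 m1 * b 0 m3 - a 0 m3 * b 0 m1) * (c 0 m0 * d 0 m2 - c 0 m2 * d 0 m0)
  + (a 0 m2 * b 0 m3 - a 0 m3 * b 0 m2) * (c 0 m0 * d 0 m1 - c 0 m1 * d 0 m0).
Proof.
pose s (u : 'rV[R]_4) := [:: u 0 m0; u 0 m1; u 0 m2; u 0 m3].
pose f (i j : nat) : R := nth 0 (nth [::] [:: s a; s b; s c; s d] i) j.
have -> : det4 a b c d = \det (\matrix_(i < 4, j < 4) f i j).
  congr (\det _); apply/matrixP => i j; rewrite !mxE.
  by move: i; apply: ord4P => /=; move: j; apply: ord4P.
have e (j : nat) := det_nat3 (fun i k => f i.+1 (bump j k)).
rewrite (@det_nat_expand 3 f) !big_ord_recl big_ord0 !e /f /= /bump /=.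
by rewrite expr0 expr1 expr2 exprS expr2; ring.
Qed.

Lemma det4_mulmx a b c d (M : 'M[R]_4) :
  det4 (a *m M) (b *m M) (c *m M) (d *m M) = det4 a b c d * \det M.
Proof.
rewrite -det_mulmx; congr (\det _); apply/matrixP => i j; rewrite !mxE.
by move: i; apply: ord4P => /=; rewrite mxE; apply: eq_bigr => k _; rewrite mxE.
Qed.

Lemma det4_triangular P A B C (s t u k1 k2 k3 : R) :
  det4 (s *: P) (s *: A + t *: P) (s *: B + u *: P) (s *: C + k1 *: P + k2 *: A + k3 *: B)
  = s ^+ 4 * det4 P A B C.
Proof. by rewrite !det4E !mxE; ring. Qed.

Lemma det4_triangular3 P A B L (s t u : R) :
  det4 (s *: P) (s *: A + t *: P) (s *: B + u *: P) L = s ^+ 3 * det4 P A B L.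
Proof. by rewrite !det4E !mxE; ring. Qed.

End Determinants.

Section SurfaceAlgebra.
Context {R : realType}.
Implicit Types (p a b c u v : 'rV[R]_3) (L : 'rV[R]_4).

(** The second derivative of the lift of a map at p with first derivatives u
    and v and second derivative c. *)
Definition d2lift p u v c : 'rV[R]_4 :=
  let z := p 0 ord_max in
  \row_k nth 0
  [:: - c 0 ord_max / z ^+ 2 + 2 * u 0 ord_max * v 0 ord_max / z ^+ 3;
   c 0 0 / z - v 0 0 * u 0 ord_max / z ^+ 2 - u 0 0 * v 0 ord_max / z ^+ 2
     + p 0 0 * (- c 0 ord_max / z ^+ 2 + 2 * u 0 ord_max * v 0 ord_max / z ^+ 3);
   c 0 1 / z - v 0 1 * u 0 ord_max / z ^+ 2 - u 0 1 * v 0 ord_max / z ^+ 2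
     + p 0 1 * (- c 0 ord_max / z ^+ 2 + 2 * u 0 ord_max * v 0 ord_max / z ^+ 3);
   (2 * (dotp u v + dotp p c)) / z - 2 * dotp p v * u 0 ord_max / z ^+ 2
     - 2 * dotp p u * v 0 ord_max / z ^+ 2
     + dotp p p * (- c 0 ord_max / z ^+ 2 + 2 * u 0 ord_max * v 0 ord_max / z ^+ 3)] k.

(* The lift without its factor 1 / z, and its derivatives: derivatives of 1 / z
   only add multiples of lower-order rows, which determinants ignore. *)
Let h0 p : 'rV[R]_4 := \row_k nth 0 [:: 1; p 0 0; p 0 1; dotp p p] k.
Let h1 p a : 'rV[R]_4 := \row_k nth 0 [:: 0; a 0 0; a 0 1; 2 * dotp p a] k.
Let h2 p u v c : 'rV[R]_4 := \row_k nth 0 [:: 0; c 0 0; c 0 1; 2 * (dotp u v + dotp p c)] k.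

Let liftE p : p 0 ord_max != 0 -> lift p = (p 0 ord_max)^-1 *: h0 p.
Proof.
move=> z0; apply/rowP; apply: ord4P; rewrite !mxE /= ?mulr1 1?mulrC //.
by rewrite dotpE.
Qed.

Let dliftE p a : p 0 ord_max != 0 ->
  dlift p a = (p 0 ord_max)^-1 *: h1 p a + (- a 0 ord_max / p 0 ord_max ^+ 2) *: h0 p.
Proof.
move=> z0; apply/rowP; apply: ord4P; rewrite !mxE /= ?dotpE.
- by rewrite mulr0 add0r mulr1.
- by ring.
- by ring.
- by ring.
Qed.

Let d2liftE p u v c : p 0 ord_max != 0 ->
  d2lift p u v c = (p 0 ord_max)^-1 *: h2 p u v c
   + (- c 0 ord_max / p 0 ord_max ^+ 2 + 2 * u 0 ord_max * v 0 ord_max / p 0 ord_max ^+ 3) *: h0 p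
   + (- v 0 ord_max / p 0 ord_max ^+ 2) *: h1 p u + (- u 0 ord_max / p 0 ord_max ^+ 2) *: h1 p v.
Proof.
move=> z0; apply/rowP; apply: ord4P; rewrite !mxE /= ?dotpE; by field.
Qed.

(** The determinant of the lift, its first derivatives and a second derivative
    is a multiple of the corresponding entry of the second fundamental form;
    compare [second_formE]. *)
Lemma det4_d2lift p a b u v c : p 0 ord_max != 0 -> (u = a \/ u = b) -> (v = a \/ v = b) ->
  det4 (lift p) (dlift p a) (dlift p b) (d2lift p u v c) =
  2 / p 0 ord_max ^+ 3 * (dotp (crossp a b) c + dotp u v * crossp a b 0 ord_max / p 0 ord_max).
Proof.
move=> z0 ua vb.
have [s [t E]] : exists s t, d2lift p u v c = (p 0 ord_max)^-1 *: h2 p u v c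
   + (- c 0 ord_max / p 0 ord_max ^+ 2 + 2 * u 0 ord_max * v 0 ord_max / p 0 ord_max ^+ 3) *: h0 p
   + s *: h1 p a + t *: h1 p b.
  rewrite d2liftE //; case: ua => ->; case: vb => ->.
  - exists (- a 0 ord_max / p 0 ord_max ^+ 2 + - a 0 ord_max / p 0 ord_max ^+ 2), 0.
    by rewrite -!addrA; congr (_ + (_ + _)); rewrite scale0r addr0 -scalerDl.
  - by eexists; eexists.
  - by eexists; eexists; rewrite addrAC.
  - exists 0, (- b 0 ord_max / p 0 ord_max ^+ 2 + - b 0 ord_max / p 0 ord_max ^+ 2).
    by rewrite -!addrA; congr (_ + (_ + _)); rewrite scale0r add0r -scalerDl.
rewrite liftE // !dliftE // E det4_triangular det4E [dotp (crossp a b) c]dotpE.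
have [-> -> ->] := crosspE a b; rewrite !mxE /= !dotpE.
by field.
Qed.

(** Up to a factor, the component along nu of the tangent vector of the
    half-space obtained by projecting the constant vector L to the hyperboloid.
    For L = [e3] this vector is a multiple of dz. *)
Definition tangency p (nu : 'rV[R]_3) L : R :=
  let z := p 0 ord_max in
  nu 0 0 * (2 * z * (L 0 m1 - L 0 m0 * p 0 0)) + nu 0 1 * (2 * z * (L 0 m2 - L 0 m0 * p 0 1))
  + nu 0 ord_max * (L 0 m3 - 2 * p 0 0 * L 0 m1 - 2 * p 0 1 * L 0 m2
      + L 0 m0 * (p 0 0 * p 0 0 + p 0 1 * p 0 1 - z * z)).

Lemma det4_dlift p a b L : p 0 ord_max != 0 ->
  det4 (lift p) (dlift p a) (dlift p b) L = (p 0 ord_max)^-1 ^+ 3 * tangency p (crossp a b) L.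
Proof.
move=> z0; rewrite liftE // !dliftE // det4_triangular3 det4E !mxE /= /tangency.
have [-> -> ->] := crosspE a b; rewrite !dotpE.
congr (_ * _); by ring.
Qed.

Lemma lagrange a b : dotp (crossp a b) (crossp a b) = dotp a a * dotp b b - dotp a b ^+ 2.
Proof. by rewrite !dotpE; have [-> -> ->] := crosspE a b; ring. Qed.

Lemma dotp_ge0 a : 0 <= dotp a a.
Proof. by rewrite dotpE -!expr2 !addr_ge0 // sqr_ge0. Qed.

Lemma dotp_eq0 a : dotp a a = 0 -> a = 0.
Proof.
rewrite dotpE -!expr2 => h.
have g0 := sqr_ge0 (a 0 0); have g1 := sqr_ge0 (a 0 1); have g2 := sqr_ge0 (a 0 ord_max).
have e0 : a 0 0 ^+ 2 = 0 by lra.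
have e1 : a 0 1 ^+ 2 = 0 by lra.
have e2 : a 0 ord_max ^+ 2 = 0 by lra.
apply/rowP => k; rewrite mxE; apply/eqP; rewrite -sqrf_eq0.
by case: (ord3P k) => ->; rewrite (e0, e1, e2).
Qed.

(** The squared norm of the cross product is the Gram determinant of the rows
    ([lagrange]). *)
Lemma row_free_crossp (A : 'M[R]_(2, 3)) a b : row 0 A = a -> row 1 A = b ->
  row_free A <-> 0 < dotp (crossp a b) (crossp a b).
Proof.
move=> ra rb.
have mE (u : 'rV[R]_2) : u *m A = u 0 0 *: a + u 0 1 *: b.
  by rewrite mulmx_sum_row sum_ord2 ra rb.
split=> [fA|D0].
- rewrite lt_def dotp_ge0 andbT; apply/eqP; rewrite lagrange => D.
  have inj (u : 'rV[R]_2) : u *m A = 0 -> u = 0.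
    by move=> /eqP; rewrite mulmx_free_eq0 // => /eqP.
  have e : dotp b b *: a + (- dotp a b) *: b = 0.
    apply: dotp_eq0; transitivity (dotp b b * (dotp a a * dotp b b - dotp a b ^+ 2)).
      by rewrite !dotpE !mxE; ring.
    by rewrite D mulr0.
  have := inj (\row_k if k == 0 then dotp b b else - dotp a b).
  rewrite mE !mxE /= => /(_ e) /rowP /(_ 0); rewrite !mxE /= => /dotp_eq0 b0.
  have := inj (\row_k if k == 0 then 0 else 1).
  by rewrite mE !mxE /= b0 scaler0 scale0r addr0 => /(_ erefl) /rowP /(_ 1) /eqP; rewrite !mxE /= oner_eq0.
- apply: inj_row_free => u; rewrite mE => e.
  have e' k : u 0 0 * a 0 k + u 0 1 * b 0 k = 0.
    by have /rowP/(_ k) := e; rewrite !mxE.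
  have u0 : u 0 0 * dotp (crossp a b) (crossp a b) = 0.
    transitivity ((u 0 0 * a 0 0 + u 0 1 * b 0 0) * (dotp b b * a 0 0 - dotp a b * b 0 0)
      + (u 0 0 * a 0 1 + u 0 1 * b 0 1) * (dotp b b * a 0 1 - dotp a b * b 0 1)
      + (u 0 0 * a 0 ord_max + u 0 1 * b 0 ord_max) * (dotp b b * a 0 ord_max - dotp a b * b 0 ord_max)).
      by rewrite lagrange !dotpE; ring.
    by rewrite !e' !mul0r !addr0.
  have u1 : u 0 1 * dotp (crossp a b) (crossp a b) = 0.
    transitivity ((u 0 0 * a 0 0 + u 0 1 * b 0 0) * (dotp a a * b 0 0 - dotp a b * a 0 0)
      + (u 0 0 * a 0 1 + u 0 1 * b 0 1) * (dotp a a * b 0 1 - dotp a b * a 0 1)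
      + (u 0 0 * a 0 ord_max + u 0 1 * b 0 ord_max) * (dotp a a * b 0 ord_max - dotp a b * a 0 ord_max)).
      by rewrite lagrange !dotpE; ring.
    by rewrite !e' !mul0r !addr0.
  have nz := lt0r_neq0 D0.
  apply/rowP => k; rewrite mxE.
  by case: (ord2P k) => ->; apply: (mulIf nz); rewrite mul0r.
Qed.

End SurfaceAlgebra.

Section SurfaceCurvature.
Context {R : realType}.
Variables (O : set 'rV[R]_2) (X : 'rV[R]_2 -> 'rV[R]_3).
Hypotheses (oO : open O) (sX : smooth_on O X) (hX : forall y, O y -> H3 (X y)).
Implicit Types (y : 'rV[R]_2) (L : 'rV[R]_4).

Definition normal_field (X : 'rV[R]_2 -> 'rV[R]_3) y := crossp (pd 0 X y) (pd 1 X y).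
Local Notation nu := (normal_field X).
Local Notation z y := (X y 0 ord_max).

Lemma second_form_pd y i j : second_form X y i j =
  hmetric (X y) (pd i (pd j X) y + christoffel (X y) (pd i X y) (pd j X y)) (unit_normal X y).
Proof. by rewrite mxE pd.unlock. Qed.

Lemma unit_normal_pd y : unit_normal X y =
  (z y / Num.sqrt (dotp (nu y) (nu y))) *: nu y.
Proof. by rewrite /unit_normal /normal_field pd.unlock. Qed.

Lemma crossp_dotl (a b : 'rV[R]_3) : dotp (crossp a b) a = 0 /\ dotp (crossp a b) b = 0.
Proof. by rewrite !dotpE; have [-> -> ->] := crosspE a b; split; ring. Qed.

(** The terms of the connection along the two tangent vectors are orthogonal to
    the normal; only the gradient term is left. *)
Lemma second_formE y i j : z y != 0 -> 0 < dotp (nu y) (nu y) ->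
  second_form X y i j = (z y * Num.sqrt (dotp (nu y) (nu y)))^-1 *
   (dotp (nu y) (pd i (pd j X) y) + dotp (pd i X y) (pd j X y) * nu y 0 ord_max / z y).
Proof.
move=> z0 D0; rewrite second_form_pd unit_normal_pd /hmetric /christoffel /height.
have s0 : Num.sqrt (dotp (nu y) (nu y)) != 0 by rewrite gt_eqF // sqrtr_gt0.
have hi : dotp (nu y) (pd i X y) = 0.
  by have [h0 h1] := crossp_dotl (pd 0 X y) (pd 1 X y); case: (ord2P i) => ->.
have hj : dotp (nu y) (pd j X y) = 0.
  by have [h0 h1] := crossp_dotl (pd 0 X y) (pd 1 X y); case: (ord2P j) => ->.
set s := Num.sqrt _ in s0 *; clearbody s; move: s0 hi hj z0; rewrite /dz.
move: (X y) (nu y) (pd i X y) (pd j X y) (pd i (pd j X) y) => p n a b c.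
rewrite !dotpE !mxE /= -[false%:R]/(0 : R) -[true%:R]/(1 : R) => s0 ha hb z0.
have E : (c 0 0 + - (p 0 ord_max)^-1 * (a 0 ord_max * b 0 0 + b 0 ord_max * a 0 0 -
   (a 0 0 * b 0 0 + a 0 1 * b 0 1 + a 0 ord_max * b 0 ord_max) * 0)) * n 0 0 +
   (c 0 1 + - (p 0 ord_max)^-1 * (a 0 ord_max * b 0 1 + b 0 ord_max * a 0 1 -
   (a 0 0 * b 0 0 + a 0 1 * b 0 1 + a 0 ord_max * b 0 ord_max) * 0)) * n 0 1 +
   (c 0 ord_max + - (p 0 ord_max)^-1 * (a 0 ord_max * b 0 ord_max + b 0 ord_max * a 0 ord_max -
   (a 0 0 * b 0 0 + a 0 1 * b 0 1 + a 0 ord_max * b 0 ord_max) * 1)) * n 0 ord_max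
  = (n 0 0 * c 0 0 + n 0 1 * c 0 1 + n 0 ord_max * c 0 ord_max)
   + (a 0 0 * b 0 0 + a 0 1 * b 0 1 + a 0 ord_max * b 0 ord_max) * n 0 ord_max / p 0 ord_max
   - (p 0 ord_max)^-1 * a 0 ord_max * (n 0 0 * b 0 0 + n 0 1 * b 0 1 + n 0 ord_max * b 0 ord_max)
   - (p 0 ord_max)^-1 * b 0 ord_max * (n 0 0 * a 0 0 + n 0 1 * a 0 1 + n 0 ord_max * a 0 ord_max).
  by ring.
rewrite ha hb !mulr0 !subr0 in E.
rewrite -E; field.
by rewrite z0 s0.
Qed.

Lemma det2E (A : 'M[R]_2) : \det A = A 0 0 * A 1 1 - A 0 1 * A 1 0.
Proof.
rewrite (expand_det_row _ 0) sum_ord2 /cofactor !det_mx11 !mxE /= expr0 expr1.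
have -> : fintype.lift 0 0 = 1 :> 'I_2 by exact: val_inj.
have -> : fintype.lift 1 0 = 0 :> 'I_2 by exact: val_inj.
by ring.
Qed.

Lemma trace_invmx2 (A B : 'M[R]_2) : \det A != 0 ->
  \tr (invmx A *m B) =
   (A 1 1 * B 0 0 - A 0 1 * B 1 0 - A 1 0 * B 0 1 + A 0 0 * B 1 1) / \det A.
Proof.
move=> dA.
have dE := det2E A.
pose A' : 'M[R]_2 := (\det A)^-1 *: \matrix_(i, j)
   (if i == 0 then (if j == 0 then A 1 1 else - A 0 1) else (if j == 0 then - A 1 0 else A 0 0)).
have A'A : A' *m A = 1%:M.
  apply/matrixP => i j; rewrite -scalemxAl !mxE sum_ord2 !mxE.
  case: (ord2P i) => ->; case: (ord2P j) => -> /=; rewrite dE; rewrite dE in dA.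
  - by rewrite mulr1n; field.
  - by rewrite mulr0n; ring.
  - by rewrite mulr0n; ring.
  - by rewrite mulr1n; field.
have [uA _] := mulmx1_unit (mulmx1C A'A).
have -> : invmx A = A' by rewrite -[A']mulmx1 -(mulmxV uA) mulmxA A'A mul1mx.
rewrite /mxtrace sum_ord2 !mxE !sum_ord2 !mxE /=.
by ring.
Qed.

Local Notation E y := (dotp (pd 0 X y) (pd 0 X y)).
Local Notation F y := (dotp (pd 0 X y) (pd 1 X y)).
Local Notation G y := (dotp (pd 1 X y) (pd 1 X y)).

(** Twice the Euclidean mean curvature, times the cube of the norm of the
    cross product, so that no square root or quotient appears. *)
Definition euclid_trace (X : 'rV[R]_2 -> 'rV[R]_3) y : R :=
  let n := normal_field X y in
  dotp (pd 1 X y) (pd 1 X y) * dotp n (pd 0 (pd 0 X) y)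
  - dotp (pd 0 X y) (pd 1 X y) * dotp n (pd 0 (pd 1 X) y)
  - dotp (pd 0 X y) (pd 1 X y) * dotp n (pd 1 (pd 0 X) y)
  + dotp (pd 0 X y) (pd 0 X y) * dotp n (pd 1 (pd 1 X) y).

(** The polynomial form of the horo-shrinker equation, with the field of the
    vector L in place of dz. *)
Definition shrinker_eq (X : 'rV[R]_2 -> 'rV[R]_3) y L : Prop :=
  let n := normal_field X y in let z := X y 0 ord_max in
  z ^+ 2 * euclid_trace X y + 2 * dotp n n * z * n 0 ord_max = 2 * dotp n n * tangency (X y) n L.

Definition e3 : 'rV[R]_4 := \row_k (k == m3)%:R.

Lemma tangency_e3 p (n : 'rV[R]_3) : tangency p n e3 = n 0 ord_max.
Proof. by rewrite /tangency !mxE /=; ring. Qed.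

Lemma first_form_pd y i j : first_form X y i j = dotp (pd i X y) (pd j X y) / z y ^+ 2.
Proof. by rewrite mxE /hmetric pd.unlock. Qed.

Lemma det_first_form y : \det (first_form X y) = dotp (nu y) (nu y) / z y ^+ 4.
Proof.
rewrite det2E !first_form_pd lagrange (_ : dotp (pd 1 X y) (pd 0 X y) = F y); last first.
  by rewrite !dotpE; ring.
move: (E y) (F y) (G y) (z y) => a b c t.
have [->|t0] := eqVneq t 0; first by rewrite !expr0n /= invr0; ring.
by field.
Qed.

Lemma mean_curvature_shrinker y : O y -> 0 < dotp (nu y) (nu y) ->
  mean_curvature X y = hmetric (X y) (unit_normal X y) dz <-> shrinker_eq X y e3.
Proof.
move=> Oy D0; have z0 : z y != 0 by rewrite gt_eqF //; exact: hX.
have n0 := lt0r_neq0 D0.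
have s0 : Num.sqrt (dotp (nu y) (nu y)) != 0 by rewrite gt_eqF // sqrtr_gt0.
rewrite /mean_curvature /shape_operator trace_invmx2; last first.
  by rewrite det_first_form mulf_neq0 // invr_neq0 // expf_neq0.
rewrite det_first_form !first_form_pd !second_formE //.
rewrite (_ : dotp (pd 1 X y) (pd 0 X y) = F y); last by rewrite !dotpE; ring.
rewrite unit_normal_pd /hmetric /height (_ : dotp (_ *: nu y) dz =
   z y / Num.sqrt (dotp (nu y) (nu y)) * nu y 0 ord_max); last first.
  by rewrite dotpE /dz !basis_vecE !mxE /=; ring.
rewrite /shrinker_eq tangency_e3 /euclid_trace.
have DE : dotp (nu y) (nu y) = E y * G y - F y ^+ 2 by rewrite /normal_field lagrange.
set s := Num.sqrt _ in s0 *; clearbody s.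
move: z0 n0 s0 DE; move: (E y) (F y) (G y) (z y) (dotp (nu y) (nu y)) (nu y 0 ord_max).
move: (dotp _ _) (dotp _ _) (dotp _ _) (dotp _ _) => c00 c01 c10 c11 a b c t D n t0 D0' s0 DE.
set lhs := (X in X = _ <-> _); set rhs := (X in _ = X <-> _).
set l2 := (X in _ <-> X = _); set r2 := (X in _ <-> _ = X).
have e : (lhs - rhs) * (2 * D * s * t) = l2 - r2.
  rewrite /lhs /rhs /l2 /r2 DE; rewrite DE in D0'; field.
  by rewrite t0 s0 D0'.
have k0 : 2 * D * s * t != 0 by rewrite !mulf_neq0.
split=> h; apply/eqP; rewrite -subr_eq0.
  by rewrite -e h subrr mul0r.
by apply/eqP/(mulIf k0); rewrite e h subrr mul0r.
Qed.

End SurfaceCurvature.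

Section MinkowskiCurvature.
Context {R : realType}.

Lemma is_derive_dotp {V : normedModType R} (X Y : V -> 'rV[R]_3) (x v : V) (X' Y' : 'rV[R]_3) :
  (forall j, is_derive x v (fun y => X y 0 j) (X' 0 j)) ->
  (forall j, is_derive x v (fun y => Y y 0 j) (Y' 0 j)) ->
  is_derive x v (fun y => dotp (X y) (Y y)) (dotp X' (Y x) + dotp (X x) Y').
Proof.
move=> dX dY.
have -> : (fun y => dotp (X y) (Y y)) =
  (fun y => X y 0 0 * Y y 0 0 + X y 0 1 * Y y 0 1 + X y 0 ord_max * Y y 0 ord_max).
  by apply/funext => y; rewrite dotpE.
have h j := is_derive_mul (dX j) (dY j).
by apply: is_derive_eq (is_derive_add (is_derive_add (h 0) (h 1)) (h ord_max)) _; rewrite !dotpE; ring.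
Qed.

Lemma is_derive_dlift {V : normedModType R} (X Y : V -> 'rV[R]_3) (x v : V) (X' Y' : 'rV[R]_3) :
  X x 0 ord_max != 0 ->
  (forall j, is_derive x v (fun y => X y 0 j) (X' 0 j)) ->
  (forall j, is_derive x v (fun y => Y y 0 j) (Y' 0 j)) ->
  forall k, is_derive x v (fun y => dlift (X y) (Y y) 0 k) (d2lift (X x) X' (Y x) Y' 0 k).
Proof.
move=> z0 dX dY.
have z2 : X x 0 ord_max * X x 0 ord_max != 0 by rewrite mulf_neq0.
have dz := is_derive_inv z0 (dX ord_max).
have dz2 := is_derive_inv (f := fun y => X y 0 ord_max * X y 0 ord_max) z2
  (is_derive_mul (dX ord_max) (dX ord_max)).
have dm := is_derive_mul (is_derive_opp (dY ord_max)) dz2.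
apply: ord4P.
- have -> : (fun y => dlift (X y) (Y y) 0 m0) =
    (fun y => - Y y 0 ord_max * (X y 0 ord_max * X y 0 ord_max)^-1).
    by apply/funext => y; rewrite mxE /= expr2.
  by apply: is_derive_eq dm _; rewrite mxE /=; field.
- have -> : (fun y => dlift (X y) (Y y) 0 m1) =
    (fun y => Y y 0 0 * (X y 0 ord_max)^-1 +
      X y 0 0 * (- Y y 0 ord_max * (X y 0 ord_max * X y 0 ord_max)^-1)).
    by apply/funext => y; rewrite mxE /= expr2.
  apply: is_derive_eq (is_derive_add (is_derive_mul (dY 0) dz) (is_derive_mul (dX 0) dm)) _.
  by rewrite mxE /=; field.
- have -> : (fun y => dlift (X y) (Y y) 0 m2) =
    (fun y => Y y 0 1 * (X y 0 ord_max)^-1 +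
      X y 0 1 * (- Y y 0 ord_max * (X y 0 ord_max * X y 0 ord_max)^-1)).
    by apply/funext => y; rewrite mxE /= expr2.
  apply: is_derive_eq (is_derive_add (is_derive_mul (dY 1) dz) (is_derive_mul (dX 1) dm)) _.
  by rewrite mxE /=; field.
- have -> : (fun y => dlift (X y) (Y y) 0 m3) =
    (fun y => 2 * dotp (X y) (Y y) * (X y 0 ord_max)^-1 +
      dotp (X y) (X y) * (- Y y 0 ord_max * (X y 0 ord_max * X y 0 ord_max)^-1)).
    by apply/funext => y; rewrite mxE /= expr2 !dotpE.
  apply: is_derive_eq (is_derive_add (is_derive_mul (is_derive_mul (is_derive_const 2 x v)
    (is_derive_dotp dX dY)) dz) (is_derive_mul (is_derive_dotp dX dX) dm)) _.
  by rewrite mxE /= !dotpE; field.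
Qed.

Section Patch.
Variables (O : set 'rV[R]_2) (X : 'rV[R]_2 -> 'rV[R]_3).
Hypotheses (oO : open O) (sX : smooth_on O X) (hX : forall y, O y -> H3 (X y)).
Implicit Types (y : 'rV[R]_2) (L : 'rV[R]_4).

Lemma pd_pd_lift y i j : O y ->
  pd i (pd j (fun y => lift (X y))) y = d2lift (X y) (pd i X y) (pd j X y) (pd i (pd j X) y).
Proof.
move=> Oy; rewrite (pd_eq_on i oO Oy (fun y Oy => pd_lift j oO sX hX Oy)).
have z0 : X y 0 ord_max != 0 by rewrite gt_eqF //; exact: hX.
have sD : smooth_on O (fun y => dlift (X y) (pd j X y)).
  apply: (smooth_on_eq oO (W := pd j (fun y => lift (X y)))).
    by move=> x Ox; rewrite (pd_lift j oO sX hX Ox).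
  by apply: smooth_on_pd => //; exact: smooth_on_lift.
apply/rowP => k; rewrite (pd_coord i k oO sD Oy); apply: pd_val.
apply: is_derive_dlift => // l; first exact: is_derive_pd_coord oO sX Oy.
by apply: (is_derive_pd_coord i l oO _ Oy); exact: smooth_on_pd.
Qed.

Definition lift_det (W : 'rV[R]_2 -> 'rV[R]_4) y L := det4 (W y) (pd 0 W y) (pd 1 W y) L.

(** [shrinker_eq] for the lift W, in terms that are covariant under Lorentz
    maps: each determinant is multiplied by the determinant of the map, and the
    first fundamental form G is unchanged. *)
Definition minkowski_eq (W : 'rV[R]_2 -> 'rV[R]_4) y L : Prop :=
  let G i j := - mink (pd i W y) (pd j W y) in
  let d i j := lift_det W y (pd i (pd j W) y) in
  G 1 1 * d 0 0 - G 0 1 * d 0 1 - G 1 0 * d 1 0 + G 0 0 * d 1 1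
  = 4 * (G 0 0 * G 1 1 - G 0 1 * G 1 0) * lift_det W y L.

Lemma lift_det_hess y i j : O y -> lift_det (fun y => lift (X y)) y (pd i (pd j (fun y => lift (X y))) y) =
  2 / X y 0 ord_max ^+ 3 * (dotp (normal_field X y) (pd i (pd j X) y)
    + dotp (pd i X y) (pd j X y) * normal_field X y 0 ord_max / X y 0 ord_max).
Proof.
move=> Oy; rewrite /lift_det pd_pd_lift // !(pd_lift _ oO sX hX Oy).
apply: det4_d2lift; first by rewrite gt_eqF //; exact: hX.
  by case: (ord2P i) => ->; [left|right].
by case: (ord2P j) => ->; [left|right].
Qed.

Lemma lift_det_const y L : O y -> lift_det (fun y => lift (X y)) y L =
  (X y 0 ord_max)^-1 ^+ 3 * tangency (X y) (normal_field X y) L.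
Proof.
move=> Oy; rewrite /lift_det !(pd_lift _ oO sX hX Oy).
by apply: det4_dlift; rewrite gt_eqF //; exact: hX.
Qed.

Lemma minkowski_eqP y L : O y ->
  minkowski_eq (fun y => lift (X y)) y L <-> shrinker_eq X y L.
Proof.
move=> Oy; have z0 : X y 0 ord_max != 0 by rewrite gt_eqF //; exact: hX.
rewrite /minkowski_eq /shrinker_eq (lift_det_const L Oy) !lift_det_hess //.
rewrite !(pd_lift _ oO sX hX Oy) !mink_dlift // /hmetric /height.
have DE : dotp (normal_field X y) (normal_field X y) =
   dotp (pd 0 X y) (pd 0 X y) * dotp (pd 1 X y) (pd 1 X y) - dotp (pd 0 X y) (pd 1 X y) ^+ 2.
  by rewrite /normal_field lagrange.
rewrite DE /euclid_trace (_ : dotp (pd 1 X y) (pd 0 X y) = dotp (pd 0 X y) (pd 1 X y)); last first.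
  by rewrite !dotpE; ring.
move: (dotp (pd 0 X y) (pd 0 X y)) (dotp (pd 0 X y) (pd 1 X y)) (dotp (pd 1 X y) (pd 1 X y)).
move: (dotp _ _) (dotp _ _) (dotp _ _) (dotp _ _) (tangency _ _ _) (normal_field X y 0 ord_max) z0.
move: (X y 0 ord_max) => z c00 c01 c10 c11 t n z0 a b c.
set lhs := (X in X = _ <-> _); set rhs := (X in _ = X <-> _).
set l2 := (X in _ <-> X = _); set r2 := (X in _ <-> _ = X).
have e : (lhs - rhs) * z ^+ 7 = 2 * (l2 - r2).
  by rewrite /lhs /rhs /l2 /r2; field.
split=> h; apply/eqP; rewrite -subr_eq0.
  move: e; rewrite h subrr mul0r => /esym /eqP.
  by rewrite mulf_eq0 pnatr_eq0 /=.
have zz : z ^+ 7 != 0 by rewrite expf_neq0.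
by apply/eqP/(mulIf zz); rewrite e h subrr mul0r mulr0.
Qed.

Lemma second_form0P y i j : O y -> 0 < dotp (normal_field X y) (normal_field X y) ->
  second_form X y i j = 0 <->
  lift_det (fun y => lift (X y)) y (pd i (pd j (fun y => lift (X y))) y) = 0.
Proof.
move=> Oy D0; have z0 : X y 0 ord_max != 0 by rewrite gt_eqF //; exact: hX.
rewrite lift_det_hess // second_formE //.
have s0 : Num.sqrt (dotp (normal_field X y) (normal_field X y)) != 0 by rewrite gt_eqF // sqrtr_gt0.
split=> /eqP; rewrite mulf_eq0 => /orP[|/eqP->]; rewrite ?mulr0 //.
  by rewrite invr_eq0 mulf_eq0 (negbTE z0) (negbTE s0).
by rewrite mulf_eq0 pnatr_eq0 /= invr_eq0 expf_eq0 /= (negbTE z0).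
Qed.

End Patch.

Section LorentzTransfer.
Variables (O : set 'rV[R]_2) (U W : 'rV[R]_2 -> 'rV[R]_4) (M : 'M[R]_4).
Hypotheses (oO : open O) (sU : smooth_on O U) (uM : M \in unitmx).
Hypothesis (lM : forall u v, mink (u *m M) (v *m M) = mink u v).
Hypothesis (UW : forall y, O y -> W y = U y *m M).

Lemma pd_transfer y i : O y -> pd i W y = pd i U y *m M.
Proof.
move=> Oy; rewrite (pd_eq_on i oO Oy UW).
by have [_ ->] := pd_linear M i oO sU Oy.
Qed.

Lemma pd_pd_transfer y i j : O y -> pd i (pd j W) y = pd i (pd j U) y *m M.
Proof.
move=> Oy; rewrite (pd_eq_on i oO Oy (fun y Oy => pd_transfer j Oy)).
by have [_ ->] := pd_linear M i oO (smooth_on_pd j oO sU) Oy.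
Qed.

Lemma lift_det_transfer y L : O y -> lift_det W y (L *m M) = lift_det U y L * \det M.
Proof. by move=> Oy; rewrite /lift_det !pd_transfer // UW // det4_mulmx. Qed.

Lemma minkowski_eq_transfer y L : O y -> minkowski_eq W y (L *m M) -> minkowski_eq U y L.
Proof.
move=> Oy; rewrite /minkowski_eq !pd_pd_transfer // !lift_det_transfer // !pd_transfer // !lM.
have dM : \det M != 0 by rewrite -unitfE -unitmxE.
move: (mink _ _) (mink _ _) (mink _ _) (mink _ _) (lift_det _ _ _) (lift_det _ _ _) (lift_det _ _ _)
  (lift_det _ _ _) (lift_det _ _ _) => a b c d e f g h k E.
by apply: (mulIf dM); rewrite [RHS]mulrAC -[RHS]mulrA [\det M * _]mulrC -E; ring.
Qed.

End LorentzTransfer.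

End MinkowskiCurvature.

(** * Horo-shrinkers tangent to the position vector *)
Section SmoothProducts.
Context {R : realType} {n : nat}.
Variable O : set 'rV[R]_n.
Hypothesis oO : open O.
Implicit Types (X Y : 'rV[R]_n -> 'rV[R]_3).

Lemma smooth_dotp X Y : smooth_on O X -> smooth_on O Y -> smooth O (fun y => dotp (X y) (Y y)).
Proof.
move=> /(smooth_onP _ oO) sX /(smooth_onP _ oO) sY.
have h j := smoothM oO (sX j) (sY j).
by apply: smooth_eq (smoothD oO (smoothD oO (h 0) (h 1)) (h ord_max)) => // y _; rewrite dotpE.
Qed.

Lemma smooth_crossp X Y : smooth_on O X -> smooth_on O Y ->
  smooth_on O (fun y => crossp (X y) (Y y)).
Proof.
move=> /(smooth_onP _ oO) sX /(smooth_onP _ oO) sY; apply/smooth_onP => // k.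
have h i j := smoothM oO (sX i) (sY j).
have d i j := smoothD oO (h i j) (smoothN oO (h j i)).
have E y := crosspE (X y) (Y y).
case: (ord3P k) => ->.
- by apply: smooth_eq (d 1 ord_max) => // y _; have [-> _ _] := E y; ring.
- by apply: smooth_eq (d ord_max 0) => // y _; have [_ -> _] := E y; ring.
- by apply: smooth_eq (d 0 1) => // y _; have [_ _ ->] := E y; ring.
Qed.

End SmoothProducts.

Lemma is_derive_crossp {R : realType} {V : normedModType R} (X Y : V -> 'rV[R]_3) (x v : V)
    (X' Y' : 'rV[R]_3) :
  (forall j, is_derive x v (fun y => X y 0 j) (X' 0 j)) ->
  (forall j, is_derive x v (fun y => Y y 0 j) (Y' 0 j)) ->
  forall k, is_derive x v (fun y => crossp (X y) (Y y) 0 k)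
    ((crossp X' (Y x) + crossp (X x) Y') 0 k).
Proof.
move=> dX dY k.
have h i j := is_derive_mul (dX i) (dY j).
have d i j := is_derive_add (h i j) (is_derive_opp (h j i)).
have E y := crosspE (X y) (Y y).
rewrite mxE; have [a1 a2 a3] := crosspE X' (Y x); have [b1 b2 b3] := crosspE (X x) Y'.
case: (ord3P k) => ->.
- have -> : (fun y => crossp (X y) (Y y) 0 0) = (fun y => X y 0 1 * Y y 0 ord_max + - (X y 0 ord_max * Y y 0 1)).
    by apply/funext => y; have [-> _ _] := E y.
  by apply: is_derive_eq (d 1 ord_max) _; rewrite a1 b1; ring.
- have -> : (fun y => crossp (X y) (Y y) 0 1) = (fun y => X y 0 ord_max * Y y 0 0 + - (X y 0 0 * Y y 0 ord_max)).
    by apply/funext => y; have [_ -> _] := E y.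
  by apply: is_derive_eq (d ord_max 0) _; rewrite a2 b2; ring.
- have -> : (fun y => crossp (X y) (Y y) 0 ord_max) = (fun y => X y 0 0 * Y y 0 1 + - (X y 0 1 * Y y 0 0)).
    by apply/funext => y; have [_ _ ->] := E y.
  by apply: is_derive_eq (d 0 1) _; rewrite a3 b3; ring.
Qed.

Section DotBilinear.
Context {R : realType}.

Lemma dotpC (a b : 'rV[R]_3) : dotp a b = dotp b a. Proof. by rewrite !dotpE; ring. Qed.
Lemma dotpDl (a b c : 'rV[R]_3) : dotp (a + b) c = dotp a c + dotp b c.
Proof. by rewrite !dotpE !mxE; ring. Qed.
Lemma dotpZl (k : R) (a c : 'rV[R]_3) : dotp (k *: a) c = k * dotp a c.
Proof. by rewrite !dotpE !mxE; ring. Qed.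
Lemma dotpDr (a b c : 'rV[R]_3) : dotp c (a + b) = dotp c a + dotp c b.
Proof. by rewrite !dotpE !mxE; ring. Qed.
Lemma dotpZr (k : R) (a c : 'rV[R]_3) : dotp c (k *: a) = k * dotp c a.
Proof. by rewrite !dotpE !mxE; ring. Qed.

Lemma dotpNl (a c : 'rV[R]_3) : dotp (- a) c = - dotp a c.
Proof. by rewrite !dotpE !mxE; ring. Qed.
Lemma dotpNr (a c : 'rV[R]_3) : dotp c (- a) = - dotp c a.
Proof. by rewrite !dotpE !mxE; ring. Qed.

Lemma gram_var00 (p q : 'rV[R]_3) (a b : R) :
  dotp (p - (a *: p + b *: q)) p + dotp p (p - (a *: p + b *: q)) =
  2 * dotp p p - 2 * a * dotp p p - 2 * b * dotp p q.
Proof. by rewrite !(dotpNl, dotpNr, dotpDl, dotpDr, dotpZl, dotpZr) (dotpC q p); ring. Qed.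

Lemma gram_var11 (p q : 'rV[R]_3) (a b : R) :
  dotp (q - (a *: p + b *: q)) q + dotp q (q - (a *: p + b *: q)) =
  2 * dotp q q - 2 * a * dotp p q - 2 * b * dotp q q.
Proof. by rewrite !(dotpNl, dotpNr, dotpDl, dotpDr, dotpZl, dotpZr) (dotpC q p); ring. Qed.

Lemma gram_var01 (p q : 'rV[R]_3) (a b c d : R) :
  dotp (p - (a *: p + b *: q)) q + dotp p (q - (c *: p + d *: q)) =
  2 * dotp p q - a * dotp p q - b * dotp q q - c * dotp p p - d * dotp p q.
Proof. by rewrite !(dotpNl, dotpNr, dotpDl, dotpDr, dotpZl, dotpZr); ring. Qed.

Lemma hess_var (n p q h k0 k1 j0 j1 : 'rV[R]_3) (t e f a b c d : R) :
  dotp n p = 0 -> dotp n q = 0 ->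
  dotp ((2 - t) *: n) h +
  dotp n (h - (e *: p + f *: q) - (a *: k0 + b *: k1) - (c *: j0 + d *: j1)) =
  (3 - t) * dotp n h - (a * dotp n k0 + b * dotp n k1) - (c * dotp n j0 + d * dotp n j1).
Proof.
by move=> np nq; rewrite !(dotpNl, dotpNr, dotpDl, dotpDr, dotpZl, dotpZr) np nq; ring.
Qed.

End DotBilinear.

Section Euler.
Context {R : realType}.
Variables (O : set 'rV[R]_2) (V0 V1 : 'rV[R]_2 -> R).
Hypotheses (oO : open O) (sV0 : smooth O V0) (sV1 : smooth O V1).
Implicit Types (phi : 'rV[R]_2 -> R) (y : 'rV[R]_2).

Definition field_at y : 'rV[R]_2 := \row_i (if i == 0 then V0 y else V1 y).

Lemma is_derive_field phi y : smooth O phi -> O y ->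
  is_derive y (field_at y) phi (V0 y * pd 0 phi y + V1 y * pd 1 phi y).
Proof.
move=> s Oy; have := is_derive_smooth (field_at y) oO s Oy.
by rewrite sum_ord2 !mxE.
Qed.

Variable phi : 'rV[R]_2 -> R.
Hypothesis sphi : smooth O phi.
Hypothesis euler : forall y, O y -> phi y = V0 y * pd 0 phi y + V1 y * pd 1 phi y.

Lemma euler0 y : O y -> is_derive y (field_at y) phi (phi y).
Proof.
move=> Oy; apply: is_derive_eq (is_derive_field sphi Oy) _.
by rewrite -euler.
Qed.

Let euler_pd j y : O y -> pd j phi y =
  pd j V0 y * pd 0 phi y + V0 y * pd j (pd 0 phi) y + (pd j V1 y * pd 1 phi y + V1 y * pd j (pd 1 phi) y).
Proof.
move=> Oy; rewrite {1}(pd_eq_on j oO Oy euler).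
by apply: pd_val; apply: is_derive_add; apply: is_derive_mul; apply: is_derive_pd Oy => //; exact: smooth_pd.
Qed.

(** Derivatives along V = (V0, V1) of the partial derivatives of a function phi
    with V phi = phi. The intended phi are the coordinates of a parametrization
    whose position vector is the image of V. *)
Lemma euler1 j y : O y -> is_derive y (field_at y) (pd j phi)
  (pd j phi y - (pd j V0 y * pd 0 phi y + pd j V1 y * pd 1 phi y)).
Proof.
move=> Oy; apply: is_derive_eq (is_derive_field (smooth_pd j sphi) Oy) _.
rewrite (pd_comm 0 j oO sphi Oy) (pd_comm 1 j oO sphi Oy) (euler_pd j Oy).
by move: (pd j V0 y) (pd j V1 y) (pd j (pd 0 phi) y) (pd j (pd 1 phi) y) => a b c d; ring.
Qed.

Lemma euler2 k j y : O y -> is_derive y (field_at y) (pd k (pd j phi))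
  (pd k (pd j phi) y
   - (pd k (pd j V0) y * pd 0 phi y + pd k (pd j V1) y * pd 1 phi y)
   - (pd j V0 y * pd k (pd 0 phi) y + pd j V1 y * pd k (pd 1 phi) y)
   - (pd k V0 y * pd j (pd 0 phi) y + pd k V1 y * pd j (pd 1 phi) y)).
Proof.
move=> Oy; apply: is_derive_eq (is_derive_field (smooth_pd k (smooth_pd j sphi)) Oy) _.
have c i : pd i (pd k (pd j phi)) y = pd k (pd j (pd i phi)) y.
  rewrite (pd_comm i k oO (smooth_pd j sphi) Oy).
  by apply: (pd_eq_on k oO Oy) => x Ox; exact: pd_comm oO sphi Ox.
rewrite !c.
have E : pd k (pd j phi) y =
  (pd k (pd j V0) y * pd 0 phi y + pd j V0 y * pd k (pd 0 phi) y)
  + (pd k V0 y * pd j (pd 0 phi) y + V0 y * pd k (pd j (pd 0 phi)) y)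
  + ((pd k (pd j V1) y * pd 1 phi y + pd j V1 y * pd k (pd 1 phi) y)
  + (pd k V1 y * pd j (pd 1 phi) y + V1 y * pd k (pd j (pd 1 phi)) y)).
  rewrite (pd_eq_on k oO Oy (fun x Ox => euler_pd j Ox)); apply: pd_val.
  have s f i : smooth O f -> smooth O (pd i f) by move=> ?; exact: smooth_pd.
  have dm f g := is_derive_mul (f := f) (g := g) (v := basis_vec k) (x := y).
  have p f : smooth O f -> is_derive y (basis_vec k) f (pd k f y) by move=> sf; exact: is_derive_pd.
  exact: (is_derive_add
    (is_derive_add (dm _ _ _ _ (p _ (s _ j sV0)) (p _ (s _ 0 sphi)))
                   (dm _ _ _ _ (p _ sV0) (p _ (s _ j (s _ 0 sphi)))))
    (is_derive_add (dm _ _ _ _ (p _ (s _ j sV1)) (p _ (s _ 1 sphi)))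
                   (dm _ _ _ _ (p _ sV1) (p _ (s _ j (s _ 1 sphi)))))).
rewrite E.
move: (pd k (pd j V0) y) (pd k (pd j V1) y) (pd j V0 y) (pd j V1 y) (pd k V0 y) (pd k V1 y).
move: (pd k (pd j (pd 0 phi)) y) (pd k (pd j (pd 1 phi)) y) (pd j (pd 0 phi) y) (pd j (pd 1 phi) y) (pd k (pd 0 phi) y) (pd k (pd 1 phi) y).
by move=> *; ring.
Qed.

End Euler.

Section Cone.
Context {R : realType}.
Variables (O : set 'rV[R]_2) (X : 'rV[R]_2 -> 'rV[R]_3).
Hypotheses (oO : open O) (sX : smooth_on O X) (hX : forall y, O y -> H3 (X y)).
Local Notation nu := (normal_field X).
Hypothesis imm : forall y, O y -> 0 < dotp (nu y) (nu y).
Hypothesis cone : forall y, O y -> dotp (nu y) (X y) = 0.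
Implicit Types (y : 'rV[R]_2) (L : 'rV[R]_4).

Local Notation E y := (dotp (pd 0 X y) (pd 0 X y)).
Local Notation F y := (dotp (pd 0 X y) (pd 1 X y)).
Local Notation G y := (dotp (pd 1 X y) (pd 1 X y)).

(** Coordinates, in the basis of the partial derivatives, of the position vector
    of a surface tangent to it. *)
Definition radial0 y := (dotp (X y) (pd 0 X y) * G y + - (dotp (X y) (pd 1 X y) * F y))
  * (dotp (nu y) (nu y))^-1.
Definition radial1 y := (dotp (X y) (pd 1 X y) * E y + - (dotp (X y) (pd 0 X y) * F y))
  * (dotp (nu y) (nu y))^-1.

Let sP i : smooth_on O (pd i X). Proof. exact: smooth_on_pd. Qed.
Let sN : smooth_on O nu. Proof. exact: smooth_crossp. Qed.

Let sV : smooth O (fun y => (dotp (nu y) (nu y))^-1).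
Proof.
apply: smoothV => //; last exact: smooth_dotp.
by move=> y /imm h; rewrite gt_eqF.
Qed.

Let s0 : smooth O radial0.
Proof. by apply: smoothM => //; apply: smoothD => //; [|apply: smoothN => //]; apply: smoothM => //; exact: smooth_dotp. Qed.

Let s1 : smooth O radial1.
Proof. by apply: smoothM => //; apply: smoothD => //; [|apply: smoothN => //]; apply: smoothM => //; exact: smooth_dotp. Qed.

Let radialE y l : O y -> X y 0 l = radial0 y * pd 0 X y 0 l + radial1 y * pd 1 X y 0 l.
Proof.
move=> Oy; have D0 := lt0r_neq0 (imm Oy).
have key (p a b : 'rV[R]_3) : dotp (crossp a b) p = 0 -> dotp (crossp a b) (crossp a b) * p 0 l =
  (dotp p a * dotp b b - dotp p b * dotp a b) * a 0 l + (dotp p b * dotp a a - dotp p a * dotp a b) * b 0 l.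
  move=> c0; transitivity ((dotp p a * dotp b b - dotp p b * dotp a b) * a 0 l + (dotp p b * dotp a a - dotp p a * dotp a b) * b 0 l + dotp (crossp a b) p * crossp a b 0 l); last by rewrite c0 mul0r addr0.
  have [n0 n1 n2] := crosspE a b; rewrite lagrange !dotpE.
  by case: (ord3P l) => ->; rewrite n0 n1 n2; ring.
apply: (mulfI D0); rewrite (key _ _ _ (cone Oy)) /radial0 /radial1.
by move: D0; rewrite -/(nu y); move: (dotp (nu y) (nu y)) => D D0; field.
Qed.

Let eulerX l y : O y -> X y 0 l =
  radial0 y * pd 0 (fun y => X y 0 l) y + radial1 y * pd 1 (fun y => X y 0 l) y.
Proof. by move=> Oy; rewrite {1}(radialE l Oy) !(pd_coord _ l oO sX Oy). Qed.

Let sXl l : smooth O (fun y => X y 0 l). Proof. exact: (smooth_onP _ oO).1. Qed.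

Local Notation v y := (field_at radial0 radial1 y).
Local Notation A j y := (pd j radial0 y).
Local Notation B j y := (pd j radial1 y).

Let d0 y l : O y -> is_derive y (v y) (fun y => X y 0 l) (X y 0 l).
Proof. by move=> Oy; exact: (euler0 oO (sXl l) (eulerX l) Oy). Qed.

Let d1 j y l : O y -> is_derive y (v y) (fun y => pd j X y 0 l)
  ((pd j X y - (A j y *: pd 0 X y + B j y *: pd 1 X y)) 0 l).
Proof.
move=> Oy; rewrite !mxE !(pd_coord _ l oO sX Oy).
apply: near_eq_is_derive (euler1 oO s0 s1 (sXl l) (eulerX l) j Oy).
have nO : \forall y \near y, O y by apply: open_nbhs_nbhs.
by near=> x; rewrite (pd_coord j l oO sX) //; near: x.
Unshelve. all: by end_near. Qed.

Let dvec (Y : 'rV[R]_2 -> 'rV[R]_3) y (Y' : 'rV[R]_3) :=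
  forall l, is_derive y (v y) (fun y => Y y 0 l) (Y' 0 l).

Let tau y := A 0 y + B 1 y.

(* A and B are the derivatives of the field, tau is its divergence: up to the
   change of the basis, nu is homogeneous of degree 2. *)
Let dN y : O y -> dvec nu y ((2 - tau y) *: nu y).
Proof.
move=> Oy l; apply: is_derive_eq (is_derive_crossp (fun l => d1 0 l Oy) (fun l => d1 1 l Oy) l) _.
rewrite /tau !mxE /normal_field; have [n0 n1 n2] := crosspE (pd 0 X y) (pd 1 X y).
move: n0 n1 n2; move: (A 0 y) (B 0 y) (A 1 y) (B 1 y) (pd 0 X y) (pd 1 X y) => a0 b0 a1 b1 a b n0 n1 n2.
have k0 : (0 + 1 : 'I_3) = 1 by exact: val_inj.
have k1 : (1 + 1 : 'I_3) = ord_max by exact: val_inj.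
have k2 : (ord_max + 1 : 'I_3) = 0 by exact: val_inj.
by case: (ord3P l) => ->; rewrite ?(k0, k1, k2) ?(k0, k1, k2); ring.
Qed.

Let d2 k j y l : O y -> is_derive y (v y) (fun y => pd k (pd j X) y 0 l)
  ((pd k (pd j X) y - (pd k (pd j radial0) y *: pd 0 X y + pd k (pd j radial1) y *: pd 1 X y)
    - (A j y *: pd k (pd 0 X) y + B j y *: pd k (pd 1 X) y)
    - (A k y *: pd j (pd 0 X) y + B k y *: pd j (pd 1 X) y)) 0 l).
Proof.
move=> Oy; rewrite !mxE !(pd_coord2 _ _ l oO sX Oy) !(pd_coord _ l oO sX Oy).
apply: near_eq_is_derive (euler2 oO s0 s1 (sXl l) (eulerX l) k j Oy).
have nO : \forall y \near y, O y by apply: open_nbhs_nbhs.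
by near=> x; rewrite (pd_coord2 k j l oO sX) //; near: x.
Unshelve. all: by end_near. Qed.

Let ddot (Y Z : 'rV[R]_2 -> 'rV[R]_3) y Y' Z' : dvec Y y Y' -> dvec Z y Z' ->
  is_derive y (v y) (fun y => dotp (Y y) (Z y)) (dotp Y' (Z y) + dotp (Y y) Z').
Proof. by move=> dY dZ; exact: is_derive_dotp. Qed.

Let d1v j y : O y -> dvec (pd j X) y (pd j X y - (A j y *: pd 0 X y + B j y *: pd 1 X y)).
Proof. by move=> Oy l; exact: d1. Qed.


Let dE y : O y -> is_derive y (v y) (fun y => E y) (2 * E y - 2 * A 0 y * E y - 2 * B 0 y * F y).
Proof.
move=> Oy; apply: is_derive_eq (ddot (d1v 0 Oy) (d1v 0 Oy)) _; exact: gram_var00.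
Qed.

Let dF y : O y -> is_derive y (v y) (fun y => F y)
  (2 * F y - A 0 y * F y - B 0 y * G y - A 1 y * E y - B 1 y * F y).
Proof.
move=> Oy; apply: is_derive_eq (ddot (d1v 0 Oy) (d1v 1 Oy)) _; exact: gram_var01.
Qed.

Let dG y : O y -> is_derive y (v y) (fun y => G y) (2 * G y - 2 * A 1 y * F y - 2 * B 1 y * G y).
Proof.
move=> Oy; apply: is_derive_eq (ddot (d1v 1 Oy) (d1v 1 Oy)) _; exact: gram_var11.
Qed.

Local Notation II k j y := (dotp (nu y) (pd k (pd j X) y)).

Let nu0 y : dotp (nu y) (pd 0 X y) = 0. Proof. by case: (crossp_dotl (pd 0 X y) (pd 1 X y)). Qed.
Let nu1 y : dotp (nu y) (pd 1 X y) = 0. Proof. by case: (crossp_dotl (pd 0 X y) (pd 1 X y)). Qed.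

Let dII k j y : O y -> is_derive y (v y) (fun y => II k j y)
  ((3 - tau y) * II k j y - (A j y * II k 0 y + B j y * II k 1 y) - (A k y * II j 0 y + B k y * II j 1 y)).
Proof.
move=> Oy; apply: is_derive_eq (ddot (dN Oy) (fun l => d2 k j l Oy)) _.
exact: (hess_var _ _ _ _ _ _ _ _ _ _ _ _ (nu0 y) (nu1 y)).
Qed.

Let dn2 y : O y -> is_derive y (v y) (fun y => dotp (nu y) (nu y)) ((4 - 2 * tau y) * dotp (nu y) (nu y)).
Proof. by move=> Oy; apply: is_derive_eq (ddot (dN Oy) (dN Oy)) _; rewrite !(dotpNl, dotpNr, dotpDl, dotpDr, dotpZl, dotpZr); ring. Qed.

Let dtang L y : O y -> is_derive y (v y) (fun y => tangency (X y) (nu y) L)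
  ((3 - tau y) * tangency (X y) (nu y) L + nu y 0 ord_max * (L 0 m0 * dotp (X y) (X y) - L 0 m3)).
Proof.
move=> Oy.
have n j := dN Oy j.
have x j := d0 j Oy.
have c (t : R) := is_derive_const t y (v y).
have D0 := is_derive_mul (n 0) (is_derive_mul (is_derive_mul (c 2) (x ord_max))
   (is_derive_add (c (L 0 m1)) (is_derive_opp (is_derive_mul (c (L 0 m0)) (x 0))))).
have D1 := is_derive_mul (n 1) (is_derive_mul (is_derive_mul (c 2) (x ord_max))
   (is_derive_add (c (L 0 m2)) (is_derive_opp (is_derive_mul (c (L 0 m0)) (x 1))))).
have Dm := is_derive_mul (n ord_max) (is_derive_add (is_derive_add (is_derive_add (c (L 0 m3))
   (is_derive_opp (is_derive_mul (is_derive_mul (c 2) (x 0)) (c (L 0 m1)))))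
   (is_derive_opp (is_derive_mul (is_derive_mul (c 2) (x 1)) (c (L 0 m2)))))
   (is_derive_mul (c (L 0 m0)) (is_derive_add (is_derive_add (is_derive_mul (x 0) (x 0)) (is_derive_mul (x 1) (x 1)))
     (is_derive_opp (is_derive_mul (x ord_max) (x ord_max)))))).
apply: is_derive_eq (is_derive_add (is_derive_add D0 D1) Dm) _.
have h : nu y 0 0 * X y 0 0 + nu y 0 1 * X y 0 1 + nu y 0 ord_max * X y 0 ord_max = 0.
  by rewrite -dotpE cone.
rewrite dotpE /tangency ![((2 - tau y) *: nu y) _ _]mxE.
move: h; move: (nu y 0 0) (nu y 0 1) (nu y 0 ord_max) (X y 0 0) (X y 0 1) (X y 0 ord_max) (tau y).
move: (L 0 m0) (L 0 m1) (L 0 m2) (L 0 m3) => l0 l1 l2 l3 n0 n1 n2 x0 x1 x2 t h.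
apply/eqP; rewrite -subr_eq0; apply/eqP.
transitivity (- 2 * x2 * l0 * (n0 * x0 + n1 * x1 + n2 * x2)); last by rewrite h mulr0.
by ring.
Qed.

(* Both sides of the equation have weight 7 - 3 tau along the position vector,
   apart from the last term of dtang; subtracting the equation multiplied by
   this weight isolates that term. *)
Let shrinker_radial L y : (forall y, O y -> shrinker_eq X y L) -> O y ->
  nu y 0 ord_max * (L 0 m0 * dotp (X y) (X y) - L 0 m3) = 0.
Proof.
move=> eqL Oy.
have s01 : II 1 0 y = II 0 1 y by rewrite (pd_comm_vec 1 0 oO sX Oy).
have dm f g df dg := @is_derive_mul R _ f g y (v y) df dg.
have dT := is_derive_add (is_derive_add (is_derive_add
   (dm _ _ _ _ (dG Oy) (dII 0 0 Oy))
   (is_derive_opp (dm _ _ _ _ (dF Oy) (dII 0 1 Oy))))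
   (is_derive_opp (dm _ _ _ _ (dF Oy) (dII 1 0 Oy))))
   (dm _ _ _ _ (dE Oy) (dII 1 1 Oy)).
have z := d0 ord_max Oy.
have c2 := is_derive_const (2 : R) y (v y).
have dL := is_derive_add (dm _ _ _ _ (dm _ _ _ _ z z) dT)
  (dm _ _ _ _ (dm _ _ _ _ (dm _ _ _ _ c2 (dn2 Oy)) z) (dN Oy ord_max)).
have dR := dm _ _ _ _ (dm _ _ _ _ c2 (dn2 Oy)) (dtang L Oy).
have eq0 x : O x -> X x 0 ord_max * X x 0 ord_max * (G x * II 0 0 x + - (F x * II 0 1 x) + - (F x * II 1 0 x) + E x * II 1 1 x)
   + 2 * dotp (nu x) (nu x) * X x 0 ord_max * nu x 0 ord_max = 2 * dotp (nu x) (nu x) * tangency (X x) (nu x) L.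
  by move=> Ox; have := eqL x Ox; rewrite /shrinker_eq /euclid_trace expr2.
have := is_derive_eq_on oO Oy eq0 dL dR.
have := eq0 y Oy; have := imm Oy.
rewrite s01 [((2 - tau y) *: nu y) _ _]mxE /tau.
move: (A 0 y) (A 1 y) (B 0 y) (B 1 y) (E y) (F y) (G y) (II 0 0 y) (II 0 1 y) (II 1 1 y).
move: (X y 0 ord_max) (nu y 0 ord_max) (tangency _ _ _) (dotp (nu y) (nu y)) (L 0 m0 * dotp (X y) (X y) - L 0 m3).
move=> z' n t D k a0 a1 b0 b1 e f g p q r D0 e0 e1.
have D2 : 2 * D != 0 by rewrite mulf_neq0 // gt_eqF.
apply: (mulfI D2); rewrite mulr0.
have e2 : 2 * D * (n * k) = - ((7 - 3 * (a0 + b1)) * (2 * D * t - (z' * z' * (g * p + - (f * q) + - (f * q) + e * r) + 2 * D * z' * n))).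
  move/eqP: e1; rewrite -subr_eq0 => /eqP e1; apply/eqP; rewrite -subr_eq0; apply/eqP; rewrite -[RHS]oppr0 -e1; ring.
by rewrite e2 e0 subrr mulr0 oppr0.
Qed.

(** Where nu_3 does not vanish, L_0 |X|^2 = L_3 on an open set. The derivative of
    the left side along the position vector is twice the left side, so
    L_0 = L_3 = 0, and a null vector of this kind is zero. *)
Lemma cone_vertical L : (forall y, O y -> shrinker_eq X y L) -> mink L L = 0 -> L != 0 ->
  forall y, O y -> nu y 0 ord_max = 0.
Proof.
move=> eqL L0 Ln0 y Oy; apply/eqP; apply: contraT => n0.
have sn : smooth O (fun y => nu y 0 ord_max) by apply: (smooth_onP _ oO).1.
have cn := smooth_cont sn Oy.
have near0 : \forall x \near y, L 0 m0 * dotp (X x) (X x) + - L 0 m3 = 0.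
  have nO : \forall x \near y, O x by apply: open_nbhs_nbhs.
  have nn : \forall x \near y, nu x 0 ord_max != 0.
    have := open_nbhs_nbhs (conj (@open_neq R 0) n0); exact: cn.
  near=> x; have Ox : O x by near: x.
  have nx : nu x 0 ord_max != 0 by near: x.
  have /eqP := shrinker_radial eqL Ox; rewrite mulf_eq0 (negbTE nx) /= => /eqP; exact.
have dd : is_derive y (v y) (fun x => L 0 m0 * dotp (X x) (X x) + - L 0 m3)
   (L 0 m0 * (2 * dotp (X y) (X y))).
  have c (t : R) := is_derive_const t y (v y).
  have d := ddot (fun l => d0 l Oy) (fun l => d0 l Oy).
  apply: is_derive_eq (is_derive_add (is_derive_mul (c (L 0 m0)) d) (is_derive_opp (c (L 0 m3)))) _.
  by ring.
have zero : L 0 m0 * (2 * dotp (X y) (X y)) = 0.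
  have c := is_derive_const (0 : R) y (v y).
  have dd' := near_eq_is_derive near0 dd.
  exact: is_derive_unique dd' c.
have p0 : 0 < dotp (X y) (X y).
  rewrite dotpE -!expr2 ltr_wpDl ?addr_ge0 ?sqr_ge0 // exprn_gt0 //; exact: hX.
have l0 : L 0 m0 = 0.
  by move/eqP: zero; rewrite !mulf_eq0 pnatr_eq0 /= (gt_eqF p0) orbF => /eqP.
have l3 : L 0 m3 = 0.
  by have /eqP := nbhs_singleton near0; rewrite l0 mul0r add0r oppr_eq0 => /eqP.
move/eqP: Ln0; case; apply/rowP.
move: L0; rewrite /mink l0 l3 => /eqP; rewrite !mul0r addr0 mul0r sub0r -opprD oppr_eq0 -!expr2.
rewrite paddr_eq0 ?sqr_ge0 // !sqrf_eq0 => /andP[/eqP l1 /eqP l2].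
by apply: ord4P; rewrite mxE.
Unshelve. all: by end_near. Qed.

(** The normal and its derivatives are horizontal and orthogonal to the position
    vector. Off the vertical axis this makes each derivative of nu parallel to nu,
    hence orthogonal to the surface. On the axis the derivative of the relation
    dotp (pd i nu) X = 0 is dotp (pd i nu) (pd j X) = 0. *)
Lemma cone_flat : (forall y, O y -> nu y 0 ord_max = 0) ->
  forall y i j, O y -> II i j y = 0.
Proof.
move=> nz y i j Oy.
have dn y' k : O y' -> forall l, is_derive y' (basis_vec k) (fun y => nu y 0 l) (pd k nu y' 0 l).
  by move=> Oy' l; exact: (is_derive_pd_coord k l oO sN Oy').
have dx y' k : O y' -> forall l, is_derive y' (basis_vec k) (fun y => X y 0 l) (pd k X y' 0 l).
  by move=> Oy' l; exact: (is_derive_pd_coord k l oO sX Oy').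
have nk y' k : O y' -> dotp (nu y') (pd k X y') = 0.
  by move=> _; case: (ord2P k) => ->.
have h1 y' k : O y' -> dotp (pd k nu y') (X y') = 0.
  move=> Oy'; have c := is_derive_const (0 : R) y' (basis_vec k).
  have := is_derive_eq_on oO Oy' cone (is_derive_dotp (dn y' k Oy') (dx y' k Oy')) c.
  by rewrite nk // addr0.
have h2 y' k : O y' -> pd k nu y' 0 ord_max = 0.
  move=> Oy'; have c := is_derive_const (0 : R) y' (basis_vec k).
  exact: is_derive_eq_on oO Oy' nz (dn y' k Oy' ord_max) c.
have h3 : II i j y = - dotp (pd i nu y) (pd j X y).
  have c := is_derive_const (0 : R) y (basis_vec i).
  have dxj l : is_derive y (basis_vec i) (fun y => pd j X y 0 l) (pd i (pd j X) y 0 l).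
    by apply: (is_derive_pd_coord i l oO _ Oy).
  have := is_derive_eq_on oO Oy (fun y' Oy' => nk y' j Oy') (is_derive_dotp (dn y i Oy) dxj) c.
  by move=> /eqP; rewrite addrC addr_eq0 => /eqP.
rewrite h3; suff -> : dotp (pd i nu y) (pd j X y) = 0 by rewrite oppr0.
have hc := cone Oy; have hi := h1 y i Oy; have hz := nz y Oy; have hiz := h2 y i Oy.
(* ax: the point is on the vertical axis. *)
have [ax|offax] := eqVneq ((X y 0 0, X y 0 1)) (0, 0).
- case: ax => x0 x1.
  have dni l : is_derive y (basis_vec j) (fun y => pd i nu y 0 l) (pd j (pd i nu) y 0 l).
    by apply: (is_derive_pd_coord j l oO _ Oy); exact: smooth_on_pd.
  have c := is_derive_const (0 : R) y (basis_vec j).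
  have := is_derive_eq_on oO Oy (fun y' Oy' => h1 y' i Oy') (is_derive_dotp dni (dx y j Oy)) c.
  have -> : dotp (pd j (pd i nu) y) (X y) = 0.
    rewrite dotpE x0 x1 !mulr0 !add0r.
    have -> : pd j (pd i nu) y 0 ord_max = 0.
      exact: is_derive_eq_on oO Oy (fun y' Oy' => h2 y' i Oy') (dni ord_max) c.
    by rewrite mul0r.
  by rewrite add0r.
- have D0 := lt0r_neq0 (imm Oy); have hj := nk y j Oy.
  apply: (mulfI D0); rewrite mulr0.
  move: hc hi hz hiz hj D0; rewrite !dotpE.
  move: (nu y) (pd i nu y) (X y) (pd j X y) offax => n m x w offax hc hi hz hiz hj _.
  rewrite hz hiz !mul0r !addr0 in hc hi hj *.
  have key : m 0 0 * n 0 1 = m 0 1 * n 0 0.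
    have k0 : x 0 0 * (m 0 0 * n 0 1 - m 0 1 * n 0 0) = 0.
      transitivity ((m 0 0 * x 0 0 + m 0 1 * x 0 1) * n 0 1 - (n 0 0 * x 0 0 + n 0 1 * x 0 1) * m 0 1); first by ring.
      by rewrite hc hi !mul0r subrr.
    have k1 : x 0 1 * (m 0 0 * n 0 1 - m 0 1 * n 0 0) = 0.
      transitivity ((n 0 0 * x 0 0 + n 0 1 * x 0 1) * m 0 0 - (m 0 0 * x 0 0 + m 0 1 * x 0 1) * n 0 0); first by ring.
      by rewrite hc hi !mul0r subrr.
    apply/eqP; rewrite -subr_eq0; apply: contraT => kn.
    move/eqP: k0; rewrite mulf_eq0 (negbTE kn) orbF => /eqP k0.
    move/eqP: k1; rewrite mulf_eq0 (negbTE kn) orbF => /eqP k1.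
    by move: offax; rewrite k0 k1 eqxx.
  transitivity ((m 0 0 * n 0 0 + m 0 1 * n 0 1) * (n 0 0 * w 0 0 + n 0 1 * w 0 1)
     + (m 0 0 * n 0 1 - m 0 1 * n 0 0) * (n 0 1 * w 0 0 - n 0 0 * w 0 1)); first by ring.
  by rewrite hj key subrr mulr0 mul0r addr0.
Qed.

End Cone.

(** * Totally geodesic surfaces lie in quadrics *)
Section Quadrics.
Context {R : realType}.
Implicit Types (p n w : 'rV[R]_3) (m L : 'rV[R]_4).

(** The covector of R^4 that vanishes on the lift of p and on the derivatives of
    lifts in the directions orthogonal to n; [quad] evaluates a covector on a
    lift, up to the factor 1 / z. *)
Definition conormal p n : 'rV[R]_4 := \row_k nth 0
  [:: n 0 ord_max * (p 0 0 * p 0 0 + p 0 1 * p 0 1 - p 0 ord_max * p 0 ord_max)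
       - 2 * p 0 ord_max * (p 0 0 * n 0 0 + p 0 1 * n 0 1);
      2 * (p 0 ord_max * n 0 0 - p 0 0 * n 0 ord_max);
      2 * (p 0 ord_max * n 0 1 - p 0 1 * n 0 ord_max);
      n 0 ord_max] k.

Definition quad m p : R := m 0 m0 + m 0 m1 * p 0 0 + m 0 m2 * p 0 1 + m 0 m3 * dotp p p.

Definition dquad m p w : R := m 0 m1 * w 0 0 + m 0 m2 * w 0 1 + 2 * m 0 m3 * dotp p w.

Lemma conormalE p n : [/\ conormal p n 0 m0 =
      n 0 ord_max * (p 0 0 * p 0 0 + p 0 1 * p 0 1 + - (p 0 ord_max * p 0 ord_max))
       + - (2 * p 0 ord_max * (p 0 0 * n 0 0 + p 0 1 * n 0 1)),
  conormal p n 0 m1 = 2 * (p 0 ord_max * n 0 0 + - (p 0 0 * n 0 ord_max)),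
  conormal p n 0 m2 = 2 * (p 0 ord_max * n 0 1 + - (p 0 1 * n 0 ord_max))
  & conormal p n 0 m3 = n 0 ord_max].
Proof. by split; rewrite mxE. Qed.

Lemma quad_conormal p n : quad (conormal p n) p = 0.
Proof. by rewrite /quad dotpE !mxE /=; ring. Qed.

Lemma quadZ k m p : quad (k *: m) p = k * quad m p.
Proof. by rewrite /quad !mxE; ring. Qed.

Lemma conormal_neq0 p n : p 0 ord_max != 0 -> 0 < dotp n n -> conormal p n != 0.
Proof.
move=> z0 n0; apply/eqP => /rowP c0.
have c3 : n 0 ord_max = 0 by have := c0 m3; rewrite !mxE.
have h k : 2 * (p 0 ord_max * k) = 0 -> k = 0.
  by move=> /eqP; rewrite !mulf_eq0 pnatr_eq0 (negbTE z0) /= => /eqP.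
have c1 : n 0 0 = 0 by have := c0 m1; rewrite !mxE /= c3 mulr0 subr0; exact: h.
have c2 : n 0 1 = 0 by have := c0 m2; rewrite !mxE /= c3 mulr0 subr0; exact: h.
by move: n0; rewrite dotpE c1 c2 c3 !mul0r !addr0 ltxx.
Qed.

Lemma perp_parallel (a b w : 'rV[R]_3) : dotp w a = 0 -> dotp w b = 0 ->
  dotp (crossp a b) (crossp a b) *: w = dotp w (crossp a b) *: crossp a b.
Proof.
move=> wa wb; apply/rowP => l; rewrite !mxE.
have n := crosspE a b.
transitivity ((dotp w a * dotp b b - dotp w b * dotp a b) * a 0 l
   + (dotp w b * dotp a a - dotp w a * dotp a b) * b 0 l + dotp w (crossp a b) * crossp a b 0 l); last first.
  by rewrite wa wb !mul0r subrr !mul0r !add0r mxE.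
have [n0 n1 n2] := n; rewrite lagrange !dotpE n0 n1 n2.
by case: (ord3P l) => ->; rewrite ?n0 ?n1 ?n2; ring.
Qed.

(** The Euclidean gradient of [quad] m at p is orthogonal to a and b, hence a
    multiple of their cross product; it determines all entries of m but m_0, and
    m_0 follows from the vanishing of [quad] m at p. *)
Lemma quad_tangent m p (a b : 'rV[R]_3) : p 0 ord_max != 0 ->
  0 < dotp (crossp a b) (crossp a b) ->
  quad m p = 0 -> dquad m p a = 0 -> dquad m p b = 0 ->
  exists k, m = k *: conormal p (crossp a b).
Proof.
move=> z0 D0 q0 qa qb; have Dn := lt0r_neq0 D0.
pose g : 'rV[R]_3 := \row_k nth 0 [:: m 0 m1 + 2 * m 0 m3 * p 0 0; m 0 m2 + 2 * m 0 m3 * p 0 1; 2 * m 0 m3 * p 0 ord_max] k.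
have ga w : dotp g w = dquad m p w by rewrite /dquad !dotpE !mxE /=; ring.
have /perp_parallel : dotp g a = 0 by rewrite ga.
move=> /(_ b); rewrite ga => /(_ qb); set N := crossp a b.
set D := dotp N N; set ka := dotp g N => E.
have El l : g 0 l = ka / D * N 0 l.
  apply: (mulfI Dn); rewrite -/D; have /rowP/(_ l) := E.
  have sc (a' : R) (v : 'rV[R]_3) : (a' *: v) 0 l = a' * v 0 l by rewrite mxE.
  rewrite !sc => ->.
  by rewrite mulrA mulrCA mulfV // mulr1.
have := El 0; have := El 1; have := El ord_max; rewrite ![g 0 _]mxE /= /ka /D {El}; clear E; clear ka; clear D.
clearbody N; move: (dotp g N / dotp N N) => k {D0 Dn g ga}.
move=> e3 e2 e1.
have h3 : m 0 m3 = k / (2 * p 0 ord_max) * N 0 ord_max.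
  apply: (mulfI (x := 2 * p 0 ord_max)); first by rewrite mulf_neq0 ?pnatr_eq0.
  by rewrite mulrAC e3; field.
have h1 : m 0 m1 = k / (2 * p 0 ord_max) * (2 * (p 0 ord_max * N 0 0 - p 0 0 * N 0 ord_max)).
  by have -> : m 0 m1 = k * N 0 0 - 2 * m 0 m3 * p 0 0; [rewrite -e1; ring | rewrite h3; field].
have h2 : m 0 m2 = k / (2 * p 0 ord_max) * (2 * (p 0 ord_max * N 0 1 - p 0 1 * N 0 ord_max)).
  by have -> : m 0 m2 = k * N 0 1 - 2 * m 0 m3 * p 0 1; [rewrite -e2; ring | rewrite h3; field].
exists (k / (2 * p 0 ord_max)); apply/rowP; apply: ord4P; rewrite !mxE /= ?h1 ?h2 ?h3 //.
move: q0; rewrite /quad dotpE h1 h2 h3 -!addrA => /eqP; rewrite addr_eq0 => /eqP ->.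
by field.
Qed.

Lemma is_derive_quad {V : normedModType R} (X : V -> 'rV[R]_3) (x v : V) (X' : 'rV[R]_3) m :
  (forall j, is_derive x v (fun y => X y 0 j) (X' 0 j)) ->
  is_derive x v (fun y => quad m (X y)) (dquad m (X x) X').
Proof.
move=> dX; have c t := is_derive_const t x v.
have d := is_derive_dotp dX dX.
apply: is_derive_eq (is_derive_add (is_derive_add (is_derive_add (c (m 0 m0))
  (is_derive_mul (c (m 0 m1)) (dX 0))) (is_derive_mul (c (m 0 m2)) (dX 1))) (is_derive_mul (c (m 0 m3)) d)) _.
by rewrite /dquad (dotpC X'); ring.
Qed.

End Quadrics.

Section GeodesicPatch.
Context {R : realType}.
Variables (O : set 'rV[R]_2) (X : 'rV[R]_2 -> 'rV[R]_3).
Hypotheses (oO : open O) (sX : smooth_on O X) (hX : forall y, O y -> H3 (X y)).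
Local Notation nu := (normal_field X).
Hypothesis imm : forall y, O y -> 0 < dotp (nu y) (nu y).
Hypothesis geod : forall y i j, O y -> second_form X y i j = 0.
Implicit Types (y : 'rV[R]_2).

Let sN : smooth_on O nu. Proof. by apply: smooth_crossp => //; exact: smooth_on_pd. Qed.
Let z0 y : O y -> X y 0 ord_max != 0. Proof. by move=> /hX h; rewrite gt_eqF. Qed.

Let umbilic y i j : O y ->
  dotp (nu y) (pd i (pd j X) y) = - (nu y 0 ord_max / X y 0 ord_max * dotp (pd i X y) (pd j X y)).
Proof.
move=> Oy; have := geod i j Oy; rewrite second_formE ?z0 ?imm // => /eqP.
rewrite mulf_eq0 invr_eq0 mulf_eq0 (negbTE (z0 Oy)) /= (gt_eqF (_ : 0 < Num.sqrt _)) ?sqrtr_gt0 ?imm //=.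
by rewrite addr_eq0 => /eqP ->; rewrite -mulrA [nu y 0 _ / _ * _]mulrC.
Qed.

Let nuX y j : dotp (nu y) (pd j X y) = 0.
Proof. by have [h0 h1] := crossp_dotl (pd 0 X y) (pd 1 X y); case: (ord2P j) => ->. Qed.

(* The last term appears because nu is not normalized. *)
Let weingarten y i : O y -> exists r, pd i nu y = (nu y 0 ord_max / X y 0 ord_max) *: pd i X y + r *: nu y.
Proof.
move=> Oy.
have h j : dotp (pd i nu y) (pd j X y) = nu y 0 ord_max / X y 0 ord_max * dotp (pd i X y) (pd j X y).
  have c := is_derive_const (0 : R) y (basis_vec i).
  have dxj l : is_derive y (basis_vec i) (fun y => pd j X y 0 l) (pd i (pd j X) y 0 l).
    by apply: (is_derive_pd_coord i l oO _ Oy); exact: smooth_on_pd.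
  have dn l := is_derive_pd_coord i l oO sN Oy.
  have := is_derive_eq_on oO Oy (fun y' Oy' => nuX y' j) (is_derive_dotp dn dxj) c.
  by rewrite umbilic // => /eqP; rewrite subr_eq0 => /eqP.
pose w : 'rV[R]_3 := pd i nu y + (- (nu y 0 ord_max / X y 0 ord_max)) *: pd i X y.
have wj j : dotp w (pd j X y) = 0 by rewrite dotpDl dotpZl h mulNr subrr.
have D0 := lt0r_neq0 (imm Oy).
exists (dotp w (nu y) / dotp (nu y) (nu y)).
have E := perp_parallel (wj 0) (wj 1).
move: E; rewrite -/(nu y) /w; move: (nu y) D0 (nu y 0 ord_max / X y 0 ord_max) (pd i X y) (pd i nu y) => n D0 t a b E.
apply/rowP => l; have /rowP/(_ l) := E; move: (dotp (b + _) n) => s.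
rewrite !mxE => El; rewrite [s / _ * _]mulrAC -El mulrAC mulfV // mul1r mulNr.
by rewrite [RHS]addrC subrK.
Qed.

Definition conormal_field y : 'rV[R]_4 := conormal (X y) (nu y).

(* Hence the derivatives of the conormal are multiples of it. *)
Let dcon y i : O y -> exists r, forall k, is_derive y (basis_vec i) (fun y => conormal_field y 0 k) (r * conormal_field y 0 k).
Proof.
move=> Oy; have [r E] := weingarten i Oy; exists (r + pd i X y 0 ord_max / X y 0 ord_max).
have nx := nuX y i; have zy := z0 Oy.
have dn l : is_derive y (basis_vec i) (fun y => nu y 0 l) (nu y 0 ord_max / X y 0 ord_max * pd i X y 0 l + r * nu y 0 l).
  by have := is_derive_pd_coord i l oO sN Oy; rewrite E !mxE.
have dx l := is_derive_pd_coord i l oO sX Oy.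
have c t := is_derive_const (t : R) y (basis_vec i).
have dm f g df dg := @is_derive_mul R _ f g y (basis_vec i) df dg.
rewrite dotpE in nx.
have E0 y' := conormalE (X y') (nu y').
apply: ord4P.
- have D := is_derive_add (dm _ _ _ _ (dn ord_max) (is_derive_add (is_derive_add (dm _ _ _ _ (dx 0) (dx 0))
     (dm _ _ _ _ (dx 1) (dx 1))) (is_derive_opp (dm _ _ _ _ (dx ord_max) (dx ord_max)))))
   (is_derive_opp (dm _ _ _ _ (dm _ _ _ _ (c 2) (dx ord_max)) (is_derive_add (dm _ _ _ _ (dx 0) (dn 0))
      (dm _ _ _ _ (dx 1) (dn 1))))).
  have -> : (fun y => conormal_field y 0 m0) = (fun y => nu y 0 ord_max * (X y 0 0 * X y 0 0 + X y 0 1 * X y 0 1 + - (X y 0 ord_max * X y 0 ord_max))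
       + - (2 * X y 0 ord_max * (X y 0 0 * nu y 0 0 + X y 0 1 * nu y 0 1))).
    by apply/funext => y'; have [e0 e1 e2 e3] := E0 y'.
  apply: is_derive_eq D _; have [e0 e1 e2 e3] := E0 y; rewrite /conormal_field ?e0 ?e1 ?e2 ?e3 => {e0 e1 e2 e3}.
  move: nx zy; move: (X y) (pd i X y) (nu y) => p w n nx zy.
  apply/eqP; rewrite -subr_eq0; apply/eqP.
  transitivity (- 2 * p 0 ord_max * (n 0 0 * w 0 0 + n 0 1 * w 0 1 + n 0 ord_max * w 0 ord_max)); last by rewrite nx mulr0.
  by move: (w 0 0) (w 0 1) (w 0 ord_max) => a b d; field.
- have D := dm _ _ _ _ (c 2) (is_derive_add (dm _ _ _ _ (dx ord_max) (dn 0)) (is_derive_opp (dm _ _ _ _ (dx 0) (dn ord_max)))).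
  have -> : (fun y => conormal_field y 0 m1) = (fun y => 2 * (X y 0 ord_max * nu y 0 0 + - (X y 0 0 * nu y 0 ord_max))).
    by apply/funext => y'; have [e0 e1 e2 e3] := E0 y'.
  apply: is_derive_eq D _; have [e0 e1 e2 e3] := E0 y; rewrite /conormal_field ?e0 ?e1 ?e2 ?e3 => {e0 e1 e2 e3}.
  by move: zy; move: (X y) (pd i X y) (nu y) => p w n zy; field.
- have D := dm _ _ _ _ (c 2) (is_derive_add (dm _ _ _ _ (dx ord_max) (dn 1)) (is_derive_opp (dm _ _ _ _ (dx 1) (dn ord_max)))).
  have -> : (fun y => conormal_field y 0 m2) = (fun y => 2 * (X y 0 ord_max * nu y 0 1 + - (X y 0 1 * nu y 0 ord_max))).
    by apply/funext => y'; have [e0 e1 e2 e3] := E0 y'.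
  apply: is_derive_eq D _; have [e0 e1 e2 e3] := E0 y; rewrite /conormal_field ?e0 ?e1 ?e2 ?e3 => {e0 e1 e2 e3}.
  by move: zy; move: (X y) (pd i X y) (nu y) => p w n zy; field.
- have -> : (fun y => conormal_field y 0 m3) = (fun y => nu y 0 ord_max).
    by apply/funext => y'; have [e0 e1 e2 e3] := E0 y'.
  apply: is_derive_eq (dn ord_max) _; have [e0 e1 e2 e3] := E0 y; rewrite /conormal_field e3 => {e0 e1 e2 e3}.
  by move: zy; move: (X y) (pd i X y) (nu y) => p w n zy; field.
Qed.

(** The quotients of the entries of the conormal by a nonzero entry have zero
    derivative. *)
Lemma conormal_locally_constant y0 : O y0 -> exists2 r : R, 0 < r &
  forall y, ball y0 r y -> O y /\ exists2 k, k != 0 & conormal_field y = k *: conormal_field y0.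
Proof.
move=> Oy0.
have n0 : conormal_field y0 != 0 by apply: conormal_neq0; [exact: z0|exact: imm].
have [l nl] : exists l, conormal_field y0 0 l != 0.
  apply: contrapT => /forallNP h; move/negP: n0; apply; apply/eqP/rowP => l.
  by rewrite [RHS]mxE; apply: contrapT => hl; apply: (h l); apply/eqP.
have cl : {for y0, continuous (fun y => conormal_field y 0 l)}.
  have [r /(_ l)[d _]] := dcon 0 Oy0.
  have sc : smooth_on O conormal_field.
    have c t := smooth_cst (t : R) oO.
    have nn := (smooth_onP _ oO).1 sN; have xx := (smooth_onP _ oO).1 sX.
    apply/smooth_onP => //; apply: ord4P.
    - apply: (smooth_eq (f := fun y => nu y 0 ord_max * (X y 0 0 * X y 0 0 + X y 0 1 * X y 0 1 + - (X y 0 ord_max * X y 0 ord_max))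
       + - (2 * X y 0 ord_max * (X y 0 0 * nu y 0 0 + X y 0 1 * nu y 0 1)))) => //; first by move=> y _; have [e0 e1 e2 e3] := conormalE (X y) (nu y).
      by repeat first [exact: nn | exact: xx | exact: c | apply: smoothD => // | apply: smoothM => // | apply: smoothN => //].
    - apply: (smooth_eq (f := fun y => 2 * (X y 0 ord_max * nu y 0 0 + - (X y 0 0 * nu y 0 ord_max)))) => //; first by move=> y _; have [e0 e1 e2 e3] := conormalE (X y) (nu y).
      by repeat first [exact: nn | exact: xx | exact: c | apply: smoothD => // | apply: smoothM => // | apply: smoothN => //].
    - apply: (smooth_eq (f := fun y => 2 * (X y 0 ord_max * nu y 0 1 + - (X y 0 1 * nu y 0 ord_max)))) => //; first by move=> y _; have [e0 e1 e2 e3] := conormalE (X y) (nu y).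
      by repeat first [exact: nn | exact: xx | exact: c | apply: smoothD => // | apply: smoothM => // | apply: smoothN => //].
    - by apply: (smooth_eq (f := fun y => nu y 0 ord_max)) => //; move=> y _; have [e0 e1 e2 e3] := conormalE (X y) (nu y).
  by apply: smooth_cont Oy0; exact: (smooth_onP _ oO).1.
have nO : \forall y \near y0, O y by apply: open_nbhs_nbhs.
have nn : \forall y \near y0, conormal_field y 0 l != 0.
  have := open_nbhs_nbhs (conj (@open_neq R 0) nl); exact: cl.
have [r r0 rP] := near_ball (filterI nO nn).
exists r => // y yb; have [Oy nly] := rP y yb; split => //.
exists (conormal_field y 0 l / conormal_field y0 0 l); first by rewrite mulf_neq0 ?invr_neq0.
apply/rowP => k; rewrite [RHS]mxE.
have := @ball_const R 2 (fun y => conormal_field y 0 k * (conormal_field y 0 l)^-1) y0 r.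
move=> /(_ _ y y0 yb (ballxx y0 r0)) E.
have {}E : conormal_field y 0 k * (conormal_field y 0 l)^-1 = conormal_field y0 0 k * (conormal_field y0 0 l)^-1.
  apply: E => x xb i; have [Ox nx] := rP x xb; have [q dq] := dcon i Ox.
  apply: is_derive_eq (is_derive_mul (dq k) (is_derive_inv nx (dq l))) _.
  by move: nx; move: (conormal_field x 0 k) (conormal_field x 0 l) => a b nx; field.
rewrite -[conormal_field y 0 k](divfK nly) E.
by move: nl; move: (conormal_field y0 0 l) (conormal_field y0 0 k) (conormal_field y 0 l) => a b c nl; field.
Qed.

End GeodesicPatch.

Section Immersions.
Context {R : realType}.
Variables (S : oriented_surface R) (Phi : S -> 'rV[R]_3).
Hypothesis imm : immersion_H3 Phi.

Lemma immersion_chart c : atlas c -> let X := Phi \o chart_inv c in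
  [/\ open (chart_cod c), smooth_on (chart_cod c) X, forall y, chart_cod c y -> H3 (X y)
    & forall y, chart_cod c y -> 0 < dotp (normal_field X y) (normal_field X y)].
Proof.
move=> Ac X; have [_ oC _ _] := atlas_chart Ac; have [sX rX] := imm.2 c Ac.
split => // y; first by move=> _; exact: imm.1.
move=> Oy; apply/(row_free_crossp (A := partials X y)); last exact: rX.
- by rewrite rowK -pdE.
- by rewrite rowK -pdE.
Qed.

Lemma chart_map_near (c : chart R S) s : atlas c -> chart_dom c s -> forall r, 0 < r ->
  \forall s' \near s, chart_dom c s' /\ ball (chart_map c s) r (chart_map c s').
Proof.
move=> Ac ds r r0; have [oD _ hD _] := atlas_chart Ac; have [_ _ cm] := hD s ds.
apply: filterI; first by apply: open_nbhs_nbhs.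
by apply: cm; exact: nbhsx_ballx.
Qed.

Lemma chart_inv_near (c : chart R S) y (A : set S) : atlas c -> chart_cod c y -> nbhs (chart_inv c y) A ->
  \forall y' \near y, chart_cod c y' /\ A (chart_inv c y').
Proof.
move=> Ac dy hA; have [_ oC _ hC] := atlas_chart Ac; have [_ _ cm] := hC y dy.
by apply: filterI; [exact: open_nbhs_nbhs|exact: cm].
Qed.

Hypothesis geod : forall c, atlas c -> forall y, chart_cod c y -> second_form (Phi \o chart_inv c) y = 0.

(** If the quadric of m contains a piece of the patch, then m is proportional to
    the conormal at a point of that piece, hence at all points of the patch. *)
Lemma quad_near_chart m c y : atlas c -> chart_cod c y -> exists2 r : R, 0 < r &
  (exists2 y', ball y r y' & \forall z \near y', quad m (Phi (chart_inv c z)) = 0) ->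
  forall z, ball y r z -> quad m (Phi (chart_inv c z)) = 0.
Proof.
move=> Ac Oy; have := immersion_chart Ac; cbv zeta; set X := Phi \o _ => -[oC sX hX nX].
have gX y' i j : chart_cod c y' -> second_form X y' i j = 0 by move=> Oy'; rewrite geod // mxE.
have [r r0 rP] := conormal_locally_constant oC sX hX nX gX Oy.
exists r => // -[y' by' qy'] z bz.
have [Oy' [k' k'0 E']] := rP _ by'; have [Oz [k k0 E]] := rP _ bz.
have dq i : dquad m (X y') (pd i X y') = 0.
  have dx l := is_derive_pd_coord i l oC sX Oy'.
  have [r' r'0 r'P] := near_ball qy'.
  apply: (is_derive_eq_on (O := ball y' r') _ _ _ (is_derive_quad m dx) (is_derive_const 0 y' (basis_vec i))) => //.
  - exact: ball_open.
  - exact: ballxx.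
have [t Et] := @quad_tangent R m (X y') (pd 0 X y') (pd 1 X y')
  (lt0r_neq0 (hX _ Oy')) (nX _ Oy') (nbhs_singleton qy') (dq 0) (dq 1).
have -> : m = (t * k' / k) *: conormal_field X z.
  by rewrite E scalerA divfK // -scalerA -E'.
by rewrite quadZ quad_conormal mulr0.
Qed.

(** The interior of the set of points mapped to the quadric is closed by
    [quad_near_chart], and the surface is connected. *)
Lemma geodesic_quad c0 s0 : atlas c0 -> chart_dom c0 s0 ->
  forall s, quad (conormal_field (Phi \o chart_inv c0) (chart_map c0 s0)) (Phi s) = 0.
Proof.
move=> Ac0 ds0; set m := conormal_field _ _.
pose A : set S := [set s | \forall s' \near s, quad m (Phi s') = 0].
have transport c s : atlas c -> chart_dom c s -> forall r, 0 < r ->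
   (forall z, ball (chart_map c s) r z -> quad m (Phi (chart_inv c z)) = 0) -> A s.
  move=> Ac ds r r0 h; apply: filterS (chart_map_near Ac ds r0) => s1 [d1 b1].
  have [_ _ hD _] := atlas_chart Ac; have [_ e _] := hD s1 d1.
  by rewrite -e; exact: h.
have cod (c : chart R S) s : atlas c -> chart_dom c s -> chart_cod c (chart_map c s) /\ chart_inv c (chart_map c s) = s.
  by move=> Ac ds; have [_ _ hD _] := atlas_chart Ac; have [cs e _] := hD s ds.
have As0 : A s0.
  have [Oy _] := cod _ _ Ac0 ds0; have := immersion_chart Ac0; cbv zeta.
  move=> [oC sX hX nX].
  have gX y' i j : chart_cod c0 y' -> second_form (Phi \o chart_inv c0) y' i j = 0 by move=> Oy'; rewrite geod // mxE.
  have [r r0 rP] := conormal_locally_constant oC sX hX nX gX Oy.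
  apply: (transport c0 s0 Ac0 ds0 r r0) => z bz; have [Oz [k k0 E]] := rP _ bz.
  have -> : m = k^-1 *: conormal_field (Phi \o chart_inv c0) z by rewrite E scalerA mulVf // scale1r.
  by rewrite quadZ quad_conormal mulr0.
suff AT : A = setT by move=> s; have : A s by [rewrite AT]; move=> /nbhs_singleton.
have oA : open A by exact: open_interior.
apply: (@surface_connected R S A).
- by exists s0.
- by exists A; rewrite ?setTI.
exists A; rewrite ?setTI // => s hs; have [c Ac ds] := atlas_cover s.
have [Oy e] := cod _ _ Ac ds; have [r r0 rP] := quad_near_chart m Ac Oy.
apply: (transport c s Ac ds r r0); apply: rP.
have [s' [As' [ds' bs']]] := hs _ (chart_map_near Ac ds r0).
exists (chart_map c s') => //; have [Oy' e'] := cod _ _ Ac ds'.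
have As2 : nbhs (chart_inv c (chart_map c s')) (fun s => quad m (Phi s) = 0) by rewrite e'.
by apply: filterS (chart_inv_near Ac Oy' As2) => z [].
Qed.

End Immersions.

(** * Images of surfaces are meagre *)
Section NowhereDense.
Context {R : realType}.
Implicit Types (O : set 'rV[R]_2) (X : 'rV[R]_2 -> 'rV[R]_3).

(** Up to the factor dotp n n, the vectors crossp b n and crossp n a are the
    basis dual to a, b that is orthogonal to n. *)
Lemma crossp_dual (a b : 'rV[R]_3) : let n := crossp a b in
  [/\ dotp (crossp b n) a = dotp n n, dotp (crossp b n) b = 0, dotp (crossp b n) n = 0 &
  [/\ dotp (crossp n a) a = 0, dotp (crossp n a) b = dotp n n & dotp (crossp n a) n = 0]].
Proof.
move=> n; have [e0 e1 e2] := crosspE a b.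
have [f0 f1 f2] := crosspE b n; have [g0 g1 g2] := crosspE n a.
rewrite !dotpE f0 f1 f2 g0 g1 g2 /n e0 e1 e2.
by split; [ring|ring|ring|split; ring].
Qed.

(** Near y the patch is a graph over its tangent plane, so two of its points
    cannot differ by a small nonzero multiple of the normal n at y. Here the
    functions Y i, coordinates of X along the dual basis minus the parameters,
    have zero derivative at y and hence Lipschitz constant 1/4 nearby. *)
Lemma patch_nowhere_dense O X y : open O -> smooth_on O X -> O y ->
  0 < dotp (normal_field X y) (normal_field X y) ->
  exists r, [/\ 0 < r, forall z, `|z - y| <= r -> O z &
    forall p : 'rV[R]_3, ~ nbhs p (X @` [set z | `|z - y| <= r])].
Proof.
move=> oO sX Oy n0; have Dn := lt0r_neq0 n0.
have := crossp_dual (pd 0 X y) (pd 1 X y); cbv zeta; rewrite -/(normal_field X y).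
set n := normal_field X y in n0 Dn *.
set A0 := crossp _ n; set A1 := crossp n _; clearbody A0 A1 => -[a0 a1 an [b0 b1 bn]].
pose B (i : 'I_2) := (dotp n n)^-1 *: (if i == 0 then A0 else A1).
have Bn i : dotp (B i) n = 0 by rewrite /B dotpZl; case: ifP => _; rewrite ?an ?bn mulr0.
have BX i k : dotp (B i) (pd k X y) = (i == k)%:R.
  rewrite /B dotpZl; case: (ord2P i) => ->; case: (ord2P k) => ->; rewrite /= ?a0 ?a1 ?b0 ?b1.
  - by rewrite mulVf.
  - by rewrite mulr0.
  - by rewrite mulr0.
  - by rewrite mulVf.
clearbody B; clear a0 a1 an b0 b1 bn A0 A1.
pose Y i z := dotp (B i) (X z) + - z 0 i.
have sY i : smooth O (Y i).
  apply: smoothD => //; last by apply: smoothN => //; exact: smooth_coord.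
  by apply: smooth_dotp => //; apply/smooth_onP => // j; exact: smooth_cst.
have dY i k : pd k (Y i) y = 0.
  apply: pd_val.
  have dx l := is_derive_pd_coord k l oO sX Oy.
  have db l : is_derive y (basis_vec k) (fun _ => B i 0 l) ((0 : 'rV[R]_3) 0 l).
    by rewrite mxE; exact: is_derive_const.
  have dc := is_derive_coord y (basis_vec k) i.
  apply: is_derive_eq (is_derive_add (is_derive_dotp db dx) (is_derive_opp dc)) _.
  by rewrite BX basis_vecE dotpE !mxE !mul0r !add0r eq_sym subrr.
have nY : \forall z \near y, O z /\ forall i k, `|pd k (Y i) z| <= 8^-1.
  apply: filterI; first by apply: open_nbhs_nbhs.
  apply: near_forall_ord => i; apply: near_forall_ord => k.
  have c := smooth_cont (smooth_pd k (sY i)) Oy.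
  have /cvgrPdist_le /(_ 8^-1) := c.
  rewrite invr_gt0 ltr0n => /(_ isT); apply: filterS => z.
  by rewrite dY sub0r normrN.
have [r r0 rP] := near_ball nY.
have cb z : `|z - y| <= r / 2 -> ball y r z.
  move=> h; rewrite -ball_normE /= distrC; apply: le_lt_trans h _.
  by rewrite ltr_pdivrMr // ltr_pMr // ltr1n.
exists (r / 2); split; first by rewrite divr_gt0.
  by move=> z /cb/rP[].
move=> p hp; have [z1 hz1 e1] := nbhs_singleton hp.
have [e e0 eP] := near_ball hp.
pose t := e / 2 / (`|n| + 1).
have N0 : 0 < `|n| + 1 by rewrite ltr_wpDl.
have t0 : 0 < t by rewrite !divr_gt0.
have [|z2 hz2 e2] := eP (p + t *: n).
  rewrite -ball_normE /= opprD addrA subrr sub0r normrN normrZ (gtr0_norm t0).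
  apply: (@lt_le_trans _ _ (t * (`|n| + 1))); first by rewrite ltr_pM2l // ltrDl.
  by rewrite /t divfK ?gt_eqF // ler_pdivrMr // ler_peMr ?ler1n // ltW.
have lip i : `|z2 0 i - z1 0 i| <= 4^-1 * `|z2 - z1|.
  have := @box_lipschitz R 2 (Y i) y r 8^-1 _ z2 z1 (cb _ hz2) (cb _ hz1).
  have -> : Y i z2 - Y i z1 = - (z2 0 i - z1 0 i).
    by rewrite /Y e2 -e1 dotpDr dotpZr Bn; ring.
  rewrite normrN (_ : 8^-1 *+ 2 = 4^-1) => [|]; last by field.
  apply => z bz k; have [Oz dz] := rP z bz; split; last by have := dz i k; rewrite -pdE.
  by have := is_derive_pd k (sY i) Oz => -[].
have : `|z2 - z1| <= 4^-1 * `|z2 - z1|.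
  by apply: norm_le_coord => [|i]; [rewrite mulr_ge0 // invr_ge0|have := lip i; rewrite !mxE].
move=> le1; have : z2 - z1 = 0.
  apply/eqP; rewrite -normr_eq0; apply/eqP; have := normr_ge0 (z2 - z1).
  by move: le1; move: (`|z2 - z1|) => a; clear; lra.
move=> /eqP; rewrite subr_eq0 => /eqP ez.
have : t *: n = 0 by have := e2; rewrite ez e1 => /eqP; rewrite -subr_eq0 opprD addrA subrr sub0r oppr_eq0 => /eqP.
move=> /eqP; rewrite scaler_eq0 (gt_eqF t0) /= => /eqP n00.
by move: n0; rewrite n00 dotpE !mxE !mul0r !addr0 ltxx.
Qed.

End NowhereDense.

Section RangeInterior.
Context {R : realType}.
Variables (S : oriented_surface R) (Phi : S -> 'rV[R]_3).
Hypothesis imm : immersion_H3 Phi.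

(** The image is a countable union of closed nowhere dense pieces, one for each
    basic open set on which a piece is available, and Baire applies. *)
Lemma range_no_interior (p : 'rV[R]_3) : ~ nbhs p (range Phi).
Proof.
move=> hp.
have [B cB bB] := @surface_second_countable R S.
pose good (b : set S) (K : set 'rV[R]_3) := [/\ closed K, forall p : 'rV[R]_3, ~ nbhs p K & Phi @` b `<=` K].
have hgood s : exists2 b, B b /\ b s & exists K, good b K.
  have [c Ac ds] := atlas_cover s; have [_ _ hD _] := atlas_chart Ac.
  have [cs e _] := hD s ds; have [oC sX hX nX] := immersion_chart imm Ac.
  have [r [r0 rO nw]] := patch_nowhere_dense oC sX cs (nX _ cs).
  have [b [bB' bs] bP] := bB.2 s _ (chart_map_near Ac ds r0).
  exists b => //; exists ((Phi \o chart_inv c) @` [set z | `|z - chart_map c s| <= r]); split => //.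
    apply: compact_closed; first exact: norm_hausdorff.
    apply: continuous_compact.
      apply: continuous_in_subspaceT => z; rewrite inE /= => hz; exact: (sX 0%N).1 (rO _ hz).
    apply: bounded_closed_compact; last exact: closed_cball.
    exists (`|chart_map c s| + r); split=> [|t ht z /= hz]; first exact: num_real.
    apply: le_trans (ltW ht); rewrite -[z](subrK (chart_map c s)) addrC.
    by apply: le_trans (ler_normD _ _) _; rewrite lerD2l.
  move=> _ [s' bs' <-]; have [ds' bl] := bP _ bs'; exists (chart_map c s').
    by move: bl; rewrite -ball_normE /= distrC => /ltW.
  by have [_ e' _] := hD _ ds'; rewrite /= e'.
have /choice[K KP] : forall b, exists K, (exists K, good b K) -> good b K.
  by move=> b; case: (pselect (exists K, good b K)) => [[K h]|h]; [exists K|exists set0].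
have /countable_injP[f finj] := cB.
(* Indices that code no piece receive the whole space. *)
have hF n : exists F : set 'rV[R]_3, [/\ open F, dense F &
    forall b, B b -> f b = n -> (exists K, good b K) -> F `&` K b = set0].
  case: (pselect (exists2 b, B b /\ f b = n & exists K, good b K)) => [[b [Bb fb] gb]|nb]; last first.
    exists setT; split; first exact: openT.
    - by move=> O hO oO; rewrite setIT.
    - by move=> b Bb fb gb; case: nb; exists b.
  have [cK nK _] := KP b gb; exists (~` K b); split; first exact: closed_openC.
  - move=> O [q Oq] oO; apply: contrapT => h; apply: (nK q).
    apply: (@filterS _ _ _ O); last exact: open_nbhs_nbhs.
    by move=> z Oz; apply: contrapT => nz; apply: h; exists z.
  - move=> b' Bb' fb' _; have -> : b' = b by apply: finj; rewrite ?inE // fb fb'.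
    by rewrite setICl.
have /choice[F FP] := hF.
have dF := @Baire R 'rV[R]_3 F (fun i => let: And3 o d _ := FP i in conj o d).
have [||q [/interior_subset [s _ es] Fq]] := dF (range Phi)^°.
- by exists p; exact: hp.
- exact: open_interior.
have [b [Bb bs] gb] := hgood s.
have [_ _ h] := FP (f b); have := h b Bb erefl gb.
move=> /seteqP[/(_ q) + _]; apply; split; first exact: Fq.
by have [_ _ sK] := KP b gb; rewrite -es; apply: sK; exists s.
Qed.

End RangeInterior.

(** * Invariance under homotheties *)
Section LinearChange.
Context {R : realType} {n m : nat}.
Variable P : 'M[R]_(n, m).
Implicit Types (O : set 'rV[R]_m) (f : 'rV[R]_m -> R).

Lemma continuous_mulmx (x : 'rV[R]_n) : {for x, continuous (fun p : 'rV[R]_n => p *m P)}.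
Proof.
apply/continuous_coordP => j.
have -> : (fun p : 'rV[R]_n => (p *m P) 0 j) = (fun p => \sum_i p 0 i * P i j).
  by apply/funext => p; rewrite mxE.
apply: (@smooth_cont _ _ setT) => //; apply: smooth_sum => [|i]; first exact: openT.
by apply: smoothM; [exact: openT|apply: smooth_coord; exact: openT|apply: smooth_cst; exact: openT].
Qed.

Lemma open_mulmx O : open O -> open [set p : 'rV[R]_n | O (p *m P)].
Proof.
move=> oO; rewrite openE => p Op; apply: (continuous_mulmx (x := p)).
exact: open_nbhs_nbhs.
Qed.

Lemma is_derive_mulmx O f (x v : 'rV[R]_n) : open O -> Ck 1 O f -> O (x *m P) ->
  is_derive x v (fun p => f (p *m P)) (\sum_j (v *m P) 0 j * pd j f (x *m P)).
Proof.
move=> oO cf Ox; have [d1 d2] := is_derive_dir (v *m P) oO Ox cf.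
have E : (fun h : R => h^-1 *: ((f \o shift (x *m P)) (h *: (v *m P)) - f (x *m P)))
       = (fun h : R => h^-1 *: (((fun p => f (p *m P)) \o shift x) (h *: v) - f (x *m P))).
  by apply/funext => h /=; rewrite mulmxDl scalemxAl.
apply: DeriveDef; first by rewrite /derivable -E.
rewrite /derive -E -/(derive f _ _) d2; apply: eq_bigr => j _; by rewrite -pdE.
Qed.

Lemma Ck_mulmx k O f : open O -> Ck k O f ->
  Ck k [set p : 'rV[R]_n | O (p *m P)] (fun p => f (p *m P)).
Proof.
move=> oO; elim: k f => [|k IH] f cf.
  split=> // x Ox; apply: (cvg_comp (fun p : 'rV[R]_n => p *m P) f); last exact: Ck_continuous cf Ox.
  exact: continuous_mulmx.
have c1 : Ck 1 O f by elim: k cf {IH} => // k IH /Ck_lower.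
split=> [x Ox|i]; first by apply: (Ck_continuous (IH _ (Ck_lower cf))).
split=> [x Ox|]; first by have [] := is_derive_mulmx (basis_vec i) oO c1 Ox.
have oP := open_mulmx oO.
apply: (Ck_eq (f := fun x => \sum_j (basis_vec i *m P) 0 j * pd j f (x *m P))) => //.
  by move=> x Ox; rewrite (@derive_val _ _ _ _ _ _ _ (is_derive_mulmx (basis_vec i) oO c1 Ox)).
apply: Ck_sum => // j; apply: CkM => //; first exact: Ck_cst.
by apply: IH; rewrite -pdE; exact: Ck_partial.
Qed.

End LinearChange.

Section RadialTangency.
Context {R : realType}.

Lemma det3_crossp (a b c : 'rV[R]_3) (A : 'M[R]_3) : row 0 A = a -> row 1 A = b -> row ord_max A = c ->
  \det A = dotp (crossp a b) c.
Proof.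
move=> <- <- <-; have [e0 e1 e2] := crosspE (row 0 A) (row 1 A); rewrite dotpE e0 e1 e2 !mxE.
pose s i := [:: A i 0; A i 1; A i ord_max].
pose f (i j : nat) : R := nth 0 (nth [::] [:: s 0; s 1; s ord_max] i) j.
have -> : A = \matrix_(i < 3, j < 3) f i j.
  by apply/matrixP => i j; rewrite mxE; case: (ord3P i) => ->; case: (ord3P j) => ->.
by rewrite det_nat3 !mxE /f /=; ring.
Qed.

Variables (S : oriented_surface R) (Phi : S -> 'rV[R]_3).
Hypothesis imm : immersion_H3 Phi.
Hypothesis inv : forall t s, 0 < t -> range Phi (t *: Phi s).

(** Otherwise (y, t) maps to t X(y) with invertible derivative at t = 1, and by
    [open_map] the invariant image has interior points. *)
Lemma homothety_tangent c y : atlas c -> chart_cod c y ->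
  dotp (normal_field (Phi \o chart_inv c) y) ((Phi \o chart_inv c) y) = 0.
Proof.
move=> Ac Oy; have := immersion_chart imm Ac; cbv zeta; set X := Phi \o _ => -[oC sX hX nX].
apply: contrapT => /eqP D.
pose P : 'M[R]_(3, 2) := \matrix_(i, j) (i == j :> nat)%:R.
(* P drops the third coordinate, which is the factor t. *)
pose F (p : 'rV[R]_3) : 'rV[R]_3 := p 0 ord_max *: X (p *m P).
pose U := [set p | chart_cod c (p *m P)] `&` [set p : 'rV[R]_3 | 0 < p 0 ord_max].
have oU : open U by apply: openI; [exact: open_mulmx|exact: open_H3].
pose p0 : 'rV[R]_3 := \row_i nth 0 [:: y 0 0; y 0 1; 1] i.
have p0P : p0 *m P = y.
  apply/rowP => j; rewrite mxE sum_ord3 !mxE /=.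
  by case: (ord2P j) => ->; rewrite /= ?mulr1 ?mulr0 ?addr0 ?add0r.
have Up0 : U p0 by split; rewrite /= ?p0P // mxE.
have FE j : (fun p => F p 0 j) = (fun p => p 0 ord_max * X (p *m P) 0 j).
  by apply/funext => p; rewrite mxE.
have cX j := Ck_mulmx P oC ((smooth_onP _ oC).1 sX j 1%N).
have cF j : Ck 1 U (fun p => F p 0 j).
  rewrite FE; apply: CkM => //; first exact: Ck_coord.
  by apply: Ck_sub (cX j) => p [].
apply: (@range_no_interior R S Phi imm (F p0)).
apply: filterS (open_map oU Up0 cF _).
  by move=> _ [p [Up p0'] <-]; exact: inv.
have dF i j : is_derive p0 (basis_vec i) (fun p => F p 0 j)
   ((basis_vec i : 'rV[R]_3) 0 ord_max * X y 0 j + (\sum_k (basis_vec i *m P) 0 k * pd k (fun z => X z 0 j) y)).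
  rewrite FE; have Oy' : chart_cod c (p0 *m P) by rewrite p0P.
  have := is_derive_mul (is_derive_coord p0 (basis_vec i) ord_max)
    (is_derive_mulmx (basis_vec i) oC ((smooth_onP _ oC).1 sX j 1%N) Oy').
  by rewrite p0P [p0 0 _]mxE mul1r.
rewrite (_ : \matrix_(i, j) _ = \matrix_(i, j) ((basis_vec i : 'rV[R]_3) 0 ord_max * X y 0 j
     + (\sum_k (basis_vec i *m P) 0 k * pd k (fun z => X z 0 j) y))); last first.
  by apply/matrixP => i j; rewrite [LHS]mxE [RHS]mxE (@derive_val _ _ _ _ _ _ _ (dF i j)).
rewrite (@det3_crossp (pd 0 X y) (pd 1 X y) (X y)) //.
all: apply/rowP => j; rewrite [LHS]mxE [LHS]mxE basis_vecE sum_ord2 ?(pd_coord _ _ oC sX Oy).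
all: have bP (i : 'I_3) k : ((basis_vec i : 'rV[R]_3) *m P) 0 k = (i == k :> nat)%:R by
  rewrite mxE sum_ord3 !basis_vecE !mxE; case: (ord3P i) => ->; rewrite ?mul1r ?mul0r ?addr0 ?add0r.
all: by rewrite !bP /= ?mul1r ?mul0r ?addr0 ?add0r.
Qed.

End RadialTangency.

(** * The model surface *)
Section PlaneTopology.
Context {R : realType} {n : nat}.

Lemma connected_row_space : connected [set: 'rV[R]_n].
Proof.
have -> : [set: 'rV[R]_n] = \bigcup_(x in [set: 'rV[R]_n]) ((fun t : R => t *: x) @` [set: R]).
  by apply/seteqP; split => // x _; exists x => //; exists 1; rewrite ?scale1r.
apply: bigcup_connected.
  by exists 0 => x _; exists 0 => //; rewrite scale0r.
move=> x _; apply: connected_continuous_connected; first by apply/connected_intervalP.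
by apply: continuous_subspaceT => t; exact: (@scalel_continuous _ _ x t).
Qed.

(** Balls with rational centers and radii 1 / (k + 1) form a basis. *)
Lemma second_countable_row_space : @second_countable 'rV[R]_n.
Proof.
pose B (k : {ffun 'I_n -> rat} * nat) : set 'rV[R]_n := ball (\row_i ratr (k.1 i) : 'rV[R]_n) k.2.+1%:R^-1.
exists (range B).
  apply: sub_countable (card_image_le _ _) _; exact: countableP.
split => [_ [k _ <-]|x A /nbhs_ballP[e /= e0 eA]].
  by apply: ball_open; rewrite invr_gt0 ltr0n.
have [N N2] : exists N, (N.+1%:R : R)^-1 < e / 2.
  have [N _ hN] := near_infty_natSinv_lt (PosNum (divr_gt0 e0 (ltr0Sn _ 1))).
  by exists N; apply: (hN N) => /=.
have N0 : 0 < (N.+1%:R : R)^-1 by rewrite invr_gt0 ltr0n.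
have hq (i : 'I_n) : exists q : rat, `|ratr q - x 0 i| < (N.+1%:R)^-1.
  have [|q] := @rat_in_itvoo R (x 0 i - N.+1%:R^-1) (x 0 i + N.+1%:R^-1).
    by rewrite ltrD2l gtrN.
  rewrite in_itv /= => /andP[h1 h2]; exists q; rewrite ltr_norml ltrBrDl h1 /=.
  by rewrite ltrBlDl.
have [q qP] := choice hq; pose k := ([ffun i => q i], N).
pose c : 'rV[R]_n := \row_i ratr (q i).
have xk : ball c (N.+1%:R^-1) x.
  by apply/ball_rowE; split => // j; rewrite mxE.
have Bk : B k = ball c (N.+1%:R^-1).
  by rewrite /B /=; congr ball; apply/rowP => i; rewrite !mxE ffunE.
exists (B k); first by split; [exists k|rewrite Bk].
rewrite Bk => y hy; apply: eA; apply: (@le_ball _ _ _ (N.+1%:R^-1 + N.+1%:R^-1)).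
  by rewrite [leRHS]splitr lerD // ltW.
by apply: ball_triangle hy; exact: ball_sym.
Qed.

End PlaneTopology.

Section PlaneSurface.
Context {R : realType}.
Implicit Types (x y : 'rV[R]_2).

Definition upper_half : set 'rV[R]_2 := [set y | 0 < y 0 1].

(** The carrier of the model surface is the whole plane, where connectedness
    and countability are immediate, but its chart takes values in the upper
    half-plane, where the vertical plane has a linear parametrization. *)
Definition exp_coord x : 'rV[R]_2 := \row_i (if i == 0 then x 0 0 else expR (x 0 1)).
Definition ln_coord x : 'rV[R]_2 := \row_i (if i == 0 then x 0 0 else ln (x 0 1)).

Lemma exp_coordK : cancel exp_coord ln_coord.
Proof. by move=> x; apply/rowP => i; rewrite !mxE /=; case: (ord2P i) => -> //=; rewrite expRK. Qed.

Lemma ln_coordK y : upper_half y -> exp_coord (ln_coord y) = y.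
Proof. by move=> hy; apply/rowP => i; rewrite !mxE /=; case: (ord2P i) => -> //=; rewrite lnK. Qed.

Lemma exp_coord_upper x : upper_half (exp_coord x).
Proof. by rewrite /upper_half /= mxE expR_gt0. Qed.

Lemma open_upper_half : open upper_half.
Proof.
apply: (open_comp (f := fun y : 'rV[R]_2 => y 0 1) (D := [set t : R | 0 < t])).
  by move=> y _; exact: coord_continuous.
exact: open_gt.
Qed.

Definition half_plane_chart : chart R 'rV[R]_2 := Chart setT upper_half exp_coord ln_coord.

Lemma half_plane_chartP : is_chart half_plane_chart.
Proof.
split; [exact: openT|exact: open_upper_half| |] => /= x hx.
- split; [exact: exp_coord_upper|exact: exp_coordK|].
  apply/continuous_coordP => j; case: (ord2P j) => ->.
    by rewrite (_ : (fun _ => _) = fun y : 'rV[R]_2 => y 0 0); [exact: coord_continuous|apply/funext => y; rewrite mxE].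
  rewrite (_ : (fun _ => _) = fun y : 'rV[R]_2 => expR (y 0 1)); last by apply/funext => y; rewrite mxE.
  apply: (cvg_comp (fun y : 'rV[R]_2 => y 0 1) expR); [exact: coord_continuous|exact: continuous_expR].
- split => //; first exact: ln_coordK.
  apply/continuous_coordP => j; case: (ord2P j) => ->.
    by rewrite (_ : (fun _ => _) = fun y : 'rV[R]_2 => y 0 0); [exact: coord_continuous|apply/funext => y; rewrite mxE].
  rewrite (_ : (fun _ => _) = fun y : 'rV[R]_2 => ln (y 0 1)); last by apply/funext => y; rewrite mxE.
  apply: (cvg_comp (fun y : 'rV[R]_2 => y 0 1) (@ln R)); [exact: coord_continuous|exact: continuous_ln].
Qed.

Lemma half_plane_transition c d : [set half_plane_chart] c -> [set half_plane_chart] d ->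
  transition_dom c d = upper_half /\ forall y, upper_half y -> transition c d y = y.
Proof.
move=> -> ->; split; last by move=> y /ln_coordK.
by apply/seteqP; split => [x []|x hx].
Qed.

Lemma half_plane_smooth c d : [set half_plane_chart] c -> [set half_plane_chart] d ->
  smooth_on (transition_dom c d) (transition c d).
Proof.
move=> hc hd; have [-> e] := half_plane_transition hc hd.
apply: (smooth_on_eq (W := id)) => [||]; [exact: open_upper_half|by move=> x hx; rewrite e|].
apply/smooth_onP => [|j]; first exact: open_upper_half.
by apply: smooth_coord; exact: open_upper_half.
Qed.

Lemma half_plane_oriented c d : [set half_plane_chart] c -> [set half_plane_chart] d ->
  forall x, transition_dom c d x -> 0 < \det (partials (transition c d) x).
Proof.
move=> hc hd x; have := half_plane_smooth hc hd; have [-> e] := half_plane_transition hc hd => sT hx.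
have -> : partials (transition c d) x = 1%:M; last by rewrite det1 ltr01.
apply/matrixP => i j; rewrite mxE -[LHS]/((fun x => 'D_(basis_vec i) (transition c d) x) x 0 j) pdE.
rewrite (pd_coord _ _ open_upper_half sT hx) (pd_eq_on (h := fun y => y 0 j) _ open_upper_half hx) => [|y hy].
  by rewrite (pd_val (is_derive_coord _ _ _)) basis_vecE mxE.
by rewrite e.
Qed.

Definition plane_surface : oriented_surface R.
Proof.
refine (@OrientedSurface R 'rV[R]_2 [set half_plane_chart] _ connected_row_space _
  second_countable_row_space _ _ half_plane_smooth half_plane_oriented).
- by exists 0.
- exact: norm_hausdorff.
- by move=> c ->; exact: half_plane_chartP.
- by move=> s; exists half_plane_chart.
Defined.

End PlaneSurface.

(** * Isometric images and vertical planes *)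
Section IsometricPatches.
Context {R : realType}.
Variables (O : set 'rV[R]_2) (X Y : 'rV[R]_2 -> 'rV[R]_3) (M : 'M[R]_4).
Hypotheses (oO : open O) (sX : smooth_on O X) (sY : smooth_on O Y).
Hypotheses (hX : forall y, O y -> H3 (X y)) (hY : forall y, O y -> H3 (Y y)).
Hypothesis uM : M \in unitmx.
Hypothesis lM : forall u v, mink (u *m M) (v *m M) = mink u v.
Hypothesis XY : forall y, O y -> lift (X y) = lift (Y y) *m M.

Let sU := smooth_on_lift oO sY hY.

Lemma patch_metric y i j : O y ->
  hmetric (X y) (pd i X y) (pd j X y) = hmetric (Y y) (pd i Y y) (pd j Y y).
Proof.
move=> Oy; have zX : X y 0 ord_max != 0 by rewrite gt_eqF //; exact: hX.
have zY : Y y 0 ord_max != 0 by rewrite gt_eqF //; exact: hY.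
apply: oppr_inj; rewrite -!mink_dlift // -!(pd_lift _ oO sX hX Oy) -!(pd_lift _ oO sY hY Oy).
by rewrite !(pd_transfer oO sU XY _ Oy) lM.
Qed.

(** The Gram determinants differ by a power of the ratio of the heights. *)
Lemma patch_immersed y : O y -> 0 < dotp (normal_field Y y) (normal_field Y y) ->
  0 < dotp (normal_field X y) (normal_field X y).
Proof.
move=> Oy; have zX : 0 < X y 0 ord_max by exact: hX.
have zY : 0 < Y y 0 ord_max by exact: hY.
have [k k0 E] : exists2 k : R, 0 < k & forall i j, dotp (pd i X y) (pd j X y) = k * dotp (pd i Y y) (pd j Y y).
  exists ((X y 0 ord_max / Y y 0 ord_max) ^+ 2) => [|i j]; first by rewrite exprn_gt0 // divr_gt0.
  have := patch_metric i j Oy; rewrite /hmetric /height => /(canRL (divfK _)) -> ; last by rewrite expf_neq0 ?gt_eqF.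
  by move: zY => /lt0r_neq0; move: (dotp _ _) (X y 0 _) (Y y 0 _) => a b c c0; field.
rewrite /normal_field !lagrange !E exprMn => h.
have -> : k * dotp (pd 0 Y y) (pd 0 Y y) * (k * dotp (pd 1 Y y) (pd 1 Y y)) - k ^+ 2 * dotp (pd 0 Y y) (pd 1 Y y) ^+ 2
  = k ^+ 2 * (dotp (pd 0 Y y) (pd 0 Y y) * dotp (pd 1 Y y) (pd 1 Y y) - dotp (pd 0 Y y) (pd 1 Y y) ^+ 2).
  by move: (dotp _ _) (dotp _ _) (dotp _ _) => a b c; ring.
by rewrite mulr_gt0 // exprn_gt0.
Qed.

Lemma patch_second_form y i j : O y -> 0 < dotp (normal_field Y y) (normal_field Y y) ->
  second_form Y y i j = 0 -> second_form X y i j = 0.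
Proof.
move=> Oy nY /(second_form0P oO sY hY _ _ Oy nY) h.
apply/(second_form0P oO sX hX _ _ Oy (patch_immersed Oy nY)).
by rewrite (pd_pd_transfer oO sU XY _ _ Oy) (lift_det_transfer oO sU XY _ Oy) h mul0r.
Qed.

Lemma patch_shrinker y L : O y -> shrinker_eq X y (L *m M) -> shrinker_eq Y y L.
Proof.
move=> Oy /(minkowski_eqP oO sX hX _ Oy) h; apply/(minkowski_eqP oO sY hY _ Oy).
refine (@minkowski_eq_transfer R O (fun y => lift (Y y)) (fun y => lift (X y)) M oO sU uM lM XY y L Oy h).
Qed.

End IsometricPatches.

Section Isometries.
Context {R : realType}.
Implicit Types (g : 'rV[R]_3 -> 'rV[R]_3) (m : 'rV[R]_4) (p : 'rV[R]_3).

Lemma isometry_lift g : isometry_H3 g -> exists M : 'M[R]_4,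
  [/\ M \in unitmx, forall u v, mink (u *m M) (v *m M) = mink u v
    & forall x, H3 x -> lift (g x) = lift x *m M].
Proof. by case=> -[gH _ _] sg ig; apply: isometry_lorentz; split => // x /gH. Qed.

Lemma quad_lift m p : H3 p -> quad m p = p 0 ord_max * (lift p *m m^T) 0 0.
Proof.
move=> /lt0r_neq0; rewrite /height /quad !mxE sum_ord4 !mxE /= dotpE => p0.
by field.
Qed.

Lemma quad_transfer g (M : 'M[R]_4) m p : (forall x, H3 x -> lift (g x) = lift x *m M) ->
  H3 p -> H3 (g p) -> quad m (g p) = 0 <-> quad (m *m M^T) p = 0.
Proof.
move=> gM hp hgp; rewrite !quad_lift // gM // trmx_mul trmxK -mulmxA.
have p0 : p 0 ord_max != 0 by rewrite gt_eqF.
have gp0 : g p 0 ord_max != 0 by rewrite gt_eqF.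
by split => /eqP; rewrite mulf_eq0 ?(negbTE p0) ?(negbTE gp0) /= => /eqP ->; rewrite mulr0.
Qed.

Lemma continuous_quad m p : {for p, continuous (quad m)}.
Proof.
apply: (@smooth_cont _ _ setT) => //.
have oT := @openT 'rV[R]_3; have c t := smooth_cst (t : R) oT.
apply: smoothD => //; first apply: smoothD => //; first apply: smoothD => //.
- by apply: smoothM => //; exact: smooth_coord.
- by apply: smoothM => //; exact: smooth_coord.
apply: smoothM => //; apply: smooth_dotp => //.
all: by apply/smooth_onP => // j; exact: smooth_coord.
Qed.

Definition quadric m : set 'rV[R]_3 := [set p | H3 p /\ quad m p = 0].

Lemma quadric_closed m : closed_in_H3 (quadric m).
Proof.
move=> p [cp hp]; split => //; apply: contrapT => /eqP q0.
have /cp [p' [[_ q1] /=]] : nbhs p [set p' | quad m p' != 0].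
  by have := open_nbhs_nbhs (conj (@open_neq R 0) q0); exact: (@continuous_quad m p).
by rewrite q1 eqxx.
Qed.

(** Covectors are transported by the inverse transpose of the matrix on
    lifts. *)
Lemma image_quadric g (M : 'M[R]_4) m : isometry_H3 g -> M \in unitmx ->
  (forall x, H3 x -> lift (g x) = lift x *m M) -> g @` quadric m = quadric (m *m (invmx M)^T).
Proof.
move=> [[gH _ gS] _ _] uM gM.
have mE : m *m (invmx M)^T *m M^T = m by rewrite -mulmxA -trmx_mul mulmxV // trmx1 mulmx1.
apply/seteqP; split => [_ [p [hp qp] <-]|x [hx qx]].
  by split; [exact: gH|apply/(quad_transfer _ gM hp (gH _ hp)); rewrite mE].
have [p hp e] := gS x hx; exists p => //; split => //.
by rewrite -[m]mE; apply/(quad_transfer _ gM hp (gH _ hp)); rewrite e.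
Qed.

End Isometries.

Section VerticalPlanes.
Context {R : realType}.
Variable m : 'rV[R]_4.
Hypotheses (m00 : m 0 m0 = 0) (m30 : m 0 m3 = 0) (mn0 : m != 0).

(** The linear parametrization (s, t) of the plane m_1 x + m_2 y = 0, and below
    a linear left inverse. *)
Definition vertical_mx : 'M[R]_(2, 3) := \matrix_(i, j)
  nth 0 (nth [::] [:: [:: - m 0 m2; m 0 m1; 0]; [:: 0; 0; 1]] i) j.

Let Y (y : 'rV[R]_2) := y *m vertical_mx.

Let YE y : [/\ Y y 0 0 = - (y 0 0 * m 0 m2), Y y 0 1 = y 0 0 * m 0 m1 & Y y 0 ord_max = y 0 1].
Proof. by rewrite /Y !mxE !sum_ord2 !mxE /=; split; ring. Qed.

Let sq0 : 0 < m 0 m1 ^+ 2 + m 0 m2 ^+ 2.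
Proof.
rewrite lt_def addr_ge0 ?sqr_ge0 // andbT; apply: contra mn0.
rewrite paddr_eq0 ?sqr_ge0 // !sqrf_eq0 => /andP[/eqP e1 /eqP e2].
by apply/eqP/rowP; apply: ord4P; rewrite [RHS]mxE.
Qed.

Definition vertical_proj : 'M[R]_(3, 2) := \matrix_(i, j)
  nth 0 (nth [::] [:: [:: - m 0 m2 / (m 0 m1 ^+ 2 + m 0 m2 ^+ 2); 0];
    [:: m 0 m1 / (m 0 m1 ^+ 2 + m 0 m2 ^+ 2); 0]; [:: 0; 1]] i) j.

Lemma vertical_mxK (y : 'rV[R]_2) : y *m vertical_mx *m vertical_proj = y.
Proof.
have [e0 e1 e2] := YE y; have sn := lt0r_neq0 sq0.
apply/rowP => j; rewrite mxE sum_ord3 -/(Y y) e0 e1 e2 !mxE.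
by case: (ord2P j) => -> /=; field.
Qed.

Lemma vertical_projK (p : 'rV[R]_3) : m 0 m1 * p 0 0 + m 0 m2 * p 0 1 = 0 ->
  p *m vertical_proj *m vertical_mx = p.
Proof.
move=> /eqP; rewrite addr_eq0 => /eqP q; have sn := lt0r_neq0 sq0.
have [e0 e1 e2] := YE (p *m vertical_proj).
apply/rowP => j; rewrite -/(Y _); case: (ord3P j) => ->; rewrite ?e0 ?e1 ?e2 mxE sum_ord3 !mxE /=.
- transitivity ((m 0 m1 * - (m 0 m2 * p 0 1) + m 0 m2 ^+ 2 * p 0 0) / (m 0 m1 ^+ 2 + m 0 m2 ^+ 2)).
    by field.
  by rewrite -q; field.
- transitivity ((m 0 m1 ^+ 2 * p 0 1 - m 0 m2 * (m 0 m1 * p 0 0)) / (m 0 m1 ^+ 2 + m 0 m2 ^+ 2)).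
    by field.
  by rewrite q; field.
- by ring.
Qed.

Lemma crossp_vertical (u v : 'rV[R]_2) : let n := crossp (u *m vertical_mx) (v *m vertical_mx) in
  dotp n n = (m 0 m1 ^+ 2 + m 0 m2 ^+ 2) * (u 0 0 * v 0 1 - u 0 1 * v 0 0) ^+ 2 /\ n 0 ord_max = 0.
Proof.
move=> n; have [c0 c1 c2] := crosspE (Y u) (Y v).
have [u0 u1 u2] := YE u; have [v0 v1 v2] := YE v.
rewrite /n -/(Y u) -/(Y v) dotpE c0 c1 c2 u0 u1 u2 v0 v1 v2; split; ring.
Qed.

Lemma vertical_quad p : quad m p = m 0 m1 * p 0 0 + m 0 m2 * p 0 1.
Proof. by rewrite /quad m00 m30; ring. Qed.

Lemma vertical_image : Y @` upper_half = quadric m.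
Proof.
apply/seteqP; split => [_ [y hy <-]|p [hp]].
  have [e0 e1 e2] := YE y; split; first by rewrite /H3 /= /height e2.
  by rewrite /quad e0 e1 m00 m30; ring.
rewrite vertical_quad => /vertical_projK q; exists (p *m vertical_proj) => //.
by rewrite /upper_half /=; have [_ _ <-] := YE (p *m vertical_proj); rewrite /Y q.
Qed.

Let oU := @open_upper_half R.

Lemma vertical_smooth : smooth_on upper_half Y.
Proof.
apply: (pd_linear vertical_mx 0 oU _ (exp_coord_upper 0)).1.
by apply/smooth_onP => // j; exact: smooth_coord.
Qed.

Lemma vertical_pd i y : upper_half y -> pd i Y y = basis_vec i *m vertical_mx.
Proof.
move=> hy; have sI : smooth_on upper_half (id : 'rV[R]_2 -> 'rV[R]_2).
  by apply/smooth_onP => // j; exact: smooth_coord.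
rewrite (pd_linear vertical_mx i oU sI hy).2; congr (_ *m _).
by apply/rowP => j; rewrite (pd_coord _ _ oU sI hy) (pd_val (is_derive_coord _ _ _)).
Qed.

Lemma vertical_normal y : upper_half y ->
  0 < dotp (normal_field Y y) (normal_field Y y) /\ normal_field Y y 0 ord_max = 0.
Proof.
move=> hy; rewrite /normal_field !vertical_pd //.
have := crossp_vertical (basis_vec 0) (basis_vec 1); cbv zeta => -[-> ->]; split => //.
by rewrite !basis_vecE /= mulr1 mulr0 subr0 expr1n mulr1.
Qed.

Lemma vertical_H3 y : upper_half y -> H3 (Y y).
Proof. by move=> hy; rewrite /H3 /= /height; have [_ _ ->] := YE y. Qed.

Lemma vertical_second_form y i j : upper_half y -> second_form Y y i j = 0.
Proof.
move=> hy; have [n0 n3] := vertical_normal hy.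
rewrite second_formE ?gt_eqF //; last exact: vertical_H3.
rewrite n3 mulr0 mul0r addr0.
have -> : pd i (pd j Y) y = 0.
  have dj z : upper_half z -> pd j Y z = (fun _ => basis_vec j *m vertical_mx) z by move=> hz; exact: vertical_pd.
  rewrite (pd_eq_on i oU hy dj).
  by rewrite -pdE; exact: derive_cst.
have -> : dotp (normal_field Y y) 0 = 0 by rewrite -(scale0r 0) dotpZr mul0r.
by rewrite mulr0.
Qed.

(** The linear parametrization has zero second fundamental form, its normal being
    horizontal and constant; by [patch_second_form] so has its image. *)
Lemma vertical_plane_geodesic g : isometry_H3 g -> totally_geodesic_plane (g @` quadric m).
Proof.
move=> ig; have [M [uM lM gM]] := isometry_lift ig.
split; first by rewrite (image_quadric m ig uM gM); exact: quadric_closed.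
have [[gH _ _] sg _] := ig.
pose Psi (s : plane_surface) := g (Y (exp_coord (s : 'rV[R]_2))).
pose X := Psi \o ln_coord.
have XE y : upper_half y -> X y = g (Y y) by move=> hy; rewrite /X /Psi /= ln_coordK.
have hX y : upper_half y -> H3 (X y) by move=> hy; rewrite XE //; apply: gH; exact: vertical_H3.
have sX : smooth_on upper_half X.
  apply: (smooth_on_eq (W := fun y => g (Y y))) => [//|y /XE -> //|].
  apply/smooth_onP => // j k.
  apply: Ck_sub (Ck_mulmx vertical_mx (@open_H3 R) ((smooth_onP _ (@open_H3 R)).1 sg j k)).
  exact: vertical_H3.
have XY y : upper_half y -> lift (X y) = lift (Y y) *m M.
  by move=> hy; rewrite XE // gM //; exact: vertical_H3.
have nX y : upper_half y -> 0 < dotp (normal_field X y) (normal_field X y).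
  by move=> hy; exact: (patch_immersed oU sX vertical_smooth hX vertical_H3 lM XY hy (vertical_normal hy).1).
exists (@plane_surface R), Psi; split.
- split => [s|c ->]; first by apply: gH; apply: vertical_H3; exact: exp_coord_upper.
  split => // y hy; apply/(row_free_crossp (a := pd 0 X y) (b := pd 1 X y)); last exact: nX.
    by rewrite rowK -pdE.
  by rewrite rowK -pdE.
- move=> c -> y hy; apply/matrixP => i j; rewrite [RHS]mxE.
  apply: (patch_second_form oU sX vertical_smooth hX vertical_H3 lM XY hy (vertical_normal hy).1).
  exact: vertical_second_form.
- rewrite -vertical_image; apply/seteqP; split => [_ [s _ <-]|_ [_ [y hy <-] <-]].
    by exists (Y (exp_coord s)) => //; exists (exp_coord s) => //; exact: exp_coord_upper.
  by exists (ln_coord y) => //; rewrite /Psi ln_coordK.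
Qed.

(** In the parameters of the plane the immersion is a local diffeomorphism, so
    its range is open in the plane; it is closed and the plane is
    connected. *)
Lemma immersed_covers (S : oriented_surface R) (Phi : S -> 'rV[R]_3) : immersion_H3 Phi ->
  range Phi `<=` quadric m -> closed_in_H3 (range Phi) -> range Phi = quadric m.
Proof.
move=> imm sub cl; apply/seteqP; split => //.
pose A : set 'rV[R]_2 := [set y | range Phi (Y (exp_coord y))].
have [_ oE cE hE] := @half_plane_chartP R.
have cexp y : {for y, continuous (@exp_coord R)} by have [//|_ _] := cE y.
have cY y : {for y, continuous (fun y => Y (exp_coord y))}.
  by apply: (cvg_comp (@exp_coord R) Y); [exact: cexp|exact: continuous_mulmx].
suff AT : A = setT.
  rewrite -vertical_image => _ [y hy <-]; rewrite -(ln_coordK hy).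
  by have : A (ln_coord y) by rewrite AT.
have Aq s : quad m (Phi s) = 0 by have [] := sub (Phi s) (imageT _ s).
have key s : \forall w \near (Phi s *m vertical_proj), range Phi (w *m vertical_mx).
  have [c Ac ds] := atlas_cover s; have [_ _ hD _] := atlas_chart Ac; have [Oy e _] := hD s ds.
  have := immersion_chart imm Ac; cbv zeta; set X := Phi \o _ => -[oC sX hX nX].
  set y := chart_map c s in Oy e.
  pose G z := X z *m vertical_proj.
  have sG : smooth_on (chart_cod c) G by exact: (pd_linear vertical_proj 0 oC sX Oy).1.
  have dG i := (pd_linear vertical_proj i oC sX Oy).2.
  have tX i : pd i X y *m vertical_proj *m vertical_mx = pd i X y.
    apply: vertical_projK.
    have dx l := is_derive_pd_coord i l oC sX Oy.
    have := is_derive_eq_on oC Oy (fun z _ => Aq _) (is_derive_quad m dx) (is_derive_const 0 y (basis_vec i)).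
    by rewrite /dquad m30 mulr0 mul0r addr0.
  have -> : Phi s *m vertical_proj = G y by rewrite /G /X /= e.
  apply: filterS (open_map oC Oy (fun j => (smooth_onP _ oC).1 sG j 1%N) _).
    move=> _ [z Oz <-]; rewrite /G vertical_projK; first by exists (chart_inv c z).
    by have := Aq (chart_inv c z); rewrite vertical_quad.
  rewrite (_ : \matrix_(i, j) _ = \matrix_(i, j) (pd i X y *m vertical_proj) 0 j); last first.
    by apply/matrixP => i j; rewrite [LHS]mxE [RHS]mxE -dG (pd_coord _ _ oC sG Oy) -pdE.
  have := nX y Oy; rewrite /normal_field -(tX 0) -(tX 1).
  have := crossp_vertical (pd 0 X y *m vertical_proj) (pd 1 X y *m vertical_proj); cbv zeta => -[-> _].
  rewrite det2E ![(\matrix_(i, j) _) _ _]mxE => h; apply: contraTneq h => ->.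
  by rewrite expr0n mulr0 ltxx.
have memA y : A y -> \forall y' \near y, A y'.
  move=> [s _ es]; have := key s; rewrite es vertical_mxK => h.
  exact: (cexp y) h.
apply: (@connected_row_space R 2).
- have [s _] := @surface_nonempty R S; have := sub (Phi s) (imageT _ s).
  rewrite -vertical_image => -[y hy e]; exists (ln_coord y).
  by rewrite /A /= ln_coordK //; exists s.
- exists A; rewrite ?setTI //; rewrite openE => y; exact: memA.
exists A; rewrite ?setTI // => y cy; apply: cl; split; last by apply: vertical_H3; exact: exp_coord_upper.
move=> B hB; have [y' [Ay' By']] := cy _ (cY y _ hB).
by exists (Y (exp_coord y')).
Qed.

End VerticalPlanes.

(** * Pulling a surface back by an isometry *)
Section Pullback.
Context {R : realType}.
Variables (g : 'rV[R]_3 -> 'rV[R]_3) (M : 'M[R]_4).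
Hypotheses (ig : isometry_H3 g) (uM : M \in unitmx).
Hypothesis lM : forall u v, mink (u *m M) (v *m M) = mink u v.
Hypothesis gM : forall x, H3 x -> lift (g x) = lift x *m M.

Lemma inverse_lorentz u v : mink (u *m invmx M) (v *m invmx M) = mink u v.
Proof. by rewrite -lM !mulmxKV. Qed.

Lemma isometry_continuous x : H3 x -> {for x, continuous g}.
Proof. by have [_ sg _] := ig; exact: (sg 0%N).1. Qed.

Lemma isometry_inj x y : H3 x -> H3 y -> g x = g y -> x = y.
Proof. by have [[_ gI _] _ _] := ig; move=> hx hy; apply: gI; rewrite inE. Qed.

(** Smoothness of the inverse of g is read from lifts: the lift of Phi is linear
    in the lift of Psi, and the coordinates of a point are rational in its
    lift. *)
Lemma pullback_surface (S : oriented_surface R) (Psi : S -> 'rV[R]_3) : immersion_H3 Psi ->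
  exists Phi : S -> 'rV[R]_3, immersion_H3 Phi /\ forall s, g (Phi s) = Psi s.
Proof.
move=> imm; have [[_ _ gS] _ _] := ig.
have /choice[Phi PhiP] : forall s, exists x, H3 x /\ g x = Psi s.
  by move=> s; have [x hx e] := gS _ (imm.1 s); exists x.
exists Phi; split; last by move=> s; exact: (PhiP s).2.
split=> [s|c Ac]; first exact: (PhiP s).1.
have := immersion_chart imm Ac; cbv zeta.
set X := Psi \o _; set Y := Phi \o _ => -[oC sX hX nX].
have hY y : chart_cod c y -> H3 (Y y) by move=> _; exact: (PhiP _).1.
have YX y : chart_cod c y -> lift (Y y) = lift (X y) *m invmx M.
  by move=> Oy; rewrite /X /= -(PhiP _).2 gM ?mulmxK //; exact: hY.
have sU : smooth_on (chart_cod c) (fun y => lift (Y y)).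
  apply: (smooth_on_eq (W := fun y => lift (X y) *m invmx M)) => //; first by move=> y /YX.
  move=> k; case: (pselect (exists y, chart_cod c y)) => [[y Oy]|ne].
    exact: (pd_linear (invmx M) 0 oC (smooth_on_lift oC sX hX) Oy).1.
  apply/Ck_on_coordP => // j; apply: (Ck_eq (f := fun=> 0)) => //; last exact: Ck_cst.
  by move=> y Oy; case: ne; exists y.
have u0 y : chart_cod c y -> lift (Y y) 0 m0 != 0.
  by move=> /hY hy; rewrite mxE /= invr_eq0 gt_eqF.
have sc := (smooth_onP _ oC).1 sU.
have sY : smooth_on (chart_cod c) Y.
  apply/smooth_onP => // j; case: (ord3P j) => ->.
  - apply: (smooth_eq (f := fun y => lift (Y y) 0 m1 * (lift (Y y) 0 m0)^-1)) => // [y /hY hy|].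
      by rewrite !mxE /= invrK divfK // gt_eqF.
    by apply: smoothM => //; apply: smoothV.
  - apply: (smooth_eq (f := fun y => lift (Y y) 0 m2 * (lift (Y y) 0 m0)^-1)) => // [y /hY hy|].
      by rewrite !mxE /= invrK divfK // gt_eqF.
    by apply: smoothM => //; apply: smoothV.
  - apply: (smooth_eq (f := fun y => (lift (Y y) 0 m0)^-1)) => // [y _|]; first by rewrite mxE /= invrK.
    by apply: smoothV.
split => // y Oy; apply/(row_free_crossp (a := pd 0 Y y) (b := pd 1 Y y)).
- by rewrite rowK -pdE.
- by rewrite rowK -pdE.
exact: (patch_immersed oC sY sX hY hX inverse_lorentz YX Oy (nX _ Oy)).
Qed.

Lemma pullback_closed (S : Type) (Phi Psi : S -> 'rV[R]_3) :
  (forall s, H3 (Phi s)) -> (forall s, g (Phi s) = Psi s) ->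
  closed_in_H3 (range Psi) -> closed_in_H3 (range Phi).
Proof.
move=> hPhi e cl x [cx hx]; have [[gH _ _] _ _] := ig.
have [|s _ es] := cl (g x).
  split; last exact: gH.
  move=> B hB; have [y [[s _ <-] By]] := cx _ (isometry_continuous hx hB).
  by exists (Psi s); split => //; rewrite -e.
by exists s => //; apply: isometry_inj => //; rewrite e.
Qed.

End Pullback.

Section HomothetyInvariantShrinkers.
Context {R : realType}.

(** The covector m is the conormal at any point: m_3 is nu_3, and m_0 is a
    multiple of dotp nu X because nu_3 = 0. *)
Lemma invariant_shrinker_vertical (S : oriented_surface R) (Phi : S -> 'rV[R]_3) (L : 'rV[R]_4) :
  immersion_H3 Phi -> (forall t s, 0 < t -> range Phi (t *: Phi s)) ->
  (forall c, atlas c -> forall y, chart_cod c y -> shrinker_eq (Phi \o chart_inv c) y L) ->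
  mink L L = 0 -> L != 0 ->
  exists m : 'rV[R]_4, [/\ m 0 m0 = 0, m 0 m3 = 0, m != 0 & range Phi `<=` quadric m].
Proof.
move=> imm inv shr L0 Ln0.
have flat c : atlas c -> forall y, chart_cod c y -> [/\ normal_field (Phi \o chart_inv c) y 0 ord_max = 0,
   dotp (normal_field (Phi \o chart_inv c) y) ((Phi \o chart_inv c) y) = 0 &
   second_form (Phi \o chart_inv c) y = 0].
  move=> Ac; have := homothety_tangent imm inv Ac; have := shr c Ac; have := immersion_chart imm Ac; cbv zeta.
  set X := Phi \o _ => -[oC sX hX nX] shX tX y Oy.
  have v := cone_vertical oC sX hX nX tX shX L0 Ln0.
  split; [exact: v|exact: tX|].
  apply/matrixP => i j; rewrite [RHS]mxE second_formE; last exact: nX.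
    by rewrite (cone_flat oC sX nX tX v) // v // mulr0 mul0r addr0 mulr0.
  by rewrite gt_eqF //; exact: hX.
have [s0 _] := @surface_nonempty R S; have [c Ac ds] := atlas_cover s0.
have [_ _ hD _] := atlas_chart Ac; have [Oy e _] := hD s0 ds.
have [n3 tX _] := flat c Ac _ Oy.
have q := geodesic_quad imm (fun c Ac y Oy => let: And3 _ _ h := flat c Ac y Oy in h) Ac ds.
have [_ _ hX nX] := immersion_chart imm Ac.
exists (conormal_field (Phi \o chart_inv c) (chart_map c s0)).
have [c0 _ _ c3] := conormalE ((Phi \o chart_inv c) (chart_map c s0)) (normal_field (Phi \o chart_inv c) (chart_map c s0)).
split.
- rewrite /conormal_field c0 n3 mul0r add0r; apply/eqP; rewrite oppr_eq0; apply/eqP.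
  move: tX; rewrite dotpE n3 mul0r addr0 => tX.
  by rewrite [_ * normal_field _ _ 0 0]mulrC [_ * normal_field _ _ 0 1]mulrC tX mulr0.
- by rewrite /conormal_field c3.
- by apply: conormal_neq0; [rewrite gt_eqF //; exact: hX|exact: nX].
- by move=> _ [s _ <-]; split; [exact: imm.1|exact: q].
Qed.

End HomothetyInvariantShrinkers.

(** * Ideal points *)
Section IdealBoundary.
Context {R : realType}.
Implicit Types (A P : set 'rV[R]_3) (w : 'rV[R]_2) (x : 'rV[R]_3) (m v : 'rV[R]_4) (a : ideal_point R).

Definition ideal_embed_row w : 'rV[R]_3 := row_mx w (0 : 'rV[R]_1).

Lemma ideal_nbhs_finite w A : ideal_nbhs (Some w) A <->
  exists2 e : R, 0 < e & forall x, H3 x -> ball (ideal_embed_row w) e x -> A x.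
Proof.
split=> [[U nU UA]|[e e0 eA]].
  have [e e0 eU] : exists2 e : R, 0 < e & forall x, ball (ideal_embed_row w) e x -> U (Some x).
    exact: near_ball nU.
  by exists e => // x hx hb; apply: UA; split => //; exact: eU.
exists (Some @` ball (ideal_embed_row w) e).
  by apply: one_point_compactification_some_nbhs; exact: nbhsx_ballx.
by move=> x [hx [y hy [e1]]]; apply: eA => //; rewrite -e1.
Qed.

Lemma ideal_nbhs_infinity A : ideal_nbhs ideal_infinity A <->
  exists r : R, forall x, H3 x -> r < `|x| -> A x.
Proof.
split=> [[U [W [cW _] WU] UA]|[r rA]].
  have [r [_ rW]] := compact_bounded cW.
  exists (r + 1) => x hx rx; apply: UA; split => //; apply: WU; left; exists x => //= Wx.
  by have /= := rW (r + 1) (ltr_pwDr ltr01 (lexx _)) x Wx; rewrite leNgt rx.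
exists (Some @` (~` [set x : 'rV[R]_3 | `|x| <= r]) `|` [set None]).
  exists [set x : 'rV[R]_3 | `|x| <= r] => //; split.
    apply: bounded_closed_compact.
      exists r; split=> [|t ht z /= hz]; first exact: num_real.
      exact: le_trans hz (ltW ht).
    have := @closed_cball R 3 0 r; rewrite (_ : [set _ | _] = [set x : 'rV[R]_3 | `|x| <= r]) //.
    by apply/funext => y /=; rewrite subr0.
  have := @closed_cball R 3 0 r; rewrite (_ : [set _ | _] = [set x : 'rV[R]_3 | `|x| <= r]) //.
  by apply/funext => y /=; rewrite subr0.
by move=> x [hx [[y /= hy [e1]]|//]]; apply: rA => //; rewrite -e1 ltNge; apply/negP.
Qed.

Definition axis (s : R) : 'rV[R]_3 := s *: dz.

Lemma axisE s : [/\ axis s 0 0 = 0, axis s 0 1 = 0 & axis s 0 ord_max = s].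
Proof. by rewrite /axis /dz; split; rewrite mxE basis_vecE /= ?mulr0 ?mulr1. Qed.

Lemma axis_H3 s : 0 < s -> H3 (axis s).
Proof. by move=> s0; rewrite /H3 /= /height; have [_ _ ->] := axisE s. Qed.

Lemma norm_axis s : `|axis s| = `|s|.
Proof.
have [e0 e1 e2] := axisE s; apply/eqP; rewrite eq_le; apply/andP; split.
  apply: norm_le_coord => // j; case: (ord3P j) => ->; rewrite ?e0 ?e1 ?e2 ?normr0 //.
by have := coord_le_norm (axis s) ord_max; rewrite e2.
Qed.

Lemma ideal_nbhs_origin_axis A : ideal_nbhs ideal_origin A ->
  exists2 d : R, 0 < d & forall s, 0 < s -> s < d -> A (axis s).
Proof.
move=> /ideal_nbhs_finite[e e0 eA]; exists e => // s s0 se; apply: eA; first exact: axis_H3.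
have -> : ideal_embed_row 0 = 0 by rewrite /ideal_embed_row row_mx0.
by rewrite -ball_normE /= sub0r normrN norm_axis gtr0_norm.
Qed.

Lemma ideal_nbhs_infinity_axis A : ideal_nbhs ideal_infinity A ->
  exists2 d : R, 0 < d & forall s, 0 < s -> s < d -> A (axis s^-1).
Proof.
move=> /ideal_nbhs_infinity[r rA]; exists (`|r| + 1)^-1; first by rewrite invr_gt0 ltr_wpDl.
move=> s s0 sd; apply: rA; first by apply: axis_H3; rewrite invr_gt0.
rewrite norm_axis gtr0_norm ?invr_gt0 //.
apply: (@lt_trans _ _ (`|r| + 1)); first by rewrite (le_lt_trans (ler_norm r)) // ltrDl.
by rewrite -[ltLHS]invrK ltf_pV2 // posrE invr_gt0 ltr_wpDl.
Qed.

Lemma vertical_quad_axis m s : m 0 m0 = 0 -> m 0 m3 = 0 -> quad m (axis s) = 0.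
Proof. by move=> h0 h3; rewrite vertical_quad //; have [-> -> _] := axisE s; rewrite !mulr0 addr0. Qed.

Lemma vertical_at_infinity g m a : m 0 m0 = 0 -> m 0 m3 = 0 ->
  ideal_maps g ideal_origin a \/ ideal_maps g ideal_infinity a -> at_infinity (g @` quadric m) a.
Proof.
move=> h0 h3 ga A hA.
have [s s0 As] : exists2 s, 0 < s & A (g (axis s)).
  case: ga => /(_ A hA) hB.
    have [d d0 dA] := ideal_nbhs_origin_axis hB; exists (d / 2); first by rewrite divr_gt0.
    by apply: dA; [rewrite divr_gt0|rewrite ltr_pdivrMr // ltr_pMr // ltr1n].
  have [d d0 dA] := ideal_nbhs_infinity_axis hB; exists (d / 2)^-1; first by rewrite invr_gt0 divr_gt0.
  by apply: dA; [rewrite divr_gt0|rewrite ltr_pdivrMr // ltr_pMr // ltr1n].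
exists (g (axis s)); split => //; exists (axis s) => //; split; [exact: axis_H3|exact: vertical_quad_axis].
Qed.

(** Rescaled lifts of points that tend to an ideal point tend to a null vector,
    (1, w, |w|^2) or [e3]; this is the value of m on that vector. *)
Definition boundary_quad m a : R := if a is Some w then quad m (ideal_embed_row w) else m 0 m3.

(** The norm of row vectors is the sup norm. *)
Lemma dotp_norm_ge x : `|x| ^+ 2 <= dotp x x.
Proof.
have h j : x 0 j ^+ 2 <= dotp x x.
  rewrite dotpE -!expr2; have a0 := sqr_ge0 (x 0 0); have a1 := sqr_ge0 (x 0 1); have a2 := sqr_ge0 (x 0 ord_max).
  case: (ord3P j) => ->.
  - by rewrite -addrA lerDl addr_ge0.
  - by rewrite addrAC lerDr addr_ge0.
  - by rewrite lerDr addr_ge0.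
have d0 := dotp_ge0 x.
have : `|x| <= Num.sqrt (dotp x x).
  apply: norm_le_coord => [|j]; first exact: sqrtr_ge0.
  by rewrite -sqrtr_sqr ler_wsqrtr.
by rewrite -(ler_pXn2r (ltn0Sn 1)) ?nnegrE ?sqrtr_ge0 // sqr_sqrtr.
Qed.

Lemma quad_infinity m : m 0 m3 != 0 -> exists r, forall x, r < `|x| -> quad m x != 0.
Proof.
move=> m30; have c0 : 0 < `|m 0 m3| by rewrite normr_gt0.
pose C := `|m 0 m0| + `|m 0 m1| + `|m 0 m2|.
have C0 : 0 <= C by rewrite !addr_ge0.
exists (1 + C / `|m 0 m3|) => x hx; apply/eqP => q.
have x1 : 1 <= `|x| by apply: le_trans (ltW hx); rewrite lerDl divr_ge0 // ltW.
have le1 : `|m 0 m3| * dotp x x <= C * `|x|.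
  have -> : `|m 0 m3| * dotp x x = `|m 0 m0 + m 0 m1 * x 0 0 + m 0 m2 * x 0 1|.
    rewrite -[X in X * _ = _](ger0_norm (normr_ge0 _)) normr_id -{1}(ger0_norm (dotp_ge0 x)) -normrM.
    rewrite -[LHS]normrN; congr `|_|; apply/eqP; rewrite eq_sym -addr_eq0; apply/eqP; exact: q.
  rewrite /C !mulrDl; apply: le_trans (ler_normD _ _) _; apply: lerD.
    apply: le_trans (ler_normD _ _) _; apply: lerD; first by rewrite ler_peMr.
    by rewrite normrM ler_wpM2l // coord_le_norm.
  by rewrite normrM ler_wpM2l // coord_le_norm.
have le2 : `|m 0 m3| * `|x| ^+ 2 <= C * `|x|.
  by apply: le_trans le1; rewrite ler_wpM2l // dotp_norm_ge.
have x0 : 0 < `|x| by apply: lt_le_trans x1.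
move: le2; rewrite expr2 mulrA ler_pM2r // mulrC -ler_pdivlMr // => le2.
move: hx; rewrite ltNge => /negP; apply; apply: le_trans le2 _.
by rewrite lerDr.
Qed.

(** By continuity at a finite point; at infinity the term m_3 r^2 dominates. *)
Lemma boundary_quad0 P m a : (forall x, P x -> quad m x = 0) -> P `<=` H3 -> at_infinity P a ->
  boundary_quad m a = 0.
Proof.
move=> q PH; case: a => [w|] h /=; apply/eqP; apply: contraT => n0.
  have [e e0 eP] : exists2 e : R, 0 < e & forall x, ball (ideal_embed_row w) e x -> quad m x != 0.
    by have := open_nbhs_nbhs (conj (@open_neq R 0) n0) => /(@continuous_quad R m _) /near_ball.
  have [x [Px qx]] : P `&` [set x | quad m x != 0] !=set0.
    by apply: h; apply/ideal_nbhs_finite; exists e => // x _; exact: eP.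
  by move: qx; rewrite /= (q _ Px) eqxx.
have [r rP] := quad_infinity n0.
have [x [Px qx]] : P `&` [set x | quad m x != 0] !=set0.
  by apply: h; apply/ideal_nbhs_infinity; exists r => x _; exact: rP.
by move: qx; rewrite /= (q _ Px) eqxx.
Qed.

End IdealBoundary.

Section BoundaryLimits.
Context {R : realType}.
Implicit Types (m v w : 'rV[R]_4) (a : ideal_point R).

Lemma small_parameter (d b c : R) : 0 < d -> 0 < b -> exists s : R, [/\ 0 < s, s < d, s <= 1 & s ^+ 2 * `|c| <= b].
Proof.
move=> d0 b0; pose s := Num.min (d / 2) (Num.min 1 (b / (`|c| + 1))).
have c0 : 0 < `|c| + 1 by rewrite ltr_wpDl.
have s0 : 0 < s by rewrite !lt_min divr_gt0 // ltr01 divr_gt0.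
have s1 : s <= 1 by rewrite !ge_min lexx orbT.
have sb : s <= b / (`|c| + 1) by rewrite !ge_min lexx !orbT.
exists s; split => //.
  apply: (@le_lt_trans _ _ (d / 2)); first by rewrite ge_min lexx.
  by rewrite ltr_pdivrMr // ltr_pMr // ltr1n.
apply: (@le_trans _ _ (s * (`|c| + 1))); last by rewrite -ler_pdivlMr.
apply: ler_pM; rewrite ?sqr_ge0 ?lerDl //.
by rewrite expr2 ger_pMl.
Qed.

(** The curve G tends to a, and s times its lift tends to the null vector v, which
    therefore represents a. If a is finite, the value of m on s lift (G s) is
    the product of a bounded factor and [quad] m (G s), which tends to
    [boundary_quad] m a = 0. If a is infinity, v has v_0 = 0 since otherwise
    G would remain bounded, so v is a multiple of [e3]. The form s^-1 (v + s^2 w)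
    is that of the lift of the vertical axis, traversed in either direction. *)
Lemma boundary_limit (G : R -> 'rV[R]_3) v w m a :
  (forall s, 0 < s -> H3 (G s) /\ lift (G s) = s^-1 *: (v + s ^+ 2 *: w)) ->
  (forall A, ideal_nbhs a A -> exists2 d : R, 0 < d & forall s, 0 < s -> s < d -> A (G s)) ->
  mink v v = 0 -> boundary_quad m a = 0 -> (v *m m^T) 0 0 = 0.
Proof.
move=> GL lim v0 bm.
pose u s := v + s ^+ 2 *: w.
have uE s k : u s 0 k = v 0 k + s ^+ 2 * w 0 k by rewrite !mxE.
have rel s : 0 < s -> u s 0 m0 != 0 /\ (forall m, (u s *m m^T) 0 0 = u s 0 m0 * quad m (G s)).
  move=> s0; have [hG lG] := GL s s0; have sn := lt0r_neq0 s0; have zn := lt0r_neq0 hG.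
  have us : u s = s *: lift (G s) by rewrite lG scalerA mulfV // scale1r.
  have u00 : u s 0 m0 = s / (G s) 0 ord_max by rewrite us !mxE.
  split; first by rewrite u00 mulf_neq0 // invr_neq0.
  move=> m'; rewrite u00 quad_lift // us -scalemxAl mxE.
  by rewrite mulrA divfK.
have mulE (u1 m' : 'rV[R]_4) : (u1 *m m'^T) 0 0 = u1 0 m0 * m' 0 m0 + u1 0 m1 * m' 0 m1 + u1 0 m2 * m' 0 m2 + u1 0 m3 * m' 0 m3.
  by rewrite mxE sum_ord4 !mxE.
case: a lim bm => [b|] lim /= bm.
- apply/eqP; apply: contraT => kn.
  set k := (v *m m^T) 0 0 in kn; set k' := (w *m m^T) 0 0.
  have k0 : 0 < `|k| by rewrite normr_gt0.
  have B0 : 0 < 4 * (`|v 0 m0| + `|w 0 m0| + 1) by rewrite mulr_gt0 // ltr_wpDl // addr_ge0.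
  pose e := `|k| / (4 * (`|v 0 m0| + `|w 0 m0| + 1)).
  have e0 : 0 < e by rewrite divr_gt0.
  have hA : ideal_nbhs (Some b) [set x | `|quad m x| < e].
    apply/ideal_nbhs_finite.
    have /cvgrPdist_lt /(_ e e0) h := @continuous_quad R m (ideal_embed_row b).
    have [r r0 rP] := near_ball h; exists r => // x _ /rP; by rewrite bm sub0r normrN.
  have [d d0 dA] := lim _ hA.
  have [s [s0 sd s1 sk]] := small_parameter k' d0 (divr_gt0 k0 (ltr0Sn _ 1)).
  have [_ /(_ m)] := rel s s0; have qs : `|quad m (G s)| < e := dA s s0 sd.
  have -> : (u s *m m^T) 0 0 = k + s ^+ 2 * k' by rewrite /u mulmxDl -scalemxAl mxE [X in _ + X]mxE.
  move=> E; have n1 : `|k| / 2 <= `|k + s ^+ 2 * k'|.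
    apply: le_trans (lerB_normD _ _); rewrite normrM (ger0_norm (sqr_ge0 _)).
    move: sk; move: (s ^+ 2 * `|k'|) (`|k|) => p q; clear; lra.
  have n2 : `|u s 0 m0 * quad m (G s)| <= (`|v 0 m0| + `|w 0 m0|) * e.
    rewrite normrM; apply: ler_pM => //; last exact: ltW.
    rewrite uE; apply: le_trans (ler_normD _ _) _; rewrite lerD2l normrM (ger0_norm (sqr_ge0 _)).
    by rewrite ler_piMl // expr_le1 // ltW.
  have n3 : (`|v 0 m0| + `|w 0 m0|) * e <= `|k| / 4.
    rewrite (_ : `|k| / 4 = (`|v 0 m0| + `|w 0 m0| + 1) * e); first by rewrite ler_wpM2r ?lerDl // ltW.
    rewrite /e; have : `|v 0 m0| + `|w 0 m0| + 1 != 0 by rewrite gt_eqF // ltr_wpDl // addr_ge0.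
    by move: (_ + _ + 1) (`|k|) => p q pn; field.
  move: n1; rewrite E => n1; have := le_trans n1 (le_trans n2 n3).
  by move: k0; move: (`|k|) => q; clear; lra.
have v00 : v 0 m0 = 0.
  apply/eqP; apply: contraT => vn.
  have vp : 0 < `|v 0 m0| by rewrite normr_gt0.
  pose C := `|v 0 m3| + `|w 0 m3|.
  have C0 : 0 <= C by rewrite addr_ge0.
  pose r := 1 + 2 * C / `|v 0 m0|.
  have r1 : 1 <= r by rewrite lerDl divr_ge0 // mulr_ge0.
  have hA : ideal_nbhs ideal_infinity [set x : 'rV[R]_3 | r < `|x|] by apply/ideal_nbhs_infinity; exists r.
  have [d d0 dA] := lim _ hA.
  have [s [s0 sd s1 sk]] := small_parameter (w 0 m0) d0 (divr_gt0 vp (ltr0Sn _ 1)).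
  have /= rs := dA s s0 sd; have [_ /(_ e3)] := rel s s0.
  rewrite mulE /quad /e3 !mxE /= !(mulr0, mulr1, mul0r, add0r) mul1r => E.
  have n1 : `|v 0 m0| / 2 <= `|u s 0 m0|.
    rewrite uE; apply: le_trans (lerB_normD _ _); rewrite normrM (ger0_norm (sqr_ge0 _)).
    move: sk; move: (s ^+ 2 * `|w 0 m0|) (`|v 0 m0|) => p q; clear; lra.
  have n2 : `|u s 0 m0| * dotp (G s) (G s) <= C.
    rewrite uE -{1}(ger0_norm (dotp_ge0 (G s))) -normrM -E.
    apply: le_trans (ler_normD _ _) _; rewrite lerD2l normrM (ger0_norm (sqr_ge0 _)).
    by rewrite ler_piMl // expr_le1 // ltW.
  have n3 : r < dotp (G s) (G s).
    apply: lt_le_trans (dotp_norm_ge _); apply: (lt_le_trans rs).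
    by rewrite expr2 ler_peMl // (le_trans r1) // ltW.
  have n4 : `|v 0 m0| / 2 * r <= C.
    by apply: le_trans n2; apply: ler_pM => //; [exact: le_trans r1|exact: ltW].
  have n5 : `|v 0 m0| / 2 * r = `|v 0 m0| / 2 + C.
    by rewrite /r; have pn := lt0r_neq0 vp; field.
  by move: n4; rewrite n5 gerDr leNgt divr_gt0.
have [v1 v2] : v 0 m1 = 0 /\ v 0 m2 = 0.
  move: v0; rewrite /mink v00 !(mul0r, mulr0) addr0 mul0r sub0r => /eqP.
  rewrite -opprD oppr_eq0 -!expr2 paddr_eq0 ?sqr_ge0 // !sqrf_eq0 => /andP[/eqP -> /eqP ->] //.
by rewrite mulE v00 v1 v2 bm !(mul0r, mulr0) !addr0.
Qed.

End BoundaryLimits.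

(** * The two implications *)
Section TranslationGroups.
Context {R : realType}.
Variables (g : 'rV[R]_3 -> 'rV[R]_3) (M : 'M[R]_4) (p q : ideal_point R).
Hypothesis ig : isometry_H3 g.
Hypothesis lM : forall u v, mink (u *m M) (v *m M) = mink u v.
Hypothesis gM : forall x, H3 x -> lift (g x) = lift x *m M.
Hypotheses (gp : ideal_maps g ideal_origin p) (gq : ideal_maps g ideal_infinity q).

Let E0 : 'rV[R]_4 := delta_mx 0 m0.
Let E3 : 'rV[R]_4 := delta_mx 0 m3.

Let lift_axis s : 0 < s -> lift (axis s) = s^-1 *: E0 + s *: E3.
Proof.
move=> s0; have [e0 e1 e2] := axisE s; have sn := lt0r_neq0 s0.
by apply/rowP; apply: ord4P; rewrite !mxE /= ?e0 ?e1 ?e2 /=; field.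
Qed.

Let mink0 : mink E0 E0 = 0 /\ mink E3 E3 = 0.
Proof. by rewrite /mink !mxE /=; split; ring. Qed.

Let pair_row (i : 'I_4) (m : 'rV[R]_4) : ((delta_mx 0 i : 'rV[R]_4) *m M *m m^T) 0 0 = (m *m M^T) 0 i.
Proof.
rewrite -mulmxA -rowE mxE -[M in LHS]trmxK -trmx_mul.
by rewrite mxE.
Qed.

(** The image under g of the vertical axis ends at p, and the lift of the axis
    is proportional in the limit to the first basis vector. *)
Lemma pullback_origin m : boundary_quad m p = 0 -> (m *m M^T) 0 m0 = 0.
Proof.
move=> bm; rewrite -pair_row; have [[gH _ _] _ _] := ig.
apply: (@boundary_limit R (fun s => g (axis s)) (E0 *m M) (E3 *m M) m p) => //.
- move=> s s0; have hs := axis_H3 s0; split; first exact: gH.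
  rewrite gM // lift_axis // mulmxDl -!scalemxAl scalerDr scalerA.
  by congr (_ + _ *: _); rewrite expr2 mulrA mulVf ?mul1r // gt_eqF.
- by move=> A /gp; exact: ideal_nbhs_origin_axis.
- by rewrite lM; exact: mink0.1.
Qed.

Lemma pullback_infinity m : boundary_quad m q = 0 -> (m *m M^T) 0 m3 = 0.
Proof.
move=> bm; rewrite -pair_row; have [[gH _ _] _ _] := ig.
apply: (@boundary_limit R (fun s => g (axis s^-1)) (E3 *m M) (E0 *m M) m q) => //.
- move=> s s0; have s0' : 0 < s^-1 by rewrite invr_gt0.
  have hs := axis_H3 s0'; split; first exact: gH.
  rewrite gM // lift_axis // invrK mulmxDl -!scalemxAl scalerDr scalerA addrC.
  by congr (_ + _ *: _); rewrite expr2 mulrA mulVf ?mul1r // gt_eqF.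
- by move=> A /gq; exact: ideal_nbhs_infinity_axis.
- by rewrite lM; exact: mink0.2.
Qed.

End TranslationGroups.

Section Conclusion.
Context {R : realType}.

Lemma pullback_neq0 (M : 'M[R]_4) (m : 'rV[R]_4) : M \in unitmx -> m != 0 -> m *m M^T != 0.
Proof.
move=> uM; apply: contraNneq => mM.
have uT : M^T \in unitmx by rewrite unitmx_tr.
by rewrite -[m](mulmxK uT) mM mul0mx.
Qed.

(** The equation of Psi has the null vector [e3]; that of the pulled-back surface
    has its preimage L under M. *)
Lemma shrinkers_are_planes (p q : ideal_point R) (h : R -> 'rV[R]_3 -> 'rV[R]_3) :
  translation_group p q h ->
  forall (S : oriented_surface R) (Psi : S -> 'rV[R]_3),
  horo_shrinker Psi -> invariant_by h (range Psi) ->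
  exists P : set 'rV[R]_3,
    [/\ totally_geodesic_plane P, at_infinity P p, at_infinity P q, range Psi `<=` P
      & closed_in_H3 (range Psi) -> range Psi = P].
Proof.
move=> [_ [g [ig gp gq gh]]] S Psi [imm shr] inv.
have [M [uM lM gM]] := isometry_lift ig.
have [Phi [immP e]] := pullback_surface ig uM lM gM imm.
have invP t s : 0 < t -> range Phi (t *: Phi s).
  move=> t0; have hs := immP.1 s.
  have ht : H3 (t *: Phi s) by rewrite /H3 /= /height mxE mulr_gt0.
  have [s' _ es] : range Psi (g (t *: Phi s)).
    by rewrite -gh // -(inv t t0) e; exists (Psi s) => //; exists s.
  by exists s' => //; apply: (isometry_inj ig) => //; [exact: immP.1|rewrite e].
pose L : 'rV[R]_4 := e3 *m invmx M.
have LM : L *m M = e3 by rewrite mulmxKV.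
have L0 : mink L L = 0 by rewrite -lM LM /mink !mxE /=; ring.
have Ln0 : L != 0.
  apply/eqP => l0; have := LM; rewrite l0 mul0mx => /rowP/(_ m3); rewrite !mxE /= => /eqP.
  by rewrite eq_sym oner_eq0.
have shP c : atlas c -> forall y, chart_cod c y -> shrinker_eq (Phi \o chart_inv c) y L.
  move=> Ac y Oy; have [oC sX hX nX] := immersion_chart imm Ac.
  have [_ sY hY _] := immersion_chart immP Ac.
  apply: (patch_shrinker oC sX sY hX hY uM lM _ Oy); first by move=> z Oz; rewrite /= -e gM //; exact: immP.1.
  by rewrite LM; apply/(mean_curvature_shrinker hX Oy (nX _ Oy)); exact: shr.
have [m [h0 h3 mn0 sub]] := invariant_shrinker_vertical immP invP shP L0 Ln0.
have rP : range Psi = g @` range Phi.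
  apply/seteqP; split => [_ [s _ <-]|_ [_ [s _ <-] <-]].
    by exists (Phi s) => //; exists s.
  by exists s => //; rewrite e.
exists (g @` quadric m); split.
- exact: vertical_plane_geodesic.
- by apply: vertical_at_infinity => //; left.
- by apply: vertical_at_infinity => //; right.
- by rewrite rP; exact: image_subset.
- move=> cl; rewrite rP; congr (_ @` _); apply: immersed_covers => //.
  exact: (pullback_closed ig immP.1 e).
Qed.

(** The entry m_3 of the conormal at a point is nu_3 at this point. *)
Lemma plane_normal (P : set 'rV[R]_3) (S : oriented_surface R) (Psi : S -> 'rV[R]_3) :
  immersion_H3 Psi ->
  (forall c, atlas c -> forall y, chart_cod c y -> second_form (Psi \o chart_inv c) y = 0) ->
  range Psi = P -> at_infinity P ideal_infinity ->
  forall c, atlas c -> forall y, chart_cod c y -> normal_field (Psi \o chart_inv c) y 0 ord_max = 0.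
Proof.
move=> imm geod rP inf c Ac y Oy; have [_ _ _ hC] := atlas_chart Ac.
have [ds ey _] := hC y Oy; have qd := geodesic_quad imm geod Ac ds.
have PH : P `<=` H3 by rewrite -rP => _ [s _ <-]; exact: imm.1.
have qP x : P x -> quad (conormal_field (Psi \o chart_inv c) y) x = 0.
  by rewrite -rP => -[s _ <-]; have := qd s; rewrite ey.
have := boundary_quad0 qP PH inf; rewrite /boundary_quad /conormal_field /ideal_infinity.
by have [_ _ _ ->] := conormalE ((Psi \o chart_inv c) y) (normal_field (Psi \o chart_inv c) y).
Qed.

Lemma vertical_scale t (x : 'rV[R]_3) (m : 'rV[R]_4) : m 0 m0 = 0 -> m 0 m3 = 0 -> 0 < t ->
  quadric m x -> quadric m (t *: x).
Proof.
move=> h0 h3 t0 [hx qx]; split; first by rewrite /H3 /= /height mxE mulr_gt0.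
move: qx; rewrite !vertical_quad // !mxE => qx.
by rewrite mulrCA [X in _ + X]mulrCA -mulrDr qx mulr0.
Qed.

(** With nu_3 = 0 and zero second fundamental form, both sides of the equation
    vanish for the given immersion. For invariance, the pulled-back immersion
    lies in a vertical plane through the origin, which it fills because P is
    closed. *)
Lemma planes_are_shrinkers (p q : ideal_point R) (h : R -> 'rV[R]_3 -> 'rV[R]_3) :
  translation_group p q h -> forall P : set 'rV[R]_3,
  totally_geodesic_plane P ->
  at_infinity P p -> at_infinity P q -> at_infinity P ideal_infinity ->
  invariant_by h P /\
  exists (S : oriented_surface R) (Psi : S -> 'rV[R]_3), horo_shrinker Psi /\ range Psi = P.
Proof.
move=> [_ [g [ig gp gq gh]]] P [cP [S [Psi [imm geod rP]]]] Pp Pq Pinf.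
have [M [uM lM gM]] := isometry_lift ig.
have PH : P `<=` H3 by rewrite -rP => _ [s _ <-]; exact: imm.1.
split; last first.
  exists S, Psi; split => //; split => // c Ac y Oy X.
  have [oC sX hX nX] := immersion_chart imm Ac.
  rewrite /mean_curvature /shape_operator geod // mulmx0 mxtrace0 mul0r unit_normal_pd /hmetric dotpZl.
  have -> : dotp (normal_field X y) dz = 0; last by rewrite mulr0 mul0r.
  by rewrite dotpE /dz !basis_vecE /= !mulr0 !add0r mulr1; exact: plane_normal imm geod rP Pinf c Ac y Oy.
have [s0 _] := @surface_nonempty R S; have [c Ac ds] := atlas_cover s0.
have [_ _ hX nX] := immersion_chart imm Ac.
have [_ _ hD _] := atlas_chart Ac; have [Oy _ _] := hD s0 ds.
have qd := geodesic_quad imm geod Ac ds.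
set m := conormal_field _ _ in qd.
have mn0 : m != 0 by apply: conormal_neq0; [rewrite gt_eqF //; exact: hX|exact: nX].
have qP x : P x -> quad m x = 0 by rewrite -rP => -[s _ <-].
have m'0 := pullback_origin ig lM gM gp (boundary_quad0 qP PH Pp).
have m'3 := pullback_infinity ig lM gM gq (boundary_quad0 qP PH Pq).
have m'n := pullback_neq0 uM mn0.
have [Phi [immP e]] := pullback_surface ig uM lM gM imm.
have sub : range Phi `<=` quadric (m *m M^T).
  move=> _ [s _ <-]; have hs := immP.1 s; split => //.
  by apply/(quad_transfer _ gM hs); rewrite e //; exact: imm.1.
have E := immersed_covers m'0 m'3 m'n immP sub.
have {}E : P = g @` quadric (m *m M^T).
  rewrite -E; last by apply: (pullback_closed ig immP.1 e); rewrite rP.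
  rewrite -rP; apply/seteqP; split => [_ [s _ <-]|_ [_ [s _ <-] <-]].
    by exists (Phi s) => //; exists s.
  by exists s => //; rewrite e.
have scal t x := @vertical_scale t x _ m'0 m'3.
move=> t t0; rewrite E; apply/seteqP; split => [_ [_ [x qx <-] <-]|_ [x qx <-]].
  by rewrite gh //; [exists (t *: x) => //; exact: scal|exact: qx.1].
have t0' : 0 < t^-1 by rewrite invr_gt0.
have qx' := scal _ _ t0' qx.
exists (g (t^-1 *: x)); first by exists (t^-1 *: x).
by rewrite gh //; [rewrite scalerA mulfV ?scale1r // gt_eqF|exact: qx'.1].
Qed.

End Conclusion.

Theorem theorem2p3 (R : realType) (p q : ideal_point R)
    (h : R -> 'rV[R]_3 -> 'rV[R]_3)
    (hpq : p <> q) (hh : translation_group p q h) :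
  (forall (S : oriented_surface R) (Psi : S -> 'rV[R]_3),
     horo_shrinker Psi -> invariant_by h (range Psi) ->
     exists P : set 'rV[R]_3,
       [/\ totally_geodesic_plane P,
           at_infinity P p,
           at_infinity P q,
           range Psi `<=` P
         & closed_in_H3 (range Psi) -> range Psi = P]) /\
  (forall P : set 'rV[R]_3,
     totally_geodesic_plane P ->
     at_infinity P p -> at_infinity P q -> at_infinity P ideal_infinity ->
     invariant_by h P /\
     exists (S : oriented_surface R) (Psi : S -> 'rV[R]_3),
       horo_shrinker Psi /\ range Psi = P).
Proof. by split; [exact: shrinkers_are_planes hh|exact: planes_are_shrinkers hh]. Qed.
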